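(* Fix $t_0>0$, $q\in\,]6,\infty]$ and $p\in\,]\frac{4q}{q-2},q[$ (with $\frac{4q}{q-2}=4$ if $q=\infty$). Let $\omega:=\sup_{s\in[0,t_0]}\operatorname{osc}(H_s)$, $\delta:=(17\omega)^{-1}$, and let $\tilde p$ be defined by $\tilde p^{-1}=q^{-1}+(p/2)^{-1}$. Let $N\in\mathbb N$ be such that $$N\ \ge\ 25\,\max\big(2,\ \bar C_{t_0}(p,q,\delta),\ \bar C_{t_0}(\tilde p,q,\delta)\big).$$ Then for every $t\in[0,t_0]$ and every $f:S\to\mathbb R$, $$N\,\mathbb E\big[|\langle f,\nu_t^N\rangle-\langle f,\mu_t\rangle|^2\big]\ \le\ \operatorname{Var}_{\mu_t}(f)+\int_0^tV_{s,t}(f)\,ds+\big[1+7\,\bar C_t(p,q,\delta)\,\varepsilon_t^{N,p}\big]\,\|f\|_{L^p(\mu_t)}^2 .$$ In particular, for every $t\in[0,t_0]$, $$\varepsilon_t^{N,p}\ \le\ (2+v_t(p))\,N^{-1}\,\big(1+10\,\bar C_t(p,q,\delta)\,N^{-1}\big),$$ where $$v_t(p):=\sup_{\tau\in[0,t]}\ \sup_{f\ne0}\ \frac{\int_0^\tau V_{s,\tau}(f)\,ds}{\|f\|_{L^p(\mu_\tau)}^2}.$$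
   Context: Setting. $S$ is a finite set and $\langle f,\nu\rangle=\sum_{x\in S}f(x)\nu(x)$ for $f:S\to\mathbb R$ and a measure $\nu$ on $S$. $(\mu_t)_{t\ge0}$ are strictly positive probability measures on $S$ of the form $\mu_t(x)=Z_t^{-1}\exp(-\mathcal U_t(x))\mu_0(x)$, with $t\mapsto\mathcal U_t(x)$ continuously differentiable for each $x$, and $H_t(x):=-\frac{\partial}{\partial t}\log\mu_t(x)$ (so $\langle H_t,\mu_t\rangle=0$). For each $t\ge0$, $\mathcal L_t$ is a generator ($Q$-matrix) on $S$, with $t\mapsto\mathcal L_t(x,y)$ continuous, satisfying detailed balance $\mu_t(x)\mathcal L_t(x,y)=\mu_t(y)\mathcal L_t(y,x)$; $(\mathcal L_tf)(x)=\sum_y\mathcal L_t(x,y)f(y)$. The constants $\lambda_t\ge0$ depend continuously on $t$. Particle system. For $N\in\mathbb N$, $X^N_t=(X^N_{t,1},\dots,X^N_{t,N})$ is, under $\mathbb P$, a right-continuous time-inhomogeneous Markov process on $S^N$ with initial distribution the $N$-fold product $\mu_0^N$ and generator at time $t$ $$\mathcal L_t^N\varphi(x)=\lambda_t\sum_{i=1}^N\mathcal L_t^{(i)}\varphi(x)+\frac1N\sum_{i,j=1}^N(H_t(x_i)-H_t(x_j))^+\big(\varphi(x^{i\to j})-\varphi(x)\big),$$ where $\mathcal L_t^{(i)}$ is $\mathcal L_t$ acting on the $i$-th component and $x^{i\to j}$ is $x$ with its $i$-th component replaced by $x_j$. Set $\eta_t^N=\frac1N\sum_{i=1}^N\delta_{X^N_{t,i}}$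 and $\nu_t^N=\exp\big(-\int_0^t\langle H_s,\eta_s^N\rangle ds\big)\eta_t^N$. Feynman-Kac operators. For $0\le s\le t$ and $f:S\to\mathbb R$, $s\mapsto q_{s,t}f$ is the unique solution on $[0,t]$ of $-\frac{\partial}{\partial s}q_{s,t}f=\lambda_s\mathcal L_sq_{s,t}f-H_sq_{s,t}f$ with $q_{t,t}f=f$. Notation. $\operatorname{osc}(g)=\sup g-\inf g$; $\operatorname{Var}_\mu(f)=\langle f^2,\mu\rangle-\langle f,\mu\rangle^2$; $$V_{s,t}(f)=-\langle H_s(q_{s,t}f)^2,\mu_s\rangle+\iint|H_s(x)|\,(q_{s,t}f(y)-q_{s,t}f(x))^2\,\mu_s(dx)\,\mu_s(dy);$$ $$\varepsilon_t^{N,p}=\sup\big\{\mathbb E[|\langle f,\nu_s^N\rangle-\langle f,\mu_s\rangle|^2]\ :\ s\in[0,t],\ f:S\to\mathbb R,\ \|f\|_{L^p(\mu_s)}\le1\big\}.$$ For $2\le p\le q\le\infty$, with $r\in[p,\infty]$ given by $p^{-1}=q^{-1}+r^{-1}$, $$C_{s,t}(p,q)=\max\Big(\sup_{f\ne0}\frac{\|q_{s,t}f\|_{L^{2r}(\mu_s)}}{\|f\|_{L^p(\mu_t)}},\ \sup_{f\ne0}\frac{\|q_{s,t}f\|_{L^p(\mu_s)}}{\|f\|_{L^{p/2}(\mu_t)}},\ 1\Big),$$ $$\bar C_t(p,q,\delta)=\sup_{\tau\in[0,t]}\int_0^{(\tau-\delta)^+}\|H_s\|_{L^q(\mu_s)}\,C_{s,\tau}(p,q)^2\,ds.$$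 Convention: $\delta=+\infty$ if $\omega=0$. *)

(* Defs.v *)
From HB Require Import structures.
From mathcomp Require Export all_boot all_order all_algebra.
From mathcomp Require Export all_classical all_reals all_analysis.
Export Order.TTheory GRing.Theory Num.Theory.
Export numFieldNormedType.Exports.
Set Implicit Arguments.
Unset Strict Implicit.
Unset Printing Implicit Defensive.

Local Open Scope classical_set_scope.
Local Open Scope ring_scope.

Section calculus.
Context {R : realType}.
Implicit Types (D : set R) (g : R -> R) (x l : R).

Definition diff_quotient_within D g x : set_system R :=
  (g u - g x) / (u - x) @[u --> within (D `\ x) (nbhs x)].

(* Derivative of the restriction of g to D: two-sided at interior points of D,
   one-sided at its endpoints. *)
Definition is_derive_within D g x l : Prop :=
  diff_quotient_within D g x --> l.

Definition derive_within D g x : R := lim (diff_quotient_within D g x).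

End calculus.

Section finite_space.
Context {R : realType} {S : finType}.
Implicit Types (f g m : S -> R) (p : \bar R).

(* A (signed) measure on S is given by its mass function. *)
Definition pairing f m : R := \sum_x f x * m x.

Definition variance_wrt m f : R :=
  pairing (fun x => f x ^+ 2) m - pairing f m ^+ 2.

Definition osc g : R := sup (range g) - inf (range g).

Definition lpnorm m p f : R :=
  match p with
  | r%:E => pairing (fun x => `|f x| `^ r) m `^ r^-1
  | +oo%E => \big[Num.max/0]_(x | 0 < m x) `|f x|
  | -oo%E => 0
  end.

Definition q_matrix (A : S -> S -> R) : Prop :=
  (forall x y, x != y -> 0 <= A x y) /\ (forall x, \sum_y A x y = 0).

Definition apply_kernel (A : S -> S -> R) f : S -> R :=
  fun x => \sum_y A x y * f y.

End finite_space.

Section setting.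
Context {R : realType} {S : finType}.
Implicit Types (mu U : R -> S -> R) (lam : R -> R) (L : R -> S -> S -> R).

Record evolving_measures mu U : Prop := EvolvingMeasures {
  evolving_pos : forall t x, 0 <= t -> 0 < mu t x ;
  evolving_mass1 : forall t, 0 <= t -> \sum_x mu t x = 1 ;
  evolving_C1 : forall x, exists dU : R -> R,
    (forall t, 0 <= t -> is_derive_within `[0, +oo[ (U ^~ x) t (dU t)) /\
    {within `[0, +oo[, continuous dU} ;
  evolving_density : exists Z : R -> R, forall t x, 0 <= t ->
    mu t x = (Z t)^-1 * expR (- U t x) * mu 0 x }.

(* H_t(x) = - d/dt log mu_t(x), the derivative being one-sided at t = 0. *)
Definition energy mu (t : R) (x : S) : R :=
  - derive_within `[0, +oo[ (fun u => ln (mu u x)) t.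

Record reversible_generators mu L : Prop := ReversibleGenerators {
  rev_generator : forall t, 0 <= t -> q_matrix (L t) ;
  rev_continuous : forall x y, {within `[0, +oo[, continuous (fun t => L t x y)} ;
  rev_balance : forall t x y, 0 <= t -> mu t x * L t x y = mu t y * L t y x }.

Definition move_rates lam : Prop :=
  (forall t, 0 <= t -> 0 <= lam t) /\ {within `[0, +oo[, continuous lam}.

(* Q s t f stands for q_{s,t} f; only its values for 0 <= s <= t matter. *)
Definition is_feynman_kac mu lam L (Q : R -> R -> (S -> R) -> S -> R) : Prop :=
  forall t f, 0 <= t ->
    (forall x, Q t t f x = f x) /\
    (forall s x, 0 <= s <= t ->
      is_derive_within `[0, t] (fun u => Q u t f x) s
        (- (lam s * apply_kernel (L s) (Q s t f) x
            - energy mu s x * Q s t f x))).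

End setting.

Section markov.
Context {R : realType} {E : finType}.

(* Transition function of the time-inhomogeneous Markov chain with generators
   A t.  As t |-> A t is only required to be the generator through Kolmogorov's
   forward equation, with a two-sided derivative at t > s, jumps at
   deterministic times are excluded. *)
Record transition_function (A : R -> (E -> R) -> E -> R)
    (p : R -> R -> E -> E -> R) : Prop := TransitionFunction {
  trans_ge0 : forall s t x y, 0 <= s <= t -> 0 <= p s t x y ;
  trans_mass1 : forall s t x, 0 <= s <= t -> \sum_y p s t x y = 1 ;
  trans_id : forall s x y, 0 <= s -> p s s x y = (x == y)%:R ;
  trans_comp : forall s t u x z, 0 <= s -> s <= t -> t <= u ->
    p s u x z = \sum_y p s t x y * p t u y z ;
  trans_forward : forall s t (phi : E -> R) x, 0 <= s <= t ->
    is_derive_within `[s, +oo[ (fun u => apply_kernel (p s u) phi x) t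
      (apply_kernel (p s t) (A t phi) x) }.

Context {d : measure_display} {T : measurableType d}.

Definition history (X : R -> T -> E) (s : R) : set (set T) :=
  <<s [set B | exists u x, 0 <= u <= s /\ B = X u @^-1` [set x]] >>.

Record markov_process (P : probability T R) (A : R -> (E -> R) -> E -> R)
    (init : E -> R) (X : R -> T -> E) : Prop := MarkovProcess {
  markov_measurable : forall t x, 0 <= t -> measurable (X t @^-1` [set x]) ;
  markov_rcontinuous : forall w t, 0 <= t -> \forall u \near t^'+, X u w = X t w ;
  markov_init : forall x, P (X 0 @^-1` [set x]) = (init x)%:E ;
  markov_property : exists2 p, transition_function A p &
    forall s t (B : set T) x y, 0 <= s <= t -> history X s B ->
      P (B `&` X s @^-1` [set x] `&` X t @^-1` [set y]) =
      (P (B `&` X s @^-1` [set x]) * (p s t x y)%:E)%E }.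

End markov.

Section particles.
Context {R : realType} {S : finType}.
Variables (N : nat) (mu : R -> S -> R) (lam : R -> R) (L : R -> S -> S -> R).
Local Notation config := {ffun 'I_N -> S}.
Implicit Types (c : config) (phi : config -> R).

Definition replace c (i : 'I_N) (y : S) : config :=
  [ffun k => if k == i then y else c k].

Definition component_generator (t : R) (i : 'I_N) phi c : R :=
  \sum_y L t (c i) y * phi (replace c i y).

Definition particle_generator (t : R) phi c : R :=
  lam t * (\sum_(i < N) component_generator t i phi c) +
  N%:R^-1 * \sum_(i < N) \sum_(j < N)
    Num.max (energy mu t (c i) - energy mu t (c j)) 0 *
    (phi (replace c i (c j)) - phi c).

Definition product_measure (m : S -> R) c : R := \prod_(i < N) m (c i).

Context {d : measure_display} {T : measurableType d}.
Variables (P : probability T R) (X : R -> T -> config).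

Definition is_particle_system : Prop :=
  markov_process P particle_generator (product_measure (mu 0)) X.

Definition empirical (t : R) (w : T) (x : S) : R :=
  N%:R^-1 * \sum_(i < N) (X t w i == x)%:R.

Definition weighted_empirical (t : R) (w : T) (x : S) : R :=
  expR (- \int[lebesgue_measure]_(s in `[0, t])
            pairing (energy mu s) (empirical s w)) * empirical t w x.

Definition mean_square_error (t : R) (f : S -> R) : \bar R :=
  'E_P[fun w =>
    `|pairing f (weighted_empirical t w) - pairing f (mu t)| ^+ 2].

Definition worst_error (t : R) (p : \bar R) : \bar R :=
  ereal_sup [set e | exists s f,
    [/\ 0 <= s <= t, lpnorm (mu s) p f <= 1 & e = mean_square_error s f]].

End particles.

Section constants.
Context {R : realType} {S : finType}.
Variables (mu : R -> S -> R) (Q : R -> R -> (S -> R) -> S -> R).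
Implicit Types (s t tau : R) (p q delta : \bar R) (f : S -> R).

Definition V_fk s t f : R :=
  - pairing (fun x => energy mu s x * Q s t f x ^+ 2) (mu s) +
  \sum_x \sum_y `|energy mu s x| * (Q s t f y - Q s t f x) ^+ 2
                * mu s x * mu s y.

Definition int_V t f : R := \int[lebesgue_measure]_(s in `[0, t]) V_fk s t f.

Definition op_norm s t (a b : \bar R) : \bar R :=
  ereal_sup [set (lpnorm (mu s) b (Q s t f) / lpnorm (mu t) a f)%:E
            | f in [set f | f <> (fun=> 0)]].

(* Inverses are taken in \bar R, where 0^-1 = +oo and +oo^-1 = 0. *)
Definition C_fk s t p q : \bar R :=
  let r := (p^-1 - q^-1)^-1%E in
  maxe (op_norm s t p (2%:E * r)%E)
    (maxe (op_norm s t (p / 2%:E)%E p) 1%E).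

Definition Cbar t p q delta : \bar R :=
  ereal_sup [set (\int[lebesgue_measure]_(s in
                      `[0%R, fine (maxe (tau%:E - delta) 0)])
                    ((lpnorm (mu s) q (energy mu s))%:E * C_fk s tau p q ^+ 2))%E
            | tau in `[0, t]].

Definition omega t0 : \bar R :=
  ereal_sup [set (osc (energy mu s))%:E | s in `[0, t0]].

(* Equal to +oo when omega t0 = 0, since 0^-1 = +oo in \bar R. *)
Definition gap t0 : \bar R := ((17%:E * omega t0)^-1)%E.

Definition v_fk t p : \bar R :=
  ereal_sup [set e | exists tau f,
    [/\ 0 <= tau <= t, f <> (fun=> 0) &
        e = (int_V tau f / lpnorm (mu tau) p f ^+ 2)%:E]].

(* The lower bound 4q/(q-2) for p, read as 4 when q is infinite. *)
Definition p_lower q : R :=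
  if q is r%:E then 4 * r / (r - 2) else 4.

End constants.

(* Main.v *)
(* The pairing of the weighted empirical measure with [Q s t f] is a martingale
   in [s], so [N] times its mean square error at time [t] is an initial variance
   plus the integral over [0, t] of a functional, quadratic in that measure, of
   [Q s t f]: the [dispersion].  Replacing products of empirical means by
   products of means under [mu s] turns the dispersion into [V_fk], at the cost
   of covariances, which the worst error [e] controls.  Up to time [t - gap] these
   contribute at most [6 e K |f|^2], where [K] is [Cbar]; on the remaining span,
   of length [1 / (17 omega)], Gronwall's lemma bounds them by their values at
   time [t].  This closes up in two steps.  A crude version of the estimate with
   the exponent [pt], [N e <= 323/256 (1 + e K) + 6 (1 + e) K], forces
   [e <= 2/5] because [25 K <= N] and [50 <= N].  That controls the covariance of
   [1] and [f ^ 2], which is all that the sharp estimate with the exponent [p]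
   still needs. *)

(* The cut before [t] is forced by [C_fk s t]: at [s = t] it contains norms of the identity from a
   weaker to a stronger Lebesgue space, which only the smallest mass of [mu t] controls. Before the
   cut the operator norms are used; after it only the oscillation of the energy, one pair of
   particles at a time. The size of [lam] and [L] never matters: they enter the error through a
   carre du champ alone, which a linear functional subtracts. The number 17 is chosen so that
   Gronwall costs [17 / 16] and a tail of dispersions [3 / 16]; the 6 counts five products, one of
   them doubled. The lower bound on [p] says exactly that [pt > 2], and [pt <= p / 2] brings [f ^ 2]
   within reach of the exponent [pt]. Two analytic obstacles remain. Paths jump, so weighted
   expectations are differentiated from the right first, and continuity then makes these derivatives
   two-sided. The integrand of [Cbar] is built from suprema, so its integral enters only through a
   comparison that is valid without measurability. *)
From mathcomp Require Import ring lra.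
From mathcomp Require Import measurable_realfun.
Require Import Defs.
Set Implicit Arguments.
Unset Strict Implicit.
Unset Printing Implicit Defensive.

Local Open Scope classical_set_scope.
Local Open Scope ring_scope.

(** * Derivatives relative to an interval *)

Section derive_within.
Context {R : realType}.
Implicit Types (D : set R) (f g F : R -> R) (x l a b : R).

Lemma within_continuousP D f : {within D, continuous f} <->
  forall x, D x -> f u @[u --> within D (nbhs x)] --> f x.
Proof. exact: subspace_continuousP. Qed.

Lemma cvg_withinP D f x l : f u @[u --> within D (nbhs x)] --> l <->
  forall e, 0 < e -> exists2 d, 0 < d &
    forall u, D u -> `|u - x| < d -> `|f u - l| <= e.
Proof.
split=> [/cvgrPdist_le h e e0|h].
  have := h e e0; rewrite near_withinE => /nbhs_ballP[d /= d0 hd].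
  exists d => // u Du ud; rewrite distrC; apply: hd => //.
  by rewrite /ball /= distrC.
apply/cvgrPdist_le => e e0; have [d d0 hd] := h e e0.
rewrite near_withinE; apply/nbhs_ballP; exists d => //= u.
rewrite /ball /= => ud Du; rewrite distrC; apply: hd => //.
by rewrite distrC.
Qed.

(** Multiplying the quotient out makes [u = x] harmless, so the estimates below need not exclude
    that point. *)
Lemma is_derive_withinP D f x l : is_derive_within D f x l <->
  forall e, 0 < e -> exists2 d, 0 < d &
    forall u, D u -> `|u - x| < d -> `|f u - f x - l * (u - x)| <= e * `|u - x|.
Proof.
have E u : u != x -> f u - f x - l * (u - x) = ((f u - f x) / (u - x) - l) * (u - x).
  by move=> ux; rewrite mulrBl divfK // subr_eq0.
rewrite /is_derive_within /diff_quotient_within; split.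
  move/cvg_withinP => h e e0; have [d d0 hd] := h e e0.
  exists d => // u Du ud; have [->|ux] := eqVneq u x.
    by rewrite !subrr mulr0 normr0 subrr normr0 mulr0.
  rewrite E // normrM ler_wpM2r //; apply: hd => //; split=> //.
  exact/eqP.
move=> h; apply/cvg_withinP => e e0; have [d d0 hd] := h e e0.
exists d => // u [Du /= /eqP ux] ud; have := hd _ Du ud.
by rewrite E // normrM ler_pM2r // normr_gt0 subr_eq0.
Qed.

Lemma is_derive_within_cvg D f x l : is_derive_within D f x l ->
  f u @[u --> within D (nbhs x)] --> f x.
Proof.
move/is_derive_withinP => h; apply/cvg_withinP => e e0.
have [d d0 hd] := h 1 ltr01.
have c0 : 0 < 1 + `|l| by rewrite ltr_pwDl.
exists (Num.min d (e / (1 + `|l|))).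
  by rewrite lt_min d0 divr_gt0.
move=> u Du; rewrite lt_min => /andP[ud ue].
have -> : f u - f x = (f u - f x - l * (u - x)) + l * (u - x) by ring.
apply: (le_trans (ler_normD _ _)); rewrite normrM.
apply: (le_trans (lerD (hd _ Du ud) (lexx _))).
by rewrite -mulrDl -ler_pdivlMl // mulrC ltW.
Qed.

Lemma is_derive_within_continuous D f f' :
  (forall x, D x -> is_derive_within D f x (f' x)) -> {within D, continuous f}.
Proof.
by move=> h; apply/within_continuousP => x Dx; apply: is_derive_within_cvg (h x Dx).
Qed.

Lemma is_derive_withinS D D' f x l : D' `<=` D ->
  is_derive_within D f x l -> is_derive_within D' f x l.
Proof.
move=> DD /is_derive_withinP h; apply/is_derive_withinP => e /h[d d0 hd].
by exists d => // u /DD; exact: hd.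
Qed.

Lemma is_derive_within_eq D f g x l l' : D x -> {in D, f =1 g} -> l = l' ->
  is_derive_within D f x l -> is_derive_within D g x l'.
Proof.
move=> Dx fg <- /is_derive_withinP h; apply/is_derive_withinP => e /h[d d0 hd].
by exists d => // u Du; rewrite -!fg ?inE//; exact: hd.
Qed.

Lemma is_derive_within_cst D c x : is_derive_within D (cst c) x 0.
Proof.
apply/is_derive_withinP => e e0; exists 1 => // u _ _.
by rewrite subrr mul0r subrr normr0 mulr_ge0 // ltW.
Qed.

Lemma is_derive_within_id D x : is_derive_within D id x 1.
Proof.
apply/is_derive_withinP => e e0; exists 1 => // u _ _.
by rewrite mul1r subrr normr0 mulr_ge0 // ltW.
Qed.

Lemma is_derive_withinD D f g x l m :
  is_derive_within D f x l -> is_derive_within D g x m ->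
  is_derive_within D (fun u => f u + g u) x (l + m).
Proof.
rewrite /is_derive_within /diff_quotient_within => hf hg.
have FF : Filter (within (D `\ x) (nbhs x)) by exact: within_filter.
have h := cvgD hf hg.
suff -> : (fun u => (f u + g u - (f x + g x)) / (u - x)) =
  (fun u => (f u - f x) / (u - x)) + (fun u => (g u - g x) / (u - x)) by exact: h.
by apply/funext => u; rewrite fctE /= opprD addrACA mulrDl.
Qed.

Lemma is_derive_withinM D f g x l m :
  is_derive_within D f x l -> is_derive_within D g x m ->
  is_derive_within D (fun u => f u * g u) x (l * g x + f x * m).
Proof.
move=> hf hg.
have cg : g u @[u --> within (D `\ x) (nbhs x)] --> g x.
  move/cvg_withinP: (is_derive_within_cvg hg) => h; apply/cvg_withinP => e /h[d d0 hd].
  by exists d => // u [Du _]; exact: hd.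
have hfx : (fun=> f x) u @[u --> within (D `\ x) (nbhs x)] --> f x by exact: cvg_cst.
move: hf hg; rewrite /is_derive_within /diff_quotient_within => hf hg.
have FF : Filter (within (D `\ x) (nbhs x)) by exact: within_filter.
have h := cvgD (cvgM hf cg) (cvgM hfx hg).
suff -> : (fun u => (f u * g u - f x * g x) / (u - x)) =
  (fun u => (f u - f x) / (u - x)) * g + (fun=> f x) * (fun u => (g u - g x) / (u - x)) by exact: h.
by apply/funext => u; rewrite !fctE /=; ring.
Qed.

Lemma is_derive_withinZ D c f x l :
  is_derive_within D f x l -> is_derive_within D (fun u => c * f u) x (c * l).
Proof.
move=> hf; have := is_derive_withinM (is_derive_within_cst D c x) hf.
by rewrite mul0r add0r.
Qed.

Lemma is_derive_withinN D f x l :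
  is_derive_within D f x l -> is_derive_within D (fun u => - f u) x (- l).
Proof.
move=> /(is_derive_withinZ (c := -1)); rewrite mulN1r.
by under [X in is_derive_within _ X]eq_fun do rewrite mulN1r.
Qed.

Lemma is_derive_withinB D f g x l m :
  is_derive_within D f x l -> is_derive_within D g x m ->
  is_derive_within D (fun u => f u - g u) x (l - m).
Proof. by move=> hf /is_derive_withinN; exact: is_derive_withinD. Qed.

Lemma is_derive_within_sum D (I : finType) (f : I -> R -> R) x (l : I -> R) :
  (forall i, is_derive_within D (f i) x (l i)) ->
  is_derive_within D (fun u => \sum_i f i u) x (\sum_i l i).
Proof.
move=> h; rewrite (_ : (fun u => _) = \sum_i f i); last first.
  by apply/funext => u; rewrite fct_sumE.
apply: (big_ind2 (fun F l => is_derive_within D F x l)) => //.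
  exact: is_derive_within_cst.
by move=> f1 l1 f2 l2; exact: is_derive_withinD.
Qed.

Lemma is_derive_is_within D f x l :
  is_derive x 1 f l -> is_derive_within D f x l.
Proof.
case=> df fE; have := @derivable1_diffP R R f x; case=> + _ => /(_ df) dfx.
apply/is_derive_withinP => e e0.
have h := @ex_derive _ _ _ _ _ _ _ (DeriveDef df fE).
have cv : h0^-1 *: (f (h0 *: 1 + x) - f x) @[h0 --> 0^'] --> l.
  by rewrite -fE; exact: df.
move/cvgrPdist_le: cv => /(_ e e0).
rewrite near_withinE => /nbhs_ballP[d /= d0 hd]; exists d => // u Du ud.
have [->|ux] := eqVneq u x.
  by rewrite !subrr mulr0 normr0 subrr normr0 mulr0.
have ux0 : u - x != 0 by rewrite subr_eq0.
have := hd (u - x); rewrite /ball /= sub0r normrN => /(_ ud ux0).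
rewrite /GRing.scale /= mulr1 subrK distrC => H.
have -> : f u - f x - l * (u - x) = ((u - x)^-1 * (f u - f x) - l) * (u - x).
  by field.
by rewrite normrM ler_wpM2r.
Qed.

(** The error splits into that of [g], along an increment of [f] that is at most
    [(1 + |l|) |u - x|], and [m] times that of [f]; each gets [e / 2]. The outer derivative is taken
    within [setT] because the squared negative part below comes in that form. *)
Lemma is_derive_within_compT D f g x l m :
  is_derive_within setT g (f x) m -> is_derive_within D f x l ->
  is_derive_within D (fun u => g (f u)) x (m * l).
Proof.
move=> hg' hf.
have cf := is_derive_within_cvg hf.
move: hf hg' => /is_derive_withinP hf /is_derive_withinP hg'.
apply/is_derive_withinP => e e0.
have c0 : 0 < 1 + `|l| by rewrite ltr_pwDl.
have c1 : 0 < 1 + `|m| by rewrite ltr_pwDl.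
have e1 : 0 < e / 2 / (1 + `|l|) by rewrite !divr_gt0.
have e2 : 0 < e / 2 / (1 + `|m|) by rewrite !divr_gt0.
have [d1 d10 hd1] := hg' _ e1.
have [d2 d20 hd2] := hf _ e2.
have [d3 d30 hd3] := hf 1 ltr01.
have d12 : 0 < d1 / 2 by rewrite divr_gt0.
move/cvg_withinP: cf => /(_ _ d12)[d4 d40 hd4].
exists (Num.min d2 (Num.min d3 d4)); first by rewrite !lt_min d20 d30.
move=> u Du; rewrite !lt_min => /and3P[u2 u3 u4].
have A1 := hd4 _ Du u4.
have A2 : `|f u - f x| < d1.
  by apply: (le_lt_trans A1); rewrite ltr_pdivrMr // ltr_pMr // ltr1n.
have A3 := hd1 (f u) I A2.
have A4 : `|f u - f x| <= (1 + `|l|) * `|u - x|.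
  have -> : f u - f x = (f u - f x - l * (u - x)) + l * (u - x) by ring.
  apply: (le_trans (ler_normD _ _)); rewrite normrM mulrDl.
  by rewrite lerD // (hd3 _ Du u3).
have -> : g (f u) - g (f x) - m * l * (u - x) =
  (g (f u) - g (f x) - m * (f u - f x)) + m * (f u - f x - l * (u - x)) by ring.
apply: (le_trans (ler_normD _ _)); rewrite normrM.
have B1 : `|g (f u) - g (f x) - m * (f u - f x)| <= e / 2 * `|u - x|.
  apply: (le_trans A3).
  apply: (le_trans (ler_wpM2l (ltW e1) A4)).
  by rewrite mulrA divfK // gt_eqF.
have B2 : `|m| * `|f u - f x - l * (u - x)| <= e / 2 * `|u - x|.
  apply: (@le_trans _ _ ((1 + `|m|) * (e / 2 / (1 + `|m|) * `|u - x|))).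
    by apply: ler_pM => //; [rewrite lerDr|exact: hd2].
  by rewrite mulrA mulrCA divff ?mulr1 // gt_eqF.
by rewrite (splitr e) mulrDl lerD.
Qed.

Lemma is_derive_within_comp D f g x l m :
  is_derive (f x) 1 g m -> is_derive_within D f x l ->
  is_derive_within D (fun u => g (f u)) x (m * l).
Proof. by move=> hg; apply: is_derive_within_compT; exact: is_derive_is_within. Qed.

Lemma within_continuousM D f g :
  {within D, continuous f} -> {within D, continuous g} ->
  {within D, continuous (fun u => f u * g u)}.
Proof.
move=> /within_continuousP cf /within_continuousP cg; apply/within_continuousP.
by move=> x Dx; apply: cvgM; [exact: cf|exact: cg].
Qed.

Lemma within_continuous_add D f g :
  {within D, continuous f} -> {within D, continuous g} ->
  {within D, continuous (fun u => f u + g u)}.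
Proof.
move=> /within_continuousP cf /within_continuousP cg; apply/within_continuousP.
by move=> x Dx; apply: cvgD; [exact: cf|exact: cg].
Qed.

Lemma within_continuousN D f :
  {within D, continuous f} -> {within D, continuous (fun u => - f u)}.
Proof.
move=> /within_continuousP cf; apply/within_continuousP.
by move=> x Dx; apply: cvgN; exact: cf.
Qed.

Lemma within_continuous_norm D f :
  {within D, continuous f} -> {within D, continuous (fun u => `|f u|)}.
Proof.
move=> /within_continuousP cf; apply/within_continuousP.
by move=> x Dx; apply: cvg_norm; exact: cf.
Qed.

Lemma within_continuous_cst D c : {within D, continuous (fun=> c : R)}.
Proof. by apply/within_continuousP => x Dx; exact: cvg_cst. Qed.

Lemma within_continuous_max D f g :
  {within D, continuous f} -> {within D, continuous g} ->
  {within D, continuous (fun u => Num.max (f u) (g u))}.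
Proof.
move=> cf cg.
under [X in continuous X]eq_fun do rewrite maxr_absE.
apply: within_continuousM; last exact: within_continuous_cst.
apply: within_continuous_add; first exact: within_continuous_add.
by apply/within_continuous_norm/within_continuous_add => //; exact: within_continuousN.
Qed.

Lemma within_continuous_sum D (I : finType) (P : pred I) (f : I -> R -> R) :
  (forall i, {within D, continuous (f i)}) ->
  {within D, continuous (fun u => \sum_(i | P i) f i u)}.
Proof.
move=> h; rewrite (_ : (fun u => _) = \sum_(i | P i) f i); last first.
  by apply/funext => u; rewrite fct_sumE.
apply: (big_ind (fun F : R -> R => {within D, continuous F})) => //.
  exact: within_continuous_cst.
by move=> f1 f2; exact: within_continuous_add.
Qed.

Lemma within_continuousV D f : (forall x, D x -> f x != 0) ->
  {within D, continuous f} -> {within D, continuous (fun u => (f u)^-1)}.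
Proof.
move=> f0 /within_continuousP cf; apply/within_continuousP.
by move=> x Dx; apply: cvgV; [exact: f0|exact: cf].
Qed.

Lemma within_continuousS D D' f : D' `<=` D ->
  {within D, continuous f} -> {within D', continuous f}.
Proof. exact: continuous_subspaceW. Qed.

(** Continuous induction. For a slope [- e], let [A] be the set of points up to which [F] stays
    above the line of that slope through [a]. Continuity puts [sup A] in [A], and the hypothesis
    extends [A] beyond any point before [b]. Then [e] tends to 0. *)
Lemma dini_nondecreasing a b F : a <= b -> {within `[a, b], continuous F} ->
  (forall x, a <= x < b -> forall e, 0 < e -> exists2 d, 0 < d &
     forall u, x <= u < x + d -> u <= b -> - e * (u - x) <= F u - F x) ->
  F a <= F b.
Proof.
move=> ab /within_continuousP cF hF.
suff H e : 0 < e -> - e * (b - a) <= F b - F a.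
  have {}ab : 0 < b - a + 1 by rewrite ltr_wpDl // subr_ge0.
  apply/ler_addgt0Pr => e e0.
  (* Dividing by [b - a + 1] rather than by [b - a] covers [a = b]. *)
  have := H (e / (b - a + 1)) (divr_gt0 e0 ab).
  have : e / (b - a + 1) * (b - a) <= e.
    by rewrite mulrAC ler_pdivrMr // ler_wpM2l //; [exact: ltW|lra].
  by rewrite mulNr; lra.
move=> e0.
pose A := [set y | a <= y <= b /\ forall z, a <= z <= y -> - e * (z - a) <= F z - F a].
have Aa : A a.
  split; first by rewrite lexx.
  by move=> z; rewrite -eq_le => /eqP <-; rewrite !subrr mulr0.
have hA : has_sup A.
  by split; [exists a|exists b => y [/andP[]]].
pose s := sup A.
have as_ : a <= s by exact: sup_upper_bound.
have sb : s <= b by apply: ge_sup; [exists a|move=> y [/andP[]]].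
have As z : a <= z < s -> - e * (z - a) <= F z - F a.
  move=> /andP[az zs]; have sz : 0 < s - z by rewrite subr_gt0.
  have [y Ay zy] := sup_adherent sz hA.
  have {}zy : z < y by move: zy; rewrite /= /s; lra.
  by apply Ay.2; rewrite az ltW.
have Ass : - e * (s - a) <= F s - F a.
  have [->|sa] := eqVneq s a; first by rewrite !subrr mulr0.
  have {}sa : a < s by rewrite lt_neqAle eq_sym sa.
  apply/ler_addgt0Pr => c c0.
  have c2 : 0 < c / 2 by rewrite divr_gt0.
  have := cF s; rewrite /= in_itv /= as_ sb => /(_ isT) /cvg_withinP /(_ _ c2)[d d0 hd].
  (* A point below [s] so near to it that the oscillation of [F] and the change of the line each
     cost at most [c / 2]. *)
  pose z := Num.max a (s - Num.min (d / 2) (c / 2 / e)).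
  have m0 : 0 < Num.min (d / 2) (c / 2 / e) by rewrite lt_min !divr_gt0.
  have az : a <= z by rewrite le_max lexx.
  have zs : z < s by rewrite gt_max sa /= ltrBlDr ltrDl.
  have zs2 : s - z <= Num.min (d / 2) (c / 2 / e) by rewrite lerBlDl -lerBlDr le_max lexx orbT.
  move: zs2; rewrite le_min => /andP[z1 z2].
  have := hd z; rewrite /= in_itv /= az (le_trans (ltW zs) sb) distrC ger0_norm; last first.
    by rewrite subr_ge0 ltW.
  have d2 : d / 2 < d by rewrite ltr_pdivrMr // ltr_pMr // ltr1n.
  move=> /(_ isT (le_lt_trans z1 d2)); rewrite ler_norml => /andP[_ z3].
  have := As z; rewrite az zs => /(_ isT).
  move: z2; rewrite ler_pdivlMr // => z2.
  nra.
have [sb'|] := ltP s b; last first.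
  by move=> bs; have -> : b = s by apply/le_anti; rewrite bs sb.
have := hF s; rewrite as_ sb' => /(_ isT _ e0)[d d0 hd].
pose y := Num.min b (s + d / 2).
have ys : s < y by rewrite lt_min sb' ltrDl divr_gt0.
have yb : y <= b by rewrite ge_min lexx.
have ysd : y < s + d.
  rewrite gt_min ltrD2l; apply/orP; right.
  by rewrite ltr_pdivrMr // ltr_pMr // ltr1n.
suff /(sup_upper_bound hA) : A y by rewrite leNgt ys.
split=> [|z /andP[az zy]]; first by rewrite yb (le_trans as_ (ltW ys)).
have [zs|sz] := ltP z s; first by apply: As; rewrite az.
have := hd z; rewrite sz (le_lt_trans zy ysd) (le_trans zy yb) => /(_ isT isT).
by move: Ass; lra.
Qed.

Lemma derive_ge0_nondecreasing a b F F' : a <= b ->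
  (forall x, a <= x <= b -> is_derive_within `[a, b] F x (F' x)) ->
  (forall x, a <= x <= b -> 0 <= F' x) -> F a <= F b.
Proof.
move=> ab dF F0; apply: dini_nondecreasing => //.
  by apply: (is_derive_within_continuous (f' := F')) => x; rewrite /= in_itv /=; exact: dF.
move=> x /andP[ax xb] e e0.
have axb : a <= x <= b by rewrite ax ltW.
have /is_derive_withinP/(_ _ e0)[d d0 hd] := dF _ axb.
exists d => // u /andP[xu uxd] ub.
have := hd u; rewrite /= in_itv /= (le_trans ax xu) ub => /(_ isT).
rewrite ger0_norm ?subr_ge0 // ltrBlDl => /(_ uxd); rewrite ler_norml => /andP[+ _].
have := F0 _ axb; have : 0 <= u - x by rewrite subr_ge0.
by move=> h1 h2; have := mulr_ge0 h2 h1; lra.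
Qed.

Lemma derive_le_increment a b F F' c : a <= b ->
  (forall x, a <= x <= b -> is_derive_within `[a, b] F x (F' x)) ->
  (forall x, a <= x <= b -> F' x <= c) -> F b - F a <= c * (b - a).
Proof.
move=> ab dF Fc.
have := @derive_ge0_nondecreasing a b (fun x => c * x - F x) (fun x => c * 1 - F' x) ab.
suff h : c * a - F a <= c * b - F b by move=> _; lra.
apply: (@derive_ge0_nondecreasing a b (fun x => c * x - F x) (fun x => c * 1 - F' x) ab).
  move=> x axb; apply: is_derive_withinB (dF _ axb).
  by apply: is_derive_withinZ; exact: is_derive_within_id.
by move=> x axb; rewrite mulr1 subr_ge0 Fc.
Qed.

Lemma derive_eq0_constant a b F : a <= b ->
  (forall x, a <= x <= b -> is_derive_within `[a, b] F x 0) -> F b = F a.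
Proof.
move=> ab dF; apply/le_anti/andP; split.
  have := derive_le_increment ab dF (c := 0).
  by rewrite mul0r subr_le0; apply.
by apply: derive_ge0_nondecreasing (dF) _.
Qed.

End derive_within.

(** * Integration of derivatives over compact intervals *)

Section integral_within.
Context {R : realType}.
Notation mu := (@lebesgue_measure R).
Implicit Types (f k F : R -> R) (x a b c : R) (I : R -> \bar R).

(** Clamping the argument to [[a, b]] freezes [k] beyond the endpoints, which makes it continuous
    there from both sides. *)
Lemma continuous_extension a b k : a <= b -> {within `[a, b], continuous k} ->
  exists2 K : R -> R, continuous K & {in `[a, b], k =1 K}.
Proof.
move=> ab ck; pose cl x := Num.max a (Num.min b x).
have clab x : a <= cl x <= b by rewrite le_max lexx /= ge_max ab ge_min lexx.
exists (k \o cl) => [x|x]; last first.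
  by rewrite in_itv /= => /andP[ax xb]; rewrite /cl min_r // max_r.
have ccl : cl u @[u --> x] --> cl x.
  have : {within setT, continuous (fun u : R => Num.max a (- Num.max (- b) (- u)))}.
    apply: within_continuous_max; first exact: within_continuous_cst.
    apply/within_continuousN/within_continuous_max; first exact: within_continuous_cst.
    by apply/within_continuousN/continuous_subspaceT => ?; exact: cvg_id.
  move=> /within_continuousP /(_ x Logic.I) /cvg_withinP h; apply/cvgrPdist_le => e /h[d d0 hd].
  near=> u; have E y : Num.max a (- Num.max (- b) (- y)) = cl y by rewrite oppr_max !opprK.
  have h1 := hd u Logic.I; rewrite !E in h1; rewrite distrC; apply: h1.
  by rewrite distrC; near: u; exact: cvgr_dist_lt.
apply/cvgrPdist_le => e e0.
move/within_continuousP: ck => /(_ (cl x)); rewrite /= in_itv /= => /(_ (clab x)).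
move/cvg_withinP => /(_ _ e0)[d d0 hd].
move/cvgrPdist_lt: ccl => /(_ _ d0); apply: filterS => u ud.
by rewrite distrC; apply: hd; [rewrite /= in_itv /= clab|rewrite distrC].
Unshelve. all: by end_near. Qed.

Lemma within_continuous_bounded a b k : {within `[a, b], continuous k} ->
  exists2 M, 0 <= M & forall x, a <= x <= b -> `|k x| <= M.
Proof.
move=> ck; have [ab|ba] := leP a b; last first.
  by exists 0 => // x /andP[ax xb]; move: (le_trans ax xb); rewrite leNgt ba.
have [c _ hc] := EVT_max ab (within_continuous_norm ck).
exists (`|k c|) => // x xab; apply: hc; by rewrite in_itv /= xab.
Qed.

Lemma within_continuous_integrable a b k : {within `[a, b], continuous k} ->
  mu.-integrable `[a, b] (EFin \o k).
Proof. by move=> ck; apply: continuous_compact_integrable => //; exact: segment_compact. Qed.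

(** The fundamental theorem is applied to the extension of [k] on [[a - 1, b + 1]], where [a] and
    [b] are interior points; subtracting the constant [J a] restores the lower limit [a]. *)
Lemma is_derive_within_integral a b k x : {within `[a, b], continuous k} ->
  a <= x <= b ->
  is_derive_within `[a, b] (fun y => \int[mu]_(s in `[a, y]) k s) x (k x).
Proof.
move=> ck axb; have ab : a <= b by case/andP: axb; exact: le_trans.
have [K cK kK] := continuous_extension ab ck.
have cKi c y : mu.-integrable `[c, y] (EFin \o K).
  by apply: within_continuous_integrable; exact: continuous_subspaceT.
have a1x : a - 1 < x by move: axb => /andP[]; lra.
have xb1 : x < b + 1 by move: axb => /andP[]; lra.
have [dJ J'] := continuous_FTC1_closed xb1 (cKi (a - 1) (b + 1)) a1x (cK x).
pose J y := \int[mu]_(s in `[a - 1, y]) K s.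
have hJ : is_derive x 1 J (K x) by apply: DeriveDef; [exact: dJ|rewrite -derive1E; exact: J'].
have hJa := is_derive_withinB (is_derive_is_within `[a, b] hJ)
  (is_derive_within_cst `[a, b] (J a) x).
apply: is_derive_within_eq hJa => //; last by rewrite subr0 kK // in_itv.
  move=> y; rewrite inE /= in_itv /= => /andP[ay yb].
  rewrite /J; have ax1 : a - 1 <= a by lra.
  rewrite (@Rintegral_itvB _ K (BLeft (a - 1)) (BRight y) a (cKi _ _)) ?bnd_simp //.
  rewrite Rintegral_itv_obnd_cbnd.
    apply: eq_Rintegral => s; rewrite inE /= in_itv /= => /andP[as_ sy].
    by rewrite kK // in_itv /= as_ (le_trans sy yb).
  by apply: integrableS (cKi a y) => //; exact: subset_itv_oc_cc.
Qed.

Lemma derive_within_FTC a b F k : a <= b -> {within `[a, b], continuous k} ->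
  (forall x, a <= x <= b -> is_derive_within `[a, b] F x (k x)) ->
  F b - F a = \int[mu]_(s in `[a, b]) k s.
Proof.
move=> ab ck dF.
have := @derive_eq0_constant _ a b (fun y => F y - \int[mu]_(s in `[a, y]) k s) ab.
rewrite set_itv1 Rintegral_set1 subr0 => <-; first by rewrite opprB addrC subrK.
move=> x axb; rewrite -(subrr (k x)).
apply: is_derive_withinB; first exact: dF.
exact: is_derive_within_integral.
Qed.

(* [I] need not be measurable: the integral of a nonnegative function is the
   supremum of the integrals of the simple functions below it. *)
Lemma le_integral_nonmeasurable (D : set R) k I :
  (forall x, D x -> (0 <= I x)%E) -> (forall x, D x -> 0 <= k x) ->
  (forall x, D x -> ((k x)%:E <= I x)%E) ->
  (\int[mu]_(x in D) (k x)%:E <= \int[mu]_(x in D) I x)%E.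
Proof.
move=> I0 k0 kI; rewrite ge0_integralE; last by move=> x Dx; rewrite lee_fin k0.
rewrite [leRHS]ge0_integralE //.
apply: le_ereal_sup => _ [h hk <-]; exists h => // x; apply: (le_trans (hk x)).
rewrite /patch; case: ifPn => // xD; apply: kI; by rewrite inE in xD.
Qed.

(** Meant for an [I] made of suprema, possibly infinite. As [I] need not be measurable, [c] is
    divided out of the continuous side instead, which sets [c = 0] apart; the positive part of [k]
    makes that side nonnegative. *)
Lemma derive_le_integral a b F k I c : a <= b -> {within `[a, b], continuous k} ->
  (forall x, a <= x <= b -> is_derive_within `[a, b] F x (k x)) ->
  0 <= c -> (forall x, a <= x <= b -> (0 <= I x)%E) ->
  (forall x, a <= x <= b -> ((k x)%:E <= c%:E * I x)%E) ->
  ((F b - F a)%:E <= c%:E * \int[mu]_(s in `[a, b]) I s)%E.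
Proof.
move=> ab ck dF c0 I0 kI; have [c00|cneq] := eqVneq c 0.
  rewrite c00 mul0e lee_fin.
  have := @derive_le_increment _ a b F k 0 ab dF; rewrite mul0r; apply.
  by move=> x /kI; rewrite c00 mul0e lee_fin.
have {}c0 : 0 < c by rewrite lt_neqAle eq_sym cneq.
pose kp := fun x => Num.max (k x) 0.
have ckp : {within `[a, b], continuous kp}.
  by apply: within_continuous_max => //; exact: within_continuous_cst.
have ckc : {within `[a, b], continuous (fun x => c^-1 * kp x)}.
  by apply: within_continuousM => //; exact: within_continuous_cst.
apply: (@le_trans _ _ (\int[mu]_(s in `[a, b]) kp s)%:E).
  rewrite lee_fin (derive_within_FTC ab ck dF).
  apply: le_Rintegral => //; try exact: within_continuous_integrable.
  by move=> x _; rewrite /kp le_max lexx.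
have -> : (\int[mu]_(s in `[a, b]) kp s = c * \int[mu]_(s in `[a, b]) (c^-1 * kp s))%R.
  rewrite RintegralZl //; last exact: within_continuous_integrable.
  by rewrite mulrA divff // mul1r.
rewrite EFinM lee_wpmul2l ?lee_fin ?(ltW c0) // /Rintegral fineK; last first.
  by apply: integrable_fin_num => //; exact: within_continuous_integrable.
apply: le_integral_nonmeasurable => //.
- by move=> x _; rewrite mulr_ge0 ?invr_ge0 ?(ltW c0) // /kp le_max lexx orbT.
- move=> x; rewrite /= in_itv /= => xab; rewrite EFinM.
  have [k0|k0] := leP (k x) 0.
    by rewrite /kp max_r // mule0 I0.
  rewrite /kp max_l ?(ltW k0) // lee_pdivrMl //; exact: kI.
Qed.

End integral_within.

(** * Norms on a finite probability space *)

Section pairing.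
Context {R : realType} {S : finType}.
Implicit Types (m f g : S -> R).

Lemma pairingD m f g : pairing (fun x => f x + g x) m = pairing f m + pairing g m.
Proof. by rewrite /pairing -big_split; apply: eq_bigr => x _; rewrite mulrDl. Qed.

Lemma pairingZ m c f : pairing (fun x => c * f x) m = c * pairing f m.
Proof. by rewrite /pairing mulr_sumr; apply: eq_bigr => x _; rewrite mulrA. Qed.

Lemma pairingN m f : pairing (fun x => - f x) m = - pairing f m.
Proof. by rewrite /pairing -sumrN; apply: eq_bigr => x _; rewrite mulNr. Qed.

Lemma pairingB m f g : pairing (fun x => f x - g x) m = pairing f m - pairing g m.
Proof. by rewrite pairingD pairingN. Qed.

Lemma eq_pairing m f g : f =1 g -> pairing f m = pairing g m.
Proof. by move=> fg; apply: eq_bigr => x _; rewrite fg. Qed.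

Lemma pairing_cst m c : pairing (fun=> c) m = c * \sum_x m x.
Proof. by rewrite /pairing mulr_sumr. Qed.

Lemma ler_pairing m f g : (forall x, 0 <= m x) -> (forall x, f x <= g x) ->
  pairing f m <= pairing g m.
Proof. by move=> m0 fg; apply: ler_sum => x _; rewrite ler_wpM2r. Qed.

Lemma pairing_ge0 m f : (forall x, 0 <= m x) -> (forall x, 0 <= f x) ->
  0 <= pairing f m.
Proof. by move=> m0 f0; apply: sumr_ge0 => x _; rewrite mulr_ge0. Qed.

Lemma ler_norm_pairing m f : (forall x, 0 <= m x) ->
  `|pairing f m| <= pairing (fun x => `|f x|) m.
Proof.
move=> m0; apply: (le_trans (ler_norm_sum _ _ _)); apply: ler_sum => x _.
by rewrite normrM (ger0_norm (m0 x)).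
Qed.

End pairing.

Section lpnorm.
Context {R : realType} {S : finType}.
Variable m : S -> R.
Hypothesis m0 : forall x, 0 < m x.
Hypothesis m1 : \sum_x m x = 1.
Implicit Types (f g : S -> R) (a b : R) (p q : \bar R).

Let m_ge0 x : 0 <= m x. Proof. exact: ltW. Qed.

Lemma lpnorm_ge0 q f : 0 <= lpnorm m q f.
Proof.
case: q => [r| |] //=; first exact: powR_ge0.
by elim/big_ind: _ => // x y x0 y0; rewrite le_max x0.
Qed.

Lemma lpnorm_powR a f : a != 0 ->
  lpnorm m a%:E f `^ a = pairing (fun x => `|f x| `^ a) m.
Proof.
move=> a0; rewrite /= -powRrM mulVf // powRr1 //.
by apply: pairing_ge0 => // x; exact: powR_ge0.
Qed.

Lemma ler_lpnorm a f c : 0 < a -> 0 <= c ->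
  (lpnorm m a%:E f <= c) = (pairing (fun x => `|f x| `^ a) m <= c `^ a).
Proof.
move=> a0 c0; rewrite -lpnorm_powR ?gt_eqF //.
apply/idP/idP => h.
  by apply: ge0_ler_powR => //; rewrite ?nnegrE ?lpnorm_ge0 // ltW.
rewrite leNgt; apply/negP => /(gt0_ltr_powR a0).
by rewrite !nnegrE lpnorm_ge0 => /(_ c0 isT); rewrite ltNge h.
Qed.

Lemma le_lpnorm a f g : 0 < a -> (forall x, `|f x| <= `|g x|) ->
  lpnorm m a%:E f <= lpnorm m a%:E g.
Proof.
move=> a0 fg; rewrite ler_lpnorm ?lpnorm_ge0 // lpnorm_powR ?gt_eqF //.
by apply: ler_pairing => // x; apply: ge0_ler_powR; rewrite ?nnegrE // ltW.
Qed.

Lemma lpnormZ a c f : 0 < a -> lpnorm m a%:E (fun x => c * f x) = `|c| * lpnorm m a%:E f.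
Proof.
move=> a0 /=; under eq_pairing do rewrite normrM powRM //.
rewrite pairingZ powRM ?powR_ge0 //; last first.
  by apply: pairing_ge0 => // x; exact: powR_ge0.
by rewrite -powRrM divff ?gt_eqF // powRr1.
Qed.

Lemma lpnorm_eq0 a f : 0 < a -> lpnorm m a%:E f = 0 -> f = fun=> 0.
Proof.
move=> a0 f0; apply/funext => x.
have : pairing (fun x => `|f x| `^ a) m = 0.
  by rewrite -lpnorm_powR ?gt_eqF // f0 powR0 // gt_eqF.
move/eqP; rewrite psumr_eq0 => [|y _]; last by rewrite mulr_ge0 ?powR_ge0.
move/allP => /(_ x); rewrite mem_index_enum => /(_ isT) /=.
by rewrite mulf_eq0 (gt_eqF (m0 x)) orbF powR_eq0 normr_eq0 => /andP[/eqP].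
Qed.

Lemma lpnorm0 a : 0 < a -> lpnorm m a%:E (fun=> 0) = 0.
Proof.
move=> a0; transitivity (lpnorm m a%:E (fun x => 0 * (fun=> 0) x)).
  by congr lpnorm; apply/funext => x; rewrite mul0r.
by rewrite lpnormZ // normr0 mul0r.
Qed.

Lemma lpnorm_cst1 a : 0 < a -> lpnorm m a%:E (fun=> 1) = 1.
Proof. by move=> a0 /=; rewrite normr1 pairing_cst !powR1 mul1r m1 powR1. Qed.

Lemma lpnorm_sqr a f : 0 < a ->
  lpnorm m a%:E (fun x => f x ^+ 2) = lpnorm m (2 * a)%:E f ^+ 2.
Proof.
move=> a0 /=.
have -> : pairing (fun x => `|f x ^+ 2| `^ a) m = pairing (fun x => `|f x| `^ (2 * a)) m.
  by apply: eq_pairing => x; rewrite powRrM powR_mulrn // normrX.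
by rewrite -powR_mulrn ?powR_ge0 // -powRrM invfM mulrAC mulVf ?mul1r.
Qed.

Lemma pairing_sqr f : pairing (fun x => f x ^+ 2) m = lpnorm m 2%:E f ^+ 2.
Proof.
rewrite -powR_mulrn ?lpnorm_ge0 // lpnorm_powR //.
by apply: eq_pairing => x; rewrite powR_mulrn // real_normK ?num_real.
Qed.

(** Young's inequality with exponents [b / a] and [r / a], applied pointwise to [(|f| / F) ^ a] and
    [(|g| / G) ^ a] and then averaged: the averages are [a / b] and [a / r], with sum 1. If a norm
    vanishes, so does the function, because [m] is positive everywhere. *)
Lemma hoelder_lpnorm a b f g : 0 < a -> a < b ->
  lpnorm m a%:E (fun x => f x * g x) <=
  lpnorm m b%:E f * lpnorm m (a^-1 - b^-1)^-1%:E g.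
Proof.
move=> a0 ab; set r := (a^-1 - b^-1)^-1.
have b0 : 0 < b := lt_trans a0 ab.
have r0 : 0 < r by rewrite invr_gt0 subr_gt0 ltf_pV2.
have rE : r^-1 = a^-1 - b^-1 by rewrite invrK.
clearbody r.
have [f0|fneq] := eqVneq (lpnorm m b%:E f) 0.
  have -> : (fun x => f x * g x) = fun=> 0.
    by apply/funext => x; rewrite (lpnorm_eq0 b0 f0) mul0r.
  by rewrite lpnorm0 // mulr_ge0 ?lpnorm_ge0.
have [g0|gneq] := eqVneq (lpnorm m r%:E g) 0.
  have -> : (fun x => f x * g x) = fun=> 0.
    by apply/funext => x; rewrite (lpnorm_eq0 r0 g0) mulr0.
  by rewrite lpnorm0 // mulr_ge0 ?lpnorm_ge0.
have F0 : 0 < lpnorm m b%:E f by rewrite lt_neqAle eq_sym fneq lpnorm_ge0.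
have G0 : 0 < lpnorm m r%:E g by rewrite lt_neqAle eq_sym gneq lpnorm_ge0.
move FE : (lpnorm m b%:E f) F0 {fneq} => F F0.
move GE : (lpnorm m r%:E g) G0 {gneq} => G G0.
have FG0 : 0 < (F * G) `^ a := powR_gt0 a (mulr_gt0 F0 G0).
rewrite ler_lpnorm ?mulr_ge0 ?(ltW F0) ?(ltW G0) //.
rewrite -[leRHS]mul1r -ler_pdivrMr // mulrC -pairingZ.
apply: (@le_trans _ _ (pairing (fun x => (a / b / F `^ b) * `|f x| `^ b +
    (a / r / G `^ r) * `|g x| `^ r) m)).
  apply: ler_pairing => // x.
  have ba0 : 0 < b / a by rewrite divr_gt0.
  have ra0 : 0 < r / a by rewrite divr_gt0.
  have conj : (b / a)^-1 + (r / a)^-1 = 1.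
    by rewrite !invfM !invrK -mulrDl rE addrCA subrr addr0 mulVf // gt_eqF.
  have := conjugate_powR (powR_ge0 (`|f x| / F) a) (powR_ge0 (`|g x| / G) a) ba0 ra0 conj.
  have e1 c y : (y `^ a) `^ (c / a) = y `^ c by rewrite -powRrM mulrCA divff ?gt_eqF // mulr1.
  rewrite !e1.
  have e2 c d : 0 < c -> forall y, (`|y| / c) `^ d = `|y| `^ d / c `^ d.
    by move=> c0 y; rewrite powRM ?invr_ge0 ?(ltW c0) // -[c^-1]powR_inv1 ?(ltW c0) // -powRrM mulN1r powRN.
  rewrite !e2 // normrM !powRM ?(ltW F0) ?(ltW G0) // invfM !invfM !invrK => h.
  have -> : (F `^ a)^-1 / G `^ a * (`|f x| `^ a * `|g x| `^ a) =
    `|f x| `^ a / F `^ a * (`|g x| `^ a / G `^ a) by ring.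
  apply: (le_trans h); rewrite le_eqVlt; apply/orP; left; apply/eqP; ring.
rewrite pairingD !pairingZ -!lpnorm_powR ?gt_eqF // FE GE.
rewrite !divfK ?gt_eqF ?powR_gt0 // -mulrDr rE addrCA subrr addr0 divff //.
by rewrite gt_eqF.
Qed.

Lemma lpnorm_mono a b f : 0 < a -> a <= b -> lpnorm m a%:E f <= lpnorm m b%:E f.
Proof.
move=> a0; rewrite le_eqVlt => /predU1P[->//|ab].
have := hoelder_lpnorm f (fun=> 1) a0 ab.
under [X in lpnorm m a%:E X]eq_fun do rewrite mulr1.
rewrite lpnorm_cst1 ?mulr1 // invr_gt0 subr_gt0 ltf_pV2 // posrE.
exact: lt_trans ab.
Qed.

Lemma ler_lpnorm_infty f x : `|f x| <= lpnorm m +oo f.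
Proof. by rewrite /= (bigD1 x) //= le_max lexx. Qed.

Lemma hoelder_lpnorm_infty a f g : 0 < a ->
  lpnorm m a%:E (fun x => f x * g x) <= lpnorm m +oo f * lpnorm m a%:E g.
Proof.
move=> a0; have F0 := lpnorm_ge0 +oo f.
have h := lpnormZ (lpnorm m +oo f) g a0; rewrite (ger0_norm F0) in h; rewrite -h.
apply: le_lpnorm => // x; rewrite !normrM ler_wpM2r // [leRHS]ger0_norm //.
exact: ler_lpnorm_infty.
Qed.

Lemma ler_norm_pairing_lpnorm a f : 1 <= a -> `|pairing f m| <= lpnorm m a%:E f.
Proof.
move=> a1; apply: (le_trans (ler_norm_pairing _ m_ge0)).
apply: (le_trans _ (lpnorm_mono f ltr01 a1)).
rewrite /= invr1 powRr1; last by apply: pairing_ge0 => // x; exact: powR_ge0.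
by apply: ler_pairing => // x; rewrite powRr1.
Qed.

Lemma ler_pairing_sqr_lpnorm a f : 2 <= a ->
  pairing (fun x => f x ^+ 2) m <= lpnorm m a%:E f ^+ 2.
Proof.
move=> a2; rewrite pairing_sqr; apply: lerXn2r; rewrite ?nnegrE ?lpnorm_ge0 //.
exact: lpnorm_mono.
Qed.

(* Here [1 / a = 1 / q + 1 / r], with [q] possibly infinite. *)
Definition hoelder_conjugates (a : R) (q : \bar R) (r : R) : Prop :=
  [/\ 0 < a, a <= r & (((q = +oo)%E /\ r = a) \/
    exists b, [/\ q = b%:E, a < b & r = (a^-1 - b^-1)^-1])].

Section conjugates.
Variables (a r : R) (q : \bar R).
Hypothesis aqr : hoelder_conjugates a q r.

Lemma lpnorm_hoelder f g :
  lpnorm m a%:E (fun x => f x * g x) <= lpnorm m q f * lpnorm m r%:E g.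
Proof.
case: aqr => a0 ar [[-> ->]|[b [-> ab ->]]]; first exact: hoelder_lpnorm_infty.
exact: hoelder_lpnorm.
Qed.

Lemma lpnorm_le_conjugate f : lpnorm m a%:E f <= lpnorm m q f.
Proof.
case: aqr => a0 ar _; have := lpnorm_hoelder f (fun=> 1).
under [X in lpnorm m a%:E X]eq_fun do rewrite mulr1.
by rewrite lpnorm_cst1 ?mulr1 // (lt_le_trans a0 ar).
Qed.

Lemma lpnorm_le_double f : lpnorm m a%:E f <= lpnorm m (2 * r)%:E f.
Proof. by case: aqr => a0 ar _; apply: lpnorm_mono => //; lra. Qed.

Lemma lpnorm_sqr_le f :
  lpnorm m a%:E (fun x => f x ^+ 2) <= lpnorm m (2 * r)%:E f ^+ 2.
Proof.
case: aqr => a0 ar _; rewrite lpnorm_sqr; last exact: a0.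
have ar2 : 2 * a <= 2 * r by lra.
have a20 : 0 < 2 * a by lra.
apply: lerXn2r (lpnorm_mono f a20 ar2); rewrite nnegrE; exact: lpnorm_ge0.
Qed.

Lemma lpnorm_mulr_sqr_le h f :
  lpnorm m a%:E (fun x => h x * f x ^+ 2) <= lpnorm m q h * lpnorm m (2 * r)%:E f ^+ 2.
Proof.
case: aqr => a0 ar _; rewrite -lpnorm_sqr; last exact: lt_le_trans ar.
exact: lpnorm_hoelder.
Qed.

Lemma lpnorm_mulr_le h f :
  lpnorm m a%:E (fun x => h x * f x) <= lpnorm m q h * lpnorm m (2 * r)%:E f.
Proof.
case: aqr => a0 ar _; have r2 : r <= 2 * r by lra.
have r0 : 0 < r := lt_le_trans a0 ar.
exact: le_trans (lpnorm_hoelder h f) (ler_wpM2l (lpnorm_ge0 q h) (lpnorm_mono f r0 r2)).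
Qed.

End conjugates.

End lpnorm.

(** * Exponentially weighted expectations along a jump process *)

Section finite_valued.
Context {R : realType} {E : finType} {d : measure_display} {T : measurableType d}.

Lemma measurable_finite_comp (Y : T -> E) (phi : E -> R) :
  (forall c, measurable (Y @^-1` [set c])) -> measurable_fun setT (fun w => phi (Y w)).
Proof.
move=> mY _ B mB; rewrite setTI.
have -> : (fun w => phi (Y w)) @^-1` B = \bigcup_(c in [set c | B (phi c)]) (Y @^-1` [set c]).
  by apply/seteqP; split => [w Bw|w [c Bc /= ->]] //=; exists (Y w).
by apply: fin_bigcup_measurable => //; exact: finite_finset.
Qed.

End finite_valued.

(** * Measurability and regularity of time integrals along paths *)

Section paths.
Context {R : realType} {E : finType} {d : measure_display} {T : measurableType d}.
Variable X : R -> T -> E.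
Hypothesis X_measurable : forall t x, 0 <= t -> measurable (X t @^-1` [set x]).
Hypothesis X_rcontinuous :
  forall w t, 0 <= t -> \forall u \near t^'+, X u w = X t w.

(** Naming the generators of [history] allows its sigma-algebra to serve as a measurable type, over
    which functions can be declared measurable with respect to the past. *)
Definition history_generators (t : R) : set (set T) :=
  [set B | exists u x, 0 <= u <= t /\ B = X u @^-1` [set x]].

Local Notation past t := (g_sigma_algebraType (history_generators t)).

Lemma measurable_past t u (c : E) : 0 <= u <= t ->
  measurable (X u @^-1` [set c] : set (past t)).
Proof. by move=> ut; apply: sub_sigma_algebra; exists u, c. Qed.

Lemma measurable_fun_past t : measurable_fun setT (fun w : T => w : past t).
Proof.
move=> _ B mB; rewrite setTI.
have : <<s history_generators t >> `<=` (measurable : set (set T)).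
  apply: smallest_sub; first exact: sigma_algebra_measurable.
  by move=> _ [u [c [/andP[u0 _] ->]]]; exact: X_measurable.
exact.
Qed.

(** Right continuity in a finite space: the state at [s] is read off from countably many later
    times. The cut [ratr r <= t] keeps these times in the past of [t], hence the strict [s < t]. *)
Lemma path_eqP t s w c : 0 <= s -> s < t -> X s w = c <->
  exists m : nat, forall r : rat, s < ratr r < s + m.+1%:R^-1 -> ratr r <= t ->
    X (ratr r) w = c.
Proof.
move=> s0 st; have := X_rcontinuous w s0; rewrite near_withinE => /nbhs_ballP[e /= e0 he].
have hX u : s < u < s + e -> X u w = X s w.
  move=> /andP[su ue]; apply: he => //.
  by rewrite /ball /= ltr_norml; lra.
split=> [sc|[m hm]].
  have [m me] : exists m : nat, m.+1%:R^-1 < e.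
    exists (Num.truncn e^-1); rewrite invf_plt ?posrE // ?ltr0Sn //.
    by rewrite truncnS_gt // invr_ge0 ltW.
  exists m => r /andP[sr rm] _; rewrite -sc; apply: hX.
  by rewrite sr /= (lt_trans rm) // ltrD2l.
have [r /[!in_itv]/= /andP[sr]] : exists r : rat, ratr r \in `]s, (s + Num.min (t - s) (Num.min e m.+1%:R^-1))[.
  apply: rat_in_itvoo; rewrite ltrDl !lt_min subr_gt0 st e0 /=.
  by rewrite invr_gt0 ltr0Sn.
rewrite -ltrBlDl !lt_min => /and3P[r1 r2 r3].
have Xr : X (ratr r) w = c by apply: hm; [rewrite sr -ltrBlDl|lra].
by rewrite -Xr hX // sr /=; lra.
Qed.

Definition occupation (t : R) (c : E) : set (R * past t) :=
  [set sw | 0 <= sw.1 <= t /\ X sw.1 sw.2 = c].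

(** Progressive measurability: joint in time and outcome, with only the past of [t] available. *)
Lemma measurable_occupation t c : 0 <= t -> measurable (@occupation t c).
Proof.
move=> t0.
(* The rational time [r] lies less than [1 / (m + 1)] after [s], yet the state at [r] is not [c]. *)
pose bad (m : nat) (r : rat) : set (R * past t) :=
  if (0 < (ratr r : R)) && (ratr r <= t) then
    (`[0, t[ `&` `]ratr r - m.+1%:R^-1, ratr r[) `*` ~` (X (ratr r) @^-1` [set c])
  else set0.
have mbad m r : measurable (bad m r).
  rewrite /bad; case: ifP => // /andP[r0 rt]; apply: measurableX.
    by apply: measurableI; exact: measurable_itv.
  by apply: measurableC; apply: measurable_past; rewrite (ltW r0).
pose J := \bigcup_m ((`[0, t[%classic `*` [set: past t]) `\` \bigcup_r bad m r).
(* The slice [s = t] is separate, since no later time belongs to the past of [t]. *)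
have -> : occupation c = J `|` ([set t] `*` (X t @^-1` [set c] : set (past t))).
  apply/seteqP; split => [[s w] [/= /andP[s0 st] sc]|[s w] []].
  - have [ts|st'] := leP t s.
      have sE : s = t by apply/le_anti; rewrite st.
      by right; split; rewrite /= -?sE.
    left; have [m hm] := (path_eqP w c s0 st').1 sc.
    exists m => //; split=> [|[r _]]; first by rewrite /= in_itv /= s0.
    rewrite /bad; case: ifP => // /andP[r0 rt] [/= [_]].
    rewrite in_itv /= => /andP[sr1 sr2]; apply; apply: hm => //.
    by rewrite sr2 -ltrBlDr.
  - move=> [m _ [[/= /[!in_itv]/= /andP[s0 st] _] hm]].
    split; first by rewrite /= s0 ltW.
    apply/(path_eqP w c s0 st); exists m => r /andP[sr rm] rt.
    apply: contrapT => Xr; apply: hm; exists r => //.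
    rewrite /bad (le_lt_trans s0 sr) rt /=; split=> //=; split; rewrite in_itv /=.
      by rewrite s0.
    by rewrite sr ltrBlDr rm.
  - by move=> [/= -> Xt]; split=> //=; rewrite t0 /=.
apply: measurableU.
  apply: bigcup_measurable => m _; apply: measurableD.
    by apply: measurableX; [exact: measurable_itv|exact: measurableT].
  by apply: countable_bigcupT_measurable => //; exact: countableP.
by apply: measurableX => //; apply: measurable_past; rewrite t0 lexx.
Qed.

Variable W : R -> E -> R.
Hypothesis W_continuous : forall c, {within `[0, +oo[, continuous (W ^~ c)}.

Let W_continuousS t c : {within `[0, t], continuous (W ^~ c)}.
Proof.
have h : `[0, t]%classic `<=` `[0, +oo[%classic by exact: subset_itvl.
exact: continuous_subspaceW h (@W_continuous c).
Qed.

Lemma weight_bounded (t : R) : exists2 M : R, 0 <= M &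
  forall (s : R) c, 0 <= s <= t -> `|W s c| <= M.
Proof.
have h c : {M | 0 <= M & forall s, 0 <= s <= t -> `|W s c| <= M}.
  by apply: cid2; exact: within_continuous_bounded.
exists (\sum_c s2val (h c)); first by apply: sumr_ge0 => c _; case: (h c).
move=> s c st; rewrite (bigD1 c) //=; case: (h c) => /= M M0 /(_ _ st) /le_trans; apply.
by rewrite lerDl; apply: sumr_ge0 => b _; case: (h b).
Qed.

Definition path_integral (t : R) (w : T) : R :=
  \int[lebesgue_measure]_(s in `[0, t]) W s (X s w).

(** The integrand is a finite sum, over states, of a continuous function of time on the occupation
    set of the state. The shift by [M] makes it nonnegative, as Tonelli's theorem requires. *)
Lemma path_density (t M : R) : 0 <= t -> (forall (s : R) c, 0 <= s <= t -> `|W s c| <= M) ->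
  exists f : R * past t -> R, [/\ measurable_fun setT f, forall sw, 0 <= f sw &
    forall s w, f (s, w) = if (0 <= s <= t) then W s (X s w) + M else 0].
Proof.
move=> t0 hM.
have h c : {K : R -> R | continuous K & {in `[0, t], W ^~ c =1 K}}.
  by apply: cid2; exact: continuous_extension.
(* The maximum changes nothing on [[0, t]], where [W] is at least [- M], and gives nonnegativity
   elsewhere. *)
pose K c s := Num.max (s2val (h c) s + M) 0.
have cK c : measurable_fun setT (K c).
  have : {within setT, continuous (K c)}.
    apply: within_continuous_max; last exact: within_continuous_cst.
    apply: within_continuous_add; last exact: within_continuous_cst.
    by apply: continuous_subspaceT; case: (h c).
  exact: (subspace_continuous_measurable_fun measurableT).
exists (fun sw => \sum_c K c sw.1 * \1_(@occupation t c) sw); split.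
- apply: measurable_sum => c; apply: measurable_funM.
    by apply: measurableT_comp (cK c) _; exact: measurable_fst.
  by apply: measurable_indic; exact: measurable_occupation.
- by move=> sw; apply: sumr_ge0 => c _; rewrite mulr_ge0 // le_max lexx orbT.
- move=> s w; case: ifPn => st.
    rewrite (bigD1 (X s w)) //= big1 ?addr0 => [|c cX].
      rewrite indicE mem_set /=; last by split.
      rewrite mulr1 /K; case: (h _) => /= k _ hk; rewrite -hk ?in_itv //= max_l //.
      by have := hM s (X s w) st; rewrite ler_norml; lra.
    rewrite indicE memNset ?mulr0 // => -[/= _ Xc].
    by move: cX; rewrite -Xc eqxx.
  by rewrite big1 // => c _; rewrite indicE memNset ?mulr0 // => -[/= /(negP st)].
Qed.

Lemma measurable_path (t : R) (w : T) : 0 <= t -> measurable_fun `[0, t] (fun s => W s (X s w)).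
Proof.
move=> t0; have [M M0 hM] := weight_bounded t.
have [f [mf _ fE]] := path_density t0 hM.
apply: (@eq_measurable_fun _ _ _ _ _ (fun s => f (s, w) - M)).
  by move=> s; rewrite inE /= in_itv /= => st; rewrite fE st addrK.
apply: measurable_funTS; apply: measurable_funB; last exact: measurable_cst.
by apply: measurableT_comp mf _; exact: pair2_measurable.
Qed.

Lemma integrable_path (t : R) (w : T) : 0 <= t ->
  lebesgue_measure.-integrable `[0, t] (EFin \o (fun s => W s (X s w))).
Proof.
move=> t0; have [M M0 hM] := weight_bounded t.
apply: (@le_integrable _ _ _ _ _ _ _ (EFin \o cst M)) => //.
- by apply/measurable_EFinP; exact: measurable_path.
- move=> s; rewrite /= in_itv /= => st; rewrite lee_fin (ger0_norm M0).
  exact: hM.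
- by apply: within_continuous_integrable; exact: within_continuous_cst.
Qed.

(** Measurability with respect to the past of [t], not just on [T], is what lets the weight be a
    factor in the Markov property. *)
Lemma measurable_path_integral (t : R) : 0 <= t ->
  measurable_fun setT (path_integral t : past t -> R).
Proof.
move=> t0; have [M M0 hM] := weight_bounded t.
have [f [mf f0 fE]] := path_density t0 hM.
have mG := @measurable_fun_fubini_tonelli_G _ _ _ _ R lebesgue_measure (EFin \o f).
have {}mG := mG ((measurable_EFinP _ _).2 mf) (fun sw => f0 sw).
have vol : fine (lebesgue_measure (`[0, t]%classic : set R)) = t.
  rewrite lebesgue_measure_itv /= lte_fin; case: ifPn; rewrite /= ?subr0 //.
  by rewrite -leNgt => t0'; apply/le_anti; rewrite t0 t0'.
have PE (w : T) : path_integral t w = fine (fubini_G lebesgue_measure (EFin \o f) w) - M * t.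
  have -> : fubini_G lebesgue_measure (EFin \o f) w =
      (\int[lebesgue_measure]_(s in `[0%R, t]) (W s (X s w) + M)%:E)%E.
    rewrite [RHS]integral_mkcond /fubini_G; apply: eq_integral => s _ /=.
    by rewrite fE /patch mem_setE in_itv /=; case: ifP.
  rewrite -[fine _]/(\int[lebesgue_measure]_(s in `[0, t]) (W s (X s w) + M)).
  rewrite RintegralD //; last 2 first.
  - exact: integrable_path.
  - by apply: within_continuous_integrable; exact: within_continuous_cst.
  by rewrite Rintegral_cst // vol addrK.
rewrite (_ : path_integral t = (fun w => fine (fubini_G lebesgue_measure (EFin \o f) w) - M * t)); last exact/funext.
apply: measurable_funB; last exact: measurable_cst.
by apply: measurableT_comp mG; exact: fine_measurable.
Qed.

(** Serves twice: [c = 0] gives the Lipschitz bound, and [c] equal to the current weight gives the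
    right derivative. *)
Lemma path_integral_increment (t s u : R) (w : T) (c e : R) : 0 <= s -> s <= u -> u <= t ->
  (forall r, s < r <= u -> `|W r (X r w) - c| <= e) ->
  `|path_integral u w - path_integral s w - c * (u - s)| <= e * (u - s).
Proof.
move=> s0 su ut he.
have u0 := le_trans s0 su.
have iu := integrable_path w u0.
have mI : measurable (`]s, u] : set (measurableTypeR R)) by exact: measurable_itv.
have iI : lebesgue_measure.-integrable `]s, u] (EFin \o (fun r => W r (X r w))).
  by apply: integrableS iu => //; apply: subset_itv; rewrite bnd_simp.
have ic (a : R) : lebesgue_measure.-integrable `]s, u] (EFin \o cst a).
  have h := within_continuous_integrable (@within_continuous_cst _ `[s, u] a).
  by apply: integrableS h => //; exact: subset_itv_oc_cc.
have vol : fine (lebesgue_measure (`]s, u]%classic : set R)) = u - s.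
  rewrite lebesgue_measure_itv /= lte_fin; case: ifPn => //.
  by rewrite -leNgt => us; have -> : u = s by [apply/le_anti; rewrite us]; rewrite subrr.
rewrite /path_integral (@Rintegral_itvB _ _ (BLeft 0) (BRight u) s iu) ?bnd_simp //.
rewrite -vol -(Rintegral_cst lebesgue_measure mI) -RintegralB //; last exact: ic.
apply: (le_trans (le_normr_Rintegral _ _)) => //.
  by apply: eq_integrable (integrableB mI iI (ic c)) => // r _.
rewrite -(Rintegral_cst lebesgue_measure mI); apply: le_Rintegral => //.
- apply: (@le_integrable _ _ _ _ _ _ _ (EFin \o cst e)) => //.
    apply/measurable_EFinP; apply: measurableT_comp => //.
    apply: measurable_funB; last exact: measurable_cst.
    by apply/measurable_EFinP; exact: measurable_int iI.
  move=> r; rewrite /= in_itv /= => rsu; rewrite lee_fin normr_id.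
  by have e0 := le_trans (normr_ge0 _) (he r rsu); rewrite (ger0_norm e0) he.
- exact: ic.
Qed.

Lemma path_integral_lipschitz (t M : R) : (forall (s : R) c, 0 <= s <= t -> `|W s c| <= M) ->
  forall s u w, 0 <= s -> s <= u -> u <= t ->
  `|path_integral u w - path_integral s w| <= M * (u - s).
Proof.
move=> hM s u w s0 su ut.
have := @path_integral_increment t s u w 0 M s0 su ut.
rewrite mul0r subr0; apply => r /andP[sr ru]; rewrite subr0; apply: hM.
by rewrite (le_trans s0 (ltW sr)) (le_trans ru).
Qed.

Lemma path_integral_bound (t M : R) (w : T) : 0 <= t -> (forall (s : R) c, 0 <= s <= t -> `|W s c| <= M) ->
  `|path_integral t w| <= M * t.
Proof.
move=> t0 hM; have := path_integral_lipschitz hM w (lexx 0) t0 (lexx t).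
by rewrite /path_integral set_itv1 Rintegral_set1 !subr0.
Qed.

(** Only from the right, the side on which the path is known to be continuous. *)
Lemma path_integral_derive (t : R) (w : T) : 0 <= t ->
  is_derive_within `[t, +oo[ (path_integral ^~ w) t (W t (X t w)).
Proof.
move=> t0; apply/is_derive_withinP => e e0.
have := X_rcontinuous w t0; rewrite near_withinE => /nbhs_ballP[d1 /= d10 hd1].
have /within_continuousP/(_ t) := @W_continuous (X t w).
rewrite /= in_itv /= t0 => /(_ isT)/cvg_withinP/(_ _ e0)[d2 d20 hd2].
exists (Num.min d1 d2); first by rewrite lt_min d10.
move=> u; rewrite /= in_itv /= andbT lt_min => tu; have ut0 : 0 <= u - t by rewrite subr_ge0.
rewrite ger0_norm // => /andP[u1 u2].
apply: (@path_integral_increment u) => // r /andP[tr ru].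
rewrite hd1 ?hd2 //.
- by rewrite /= in_itv /= (le_trans t0 (ltW tr)).
- by rewrite ger0_norm ?subr_ge0 1?ltW //; lra.
- by rewrite /ball /= ltr0_norm ?subr_lt0 //; lra.
Qed.

End paths.

(* Both sides are integrals over [G], against the images of [P] restricted to
   [Y] and of [P]. *)
Lemma integral_conditional (R : realType) (d d' : measure_display)
  (T : measurableType d) (G : measurableType d') (phi : T -> G)
  (mphi : measurable_fun setT phi) (P : {measure set T -> \bar R})
  (D : set G) (mD : measurable D) (Y : set T) (mY : measurable Y)
  (p : {nonneg R}) (Z : G -> R) (mZ : measurable_fun setT Z) (Z0 : forall g, 0 <= Z g) :
  (forall A, measurable A -> A `<=` D ->
     P (phi @^-1` A `&` Y) = (p%:num%:E * P (phi @^-1` A))%E) ->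
  (\int[P]_(w in phi @^-1` D `&` Y) (Z (phi w))%:E =
   p%:num%:E * \int[P]_(w in phi @^-1` D) (Z (phi w))%:E)%E.
Proof.
move=> hP.
have mpD : measurable (phi @^-1` D) by rewrite -[X in measurable X]setTI; exact: mphi.
have mZE B : measurable_fun B (EFin \o Z) by apply/measurable_EFinP/measurable_funTS.
have mZphi B : measurable_fun B (fun w => (Z (phi w))%:E).
  by apply/measurable_funTS/measurable_EFinP; exact: measurableT_comp mZ mphi.
transitivity (\int[mrestr P mY]_(w in phi @^-1` D `&` Y) (Z (phi w))%:E)%E.
  apply: eq_measure_integral => A mA AD.
  by rewrite /= /mrestr setIidl // => w /AD[].
transitivity (\int[mrestr P mY]_(w in phi @^-1` D) (Z (phi w))%:E)%E.
  rewrite -{2}(setUIDK (phi @^-1` D) Y) ge0_integral_setU //.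
  - rewrite (@null_set_integral _ _ _ _ (phi @^-1` D `\` Y)) ?adde0 //.
      exact: measurableD.
    rewrite /= /mrestr (_ : _ `&` Y = set0) ?measure0 //.
    by apply/seteqP; split => // w [[_ nY] /nY].
  - exact: measurableI.
  - exact: measurableD.
  - by move=> w _; rewrite lee_fin.
  - by apply/disj_setPS => w [[_ Yw] [_ /(_ Yw)]].
rewrite -(ge0_integral_pushforward mphi (mrestr P mY) mD (mZE D)); last first.
  by move=> g _; rewrite lee_fin.
rewrite -(ge0_integral_pushforward mphi P mD (mZE D)); last first.
  by move=> g _; rewrite lee_fin.
rewrite -ge0_integral_mscale //; last by move=> g _; rewrite lee_fin /=.
apply: eq_measure_integral => A mA AD.
by rewrite /= /mscale /= /pushforward /mrestr hP.
Qed.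

Lemma expR_lipschitz (R : realType) (a b M : R) : expR a <= M -> expR b <= M ->
  `|expR a - expR b| <= M * `|a - b|.
Proof.
wlog ab : a b / b <= a.
  move=> h aM bM; have [ba|ab] := leP b a; first exact: h.
  by rewrite distrC (distrC a); apply: h => //; exact: ltW.
move=> aM _; rewrite !ger0_norm ?subr_ge0 ?ler_expR //.
apply: (@le_trans _ _ (expR a * (a - b))); last by rewrite ler_wpM2r // subr_ge0.
have := @expR_ge1Dx R (b - a); rewrite expRD expRN => h.
have a0 := expR_gt0 a.
have : expR a * (1 + (b - a)) <= expR b.
  by rewrite -ler_pdivlMl // mulrC.
by rewrite mulrDr mulr1; lra.
Qed.

Section bounded_integrals.
Context {R : realType} {d : measure_display} {T : measurableType d}.
Variable P : probability T R.

Lemma bounded_integrable (Z : T -> R) M : measurable_fun setT Z ->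
  (forall w, `|Z w| <= M) -> P.-integrable setT (EFin \o Z).
Proof.
move=> mZ ZM; apply: (@le_integrable _ _ _ P _ _ _ (EFin \o cst M)) => //.
- exact/measurable_EFinP.
- move=> w _; rewrite lee_fin (le_trans (ZM w)) // ler_norm //.
- exact: finite_measure_integrable_cst.
Qed.

Lemma Rintegral_sum (I : finType) (f : I -> T -> R) :
  (forall i, P.-integrable setT (EFin \o f i)) ->
  \int[P]_w (\sum_i f i w) = \sum_i \int[P]_w f i w.
Proof.
move=> fi; rewrite /Rintegral; under eq_integral do rewrite -sumEFin.
rewrite integral_sum // sum_fine // => i _.
by apply: integrable_fin_num => //; exact: fi.
Qed.

Lemma Rintegral_finite_comp (E : finType) (Y : T -> E) (Z : T -> R) (phi : E -> R) M :
  (forall c, measurable (Y @^-1` [set c])) -> measurable_fun setT Z ->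
  (forall w, `|Z w| <= M) ->
  \int[P]_w (Z w * phi (Y w)) = \sum_c \int[P]_w (Z w * (Y w == c)%:R) * phi c.
Proof.
move=> mY mZ ZM.
have Zi c : P.-integrable setT (EFin \o (fun w => Z w * (Y w == c)%:R)).
  apply: (@bounded_integrable _ M).
    apply: measurable_funM => //.
    exact: (@measurable_finite_comp R E d T Y (fun x => (x == c)%:R)).
  move=> w; rewrite normrM; case: eqP => _; first by rewrite normr1 mulr1.
  by rewrite normr0 mulr0 (le_trans _ (ZM w)).
under [RHS]eq_bigr do rewrite -RintegralZr //.
rewrite -Rintegral_sum; last first.
  move=> c; have := integrableZr measurableT (phi c) (Zi c).
  by apply: eq_integrable => // w _ /=; rewrite EFinM.
apply: eq_Rintegral => w _; rewrite (bigD1 (Y w)) //= eqxx mulr1 big1 ?addr0 //.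
by move=> c /negPf cY; rewrite eq_sym cY mulr0 mul0r.
Qed.

End bounded_integrals.

(** * Discounted expectations and the Markov property *)

Section feynman_kac.
Context {R : realType} {E : finType} {d : measure_display} {T : measurableType d}.
Variables (P : probability T R) (A : R -> (E -> R) -> E -> R) (init : E -> R).
Variable X : R -> T -> E.
Hypothesis hX : markov_process P A init X.
Variable W : R -> E -> R.
Hypothesis W_continuous : forall c, {within `[0, +oo[, continuous (W ^~ c)}.

Let X_measurable := markov_measurable hX.
Let X_rcontinuous := markov_rcontinuous hX.

(** The parameter [k] is 1 for first moments of the weighted empirical measure and 2 for second
    moments, where its weight is squared. *)
Definition discount (k t : R) (w : T) : R := expR (- (k * path_integral X W t w)).

Definition tilted (k t : R) (phi : E -> R) : R :=
  \int[P]_w (discount k t w * phi (X t w)).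

Definition tilted_mass (k t : R) (c : E) : R := tilted k t (fun x => (x == c)%:R).

Lemma discount_bounded (k t : R) : 0 <= t ->
  exists2 M, 0 < M & forall s w, 0 <= s <= t -> discount k s w <= M.
Proof.
move=> t0; have [M M0 hM] := weight_bounded W_continuous t.
exists (expR (`|k| * (M * t))); first exact: expR_gt0.
move=> s w /andP[s0 st]; rewrite ler_expR (le_trans (ler_norm _)) // normrN normrM.
rewrite ler_wpM2l //.
apply: (@le_trans _ _ (M * s)); last by rewrite ler_wpM2l.
apply: (path_integral_bound X_rcontinuous W_continuous) => // r c /andP[r0 rs].
by apply: hM; rewrite r0 (le_trans rs).
Qed.

Lemma measurable_discount_past (k t : R) : 0 <= t ->
  measurable_fun setT
    (discount k t : g_sigma_algebraType (history_generators X t) -> R).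
Proof.
move=> t0; apply: measurableT_comp; first exact: measurable_expR.
apply: measurable_funN; apply: measurable_funM; first exact: measurable_cst.
exact: (measurable_path_integral X_rcontinuous W_continuous).
Qed.

Lemma measurable_discount (k t : R) : 0 <= t -> measurable_fun setT (discount k t).
Proof.
move=> t0.
exact: (measurableT_comp (measurable_discount_past k t0) (measurable_fun_past X_measurable (t := t))).
Qed.

Lemma discount_norm (k t : R) w : `|discount k t w| = discount k t w.
Proof. by rewrite ger0_norm ?expR_ge0. Qed.

Lemma tiltedE (k t : R) phi : 0 <= t ->
  tilted k t phi = \sum_c tilted_mass k t c * phi c.
Proof.
move=> t0; have [M M0 hM] := discount_bounded k t0.
apply: (@Rintegral_finite_comp _ _ _ P E (X t) (discount k t) phi M).
- by move=> c; exact: X_measurable.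
- exact: measurable_discount.
- by move=> w; rewrite discount_norm hM // t0 /=.
Qed.

Lemma tilted_mass_ge0 (k t : R) c : 0 <= tilted_mass k t c.
Proof. by apply: Rintegral_ge0 => w _; rewrite mulr_ge0 ?expR_ge0. Qed.

Lemma tilted0 (k : R) phi : tilted k 0 phi = \sum_c init c * phi c.
Proof.
rewrite tiltedE //; apply: eq_bigr => c _; congr (_ * _).
rewrite /tilted_mass /tilted /discount /path_integral set_itv1.
have -> : init c = fine (P (X 0 @^-1` [set c])) by rewrite (markov_init hX).
have mc : measurable (X 0 @^-1` [set c]) by exact: X_measurable.
rewrite -[RHS](mul1r _) -(Rintegral_cst P mc) [RHS]Rintegral_mkcond.
apply: eq_Rintegral => w _; rewrite Rintegral_set1 mulr0 oppr0 expR0 mul1r /patch.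
case: ifPn; rewrite ?inE ?notin_setE /=; first by move=> ->; rewrite eqxx.
by move=> /eqP/negPf ->.
Qed.

Section transition.
Variable p : R -> R -> E -> E -> R.
Hypothesis hp : transition_function A p.
Hypothesis p_markov : forall (s t : R) (B : set T) x y, 0 <= s <= t -> history X s B ->
  P (B `&` X s @^-1` [set x] `&` X t @^-1` [set y]) =
  (P (B `&` X s @^-1` [set x]) * (p s t x y)%:E)%E.

(** The Markov property is stated for events of the past; [integral_conditional] carries it over to
    the factor [discount k s], which depends only on the path up to [s]. *)
Lemma discount_transition (k s t : R) x y : 0 <= s <= t ->
  \int[P]_w (discount k s w * ((X s w, X t w) == (x, y))%:R) =
  tilted_mass k s x * p s t x y.
Proof.
move=> st; have /andP[s0 s_t] := st.
have pxy0 : 0 <= p s t x y := trans_ge0 hp x y st.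
have mX u : 0 <= u <= s -> measurable (X u @^-1` [set x] : set (g_sigma_algebraType (history_generators X s))).
  exact: measurable_past.
have mY : measurable (X t @^-1` [set y]) by apply: X_measurable; exact: le_trans s_t.
have mxs : 0 <= s <= s by rewrite s0 lexx.
have := @integral_conditional R _ _ T _ _ (measurable_fun_past X_measurable (t := s)) P
  _ (mX s mxs) _ mY (NngNum pxy0) _ (measurable_discount_past k s0) (fun w => expR_ge0 _).
have hP (B : set (g_sigma_algebraType (history_generators X s))) : measurable B -> B `<=` X s @^-1` [set x] ->
    P (B `&` X t @^-1` [set y]) = ((p s t x y)%:E * P B)%E.
  by move=> mB Bx; rewrite muleC -{1 2}(setIidl Bx) p_markov.
move=> /(_ hP) /= H.
transitivity (\int[P]_(w in X s @^-1` [set x] `&` X t @^-1` [set y]) discount k s w).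
  rewrite [RHS]Rintegral_mkcond; apply: eq_Rintegral => w _; rewrite /patch xpair_eqE.
  case: ifPn; rewrite ?inE ?notin_setE /=.
    by move=> [-> ->]; rewrite !eqxx mulr1.
  move=> h; case: eqP => [xE|]; case: eqP => [yE|] /=; rewrite ?mulr0 //.
  by exfalso; apply: h.
rewrite /Rintegral H /= fineM //; last first.
  have [M M0 hM] := discount_bounded k s0.
  have : P.-integrable setT (EFin \o discount k s).
    apply: (@bounded_integrable _ _ _ _ _ M); first exact: measurable_discount.
    by move=> w; rewrite discount_norm hM.
  move=> /integrableS h; apply: integrable_fin_num; first exact: X_measurable.
  by apply: h => //; exact: X_measurable.
rewrite mulrC; congr (_ * _); rewrite -[LHS]/(\int[P]_(w in X s @^-1` [set x]) discount k s w).
rewrite [LHS]Rintegral_mkcond; apply: eq_Rintegral => w _; rewrite /patch.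
case: ifPn; rewrite ?inE ?notin_setE /=; first by move=> ->; rewrite eqxx mulr1.
by move=> /eqP/negPf ->; rewrite mulr0.
Qed.

Lemma discount_markov (k s t : R) phi : 0 <= s <= t ->
  \int[P]_w (discount k s w * phi (X t w)) =
  \sum_x tilted_mass k s x * apply_kernel (p s t) phi x.
Proof.
move=> st; have /andP[s0 s_t] := st.
have [M M0 hM] := discount_bounded k s0.
rewrite (@Rintegral_finite_comp _ _ _ P (E * E)%type (fun w => (X s w, X t w)) (discount k s)
  (fun xy => phi xy.2) M).
- transitivity (\sum_(c : E * E) tilted_mass k s c.1 * (p s t c.1 c.2 * phi c.2)).
    by apply: eq_bigr => -[x y] _; rewrite discount_transition // -mulrA.
  rewrite -(pair_bigA _ (fun x y => tilted_mass k s x * (p s t x y * phi y))) /=.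
  by apply: eq_bigr => x _; rewrite mulr_sumr.
- move=> [x y]; rewrite (_ : _ @^-1` _ = X s @^-1` [set x] `&` X t @^-1` [set y]).
    by apply: measurableI; apply: X_measurable => //; exact: le_trans s_t.
  by apply/seteqP; split => w /=; [case=> -> ->|case=> -> ->].
- exact: measurable_discount.
- by move=> w; rewrite discount_norm hM // s0 /=.
Qed.

End transition.
End feynman_kac.

(** * From right derivatives to derivatives of weighted expectations *)

Section right_derivative.
Context {R : realType}.
Implicit Types (f g F : R -> R) (a b x t l : R).

Lemma is_derive_within_right f t l :
  (f u - f t) / (u - t) @[u --> t^'+] --> l -> is_derive_within `[t, +oo[ f t l.
Proof.
move/cvgrPdist_le => h; apply/is_derive_withinP => e e0.
have := h e e0; rewrite near_withinE => /nbhs_ballP[d /= d0 hd]; exists d => // u.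
rewrite /= in_itv /= andbT le_eqVlt => /predU1P[<- _|tu ud].
  by rewrite !subrr mulr0 subrr normr0 mulr0.
have ut : u - t != 0 by rewrite subr_eq0 gt_eqF.
have := hd u; rewrite /ball /= distrC => /(_ ud tu).
rewrite distrC => H.
have -> : f u - f t - l * (u - t) = ((f u - f t) / (u - t) - l) * (u - t) by field.
by rewrite normrM ler_wpM2r.
Qed.

(* Comparison with [int_0^x g] through the Dini criterion. *)
Lemma derive_within_of_right f g b :
  {within `[0, b], continuous f} -> {within `[0, b], continuous g} ->
  (forall x, 0 <= x < b -> is_derive_within `[x, b] f x (g x)) ->
  forall x, 0 <= x <= b -> is_derive_within `[0, b] f x (g x).
Proof.
move=> cf cg df x xb.
pose J y := \int[lebesgue_measure]_(s in `[0, y]) g s.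
have dJ y : 0 <= y <= b -> is_derive_within `[0, b] J y (g y).
  by move=> yb; exact: is_derive_within_integral.
have J0 : J 0 = 0 by rewrite /J set_itv1 Rintegral_set1.
have cJ : {within `[0, b], continuous J}.
  by apply: (is_derive_within_continuous (f' := g)) => y; rewrite /= in_itv /=; exact: dJ.
(* Used with [c = 1] and [c = -1]: both [f - J] and its opposite are nondecreasing, so [f - J] is
   constant. *)
have key (c : R) y : 0 <= y <= b -> c * (f 0 - J 0) <= c * (f y - J y).
  move=> /andP[y0 yb]; apply: (@dini_nondecreasing _ 0 y (fun z => c * (f z - J z))) => //.
    have sub : `[0, y]%classic `<=` `[0, b]%classic by apply: subset_itvl; rewrite bnd_simp.
    apply: within_continuousM; first exact: within_continuous_cst.
    apply: within_continuous_add; first exact: within_continuousS cf.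
    by apply: within_continuousN; exact: within_continuousS cJ.
  move=> z /andP[z0 zy] e e0.
  have zb : z < b := lt_le_trans zy yb.
  have z0b : 0 <= z < b by rewrite z0.
  have dJz : is_derive_within `[z, b] J z (g z).
    apply: is_derive_withinS (dJ z _); last by rewrite z0 ltW.
    by apply: subset_itvr; rewrite bnd_simp.
  have /is_derive_withinP/(_ _ e0)[d d0 hd] :=
    is_derive_withinZ (c := c) (is_derive_withinB (df z z0b) dJz).
  exists d => // u /andP[zu uzd] uy.
  have := hd u; rewrite /= in_itv /= zu (le_trans uy yb) => /(_ isT).
  rewrite ger0_norm ?subr_ge0 // ltrBlDl => /(_ uzd).
  by rewrite subrr mulr0 mul0r subr0 ler_norml => /andP[+ _]; rewrite mulNr.
have fE y : 0 <= y <= b -> f y = f 0 + J y.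
  move=> yb; have := key 1 y yb; have := key (-1) y yb; rewrite J0 subr0 => h1 h2.
  by apply/le_anti; apply/andP; split; lra.
have dfJ := is_derive_withinD (is_derive_within_cst `[0, b] (f 0) x) (dJ x xb).
apply: is_derive_within_eq dfJ; first by rewrite /= in_itv.
  by move=> y; rewrite inE /= in_itv /= => yb; exact/esym/fE.
by rewrite add0r.
Qed.

End right_derivative.

Section tilted_derivative.
Context {R : realType} {E : finType} {d : measure_display} {T : measurableType d}.
Variables (P : probability T R) (A : R -> (E -> R) -> E -> R) (init : E -> R).
Variable X : R -> T -> E.
Hypothesis hX : markov_process P A init X.
Variable W : R -> E -> R.
Hypothesis W_continuous : forall c, {within `[0, +oo[, continuous (W ^~ c)}.
Hypothesis A_continuous :
  forall phi c, {within `[0, +oo[, continuous (fun t => A t phi c)}.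

Let X_measurable := markov_measurable hX.
Let X_rcontinuous := markov_rcontinuous hX.
Local Notation disc := (discount X W).
Local Notation tilt := (tilted P X W).
Local Notation tmass := (tilted_mass P X W).

Lemma norm_Rintegral_le (Z : T -> R) M : measurable_fun setT Z ->
  (forall w, `|Z w| <= M) -> `|\int[P]_w Z w| <= M.
Proof.
move=> mZ ZM; have Zi := bounded_integrable P mZ ZM.
apply: (le_trans (le_normr_Rintegral measurableT Zi)).
have -> : M = \int[P]_(w in setT) cst M w.
  by rewrite Rintegral_cst //= (@probability_setT _ _ _ P) /= mulr1.
apply: le_Rintegral => //; last exact: finite_measure_integrable_cst.
apply: (@bounded_integrable _ _ _ P _ (M)); first exact: measurableT_comp.
by move=> w; rewrite normr_id.
Qed.

Lemma measurable_state (t : R) (phi : E -> R) : 0 <= t ->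
  measurable_fun setT (fun w => phi (X t w)).
Proof. by move=> t0; apply: measurable_finite_comp => c; exact: X_measurable. Qed.

Lemma finite_function_bounded (phi : E -> R) :
  exists2 M, 0 <= M & forall c, `|phi c| <= M.
Proof.
exists (\sum_c `|phi c|); first exact: sumr_ge0.
by move=> c; rewrite (bigD1 c) //= lerDl; exact: sumr_ge0.
Qed.

Lemma discount_lipschitz (k t : R) : 0 <= t -> exists2 C, 0 <= C &
  forall s u w, 0 <= s -> s <= u -> u <= t -> `|disc k u w - disc k s w| <= C * (u - s).
Proof.
move=> t0; have [M M0 hM] := weight_bounded W_continuous t.
have [D D0 hD] := discount_bounded hX W_continuous k t0.
exists (D * (`|k| * M)); first by rewrite !mulr_ge0 // ltW.
move=> s u w s0 su ut; apply: (le_trans (expR_lipschitz (M := D) _ _)).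
- by apply: hD; rewrite (le_trans s0 su).
- by apply: hD; rewrite s0 (le_trans su ut).
rewrite -!mulrA ler_wpM2l ?(ltW D0) // -opprB normrN opprK addrC -mulrBr normrM ler_wpM2l //.
exact: (path_integral_lipschitz X_rcontinuous W_continuous hM w s0 su ut).
Qed.

Lemma discount_derive (k t : R) (w : T) : 0 <= t ->
  is_derive_within `[t, +oo[ (fun u => disc k u w) t (- (k * W t (X t w)) * disc k t w).
Proof.
move=> t0; rewrite mulrC; apply: is_derive_within_comp.
apply: is_derive_withinN; apply: is_derive_withinZ.
exact: (path_integral_derive X_rcontinuous W_continuous).
Qed.

(** A product rule before any limit: the first term moves the state with the weight frozen at [s],
    where the Markov property applies, and the second carries the change of weight. *)
Lemma tilted_increment (k s u : R) phi : 0 <= s <= u ->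
  tilt k u phi = \int[P]_w (disc k s w * phi (X u w)) +
                 \int[P]_w ((disc k u w - disc k s w) * phi (X u w)).
Proof.
move=> /andP[s0 su]; have u0 := le_trans s0 su.
have [B B0 hB] := finite_function_bounded phi.
have [D D0 hD] := discount_bounded hX W_continuous k u0.
have Zi (v : R) : 0 <= v <= u -> P.-integrable setT (EFin \o (fun w => disc k v w * phi (X u w))).
  move=> vu; have v0 : 0 <= v by case/andP: vu.
  apply: (@bounded_integrable _ _ _ P _ (D * B)).
    apply: measurable_funM; last exact: measurable_state.
    exact: (measurable_discount hX W_continuous).
  by move=> w; rewrite normrM discount_norm ler_pM ?expR_ge0 // hD.
under [X in _ + X]eq_Rintegral do rewrite mulrBl.
rewrite RintegralB //; last 2 first.
- by apply: Zi; rewrite u0 lexx.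
- by apply: Zi; rewrite s0.
by rewrite addrC subrK.
Qed.

(** Supplies the continuity that turns right derivatives into derivatives. The state part follows
    from the forward equation, whose right-hand side is bounded by [K] because the rows of [p] are
    probabilities; the weight part follows from [discount_lipschitz]. *)
Lemma tilted_lipschitz (k t : R) phi : 0 <= t -> exists2 C, 0 <= C &
  forall s u, 0 <= s -> s <= u -> u <= t -> `|tilt k u phi - tilt k s phi| <= C * (u - s).
Proof.
move=> t0; have [p hp pm] := markov_property hX.
have [B B0 hB] := finite_function_bounded phi.
have [D D0 hD] := discount_bounded hX W_continuous k t0.
have [C C0 hC] := discount_lipschitz k t0.
have cA c : {within `[0, t], continuous (fun t => A t phi c)}.
  have sub : `[0, t]%classic `<=` `[0, +oo[%classic by exact: subset_itvl.
  exact: within_continuousS sub (@A_continuous phi c).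
have [K K0 hK] : exists2 K, 0 <= K & forall u c, 0 <= u <= t -> `|A u phi c| <= K.
  have h c : {M | 0 <= M & forall s, 0 <= s <= t -> `|A s phi c| <= M}.
    by apply: cid2; exact: within_continuous_bounded.
  exists (\sum_c s2val (h c)); first by apply: sumr_ge0 => c _; case: (h c).
  move=> s c st; rewrite (bigD1 c) //=; case: (h c) => /= M M0 /(_ _ st) /le_trans; apply.
  by rewrite lerDl; apply: sumr_ge0 => b _; case: (h b).
exists (\sum_(c : E) D * K + C * B).
  by rewrite addr_ge0 ?mulr_ge0 //; apply: sumr_ge0 => c _; rewrite mulr_ge0 // ltW.
move=> s u s0 su ut; have u0 := le_trans s0 su.
have su' : 0 <= s <= u by rewrite s0.
rewrite (tilted_increment k phi su') (discount_markov hX W_continuous hp pm) //.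
rewrite (tiltedE hX W_continuous) // addrAC -sumrB mulrDl.
apply: (le_trans (ler_normD _ _)); apply: lerD.
  rewrite mulr_suml; apply: (le_trans (ler_norm_sum _ _ _)); apply: ler_sum => c _.
  rewrite -mulrBr normrM -mulrA; apply: ler_pM => //.
    apply: norm_Rintegral_le => [|w].
      apply: measurable_funM; last exact: (measurable_state (fun x => (x == c)%:R)).
      exact: (measurable_discount hX W_continuous).
    rewrite normrM discount_norm -[leRHS]mulr1 ler_pM ?expR_ge0 //.
      by apply: hD; rewrite s0 (le_trans su).
    by case: eqP => _; rewrite ?normr1 ?normr0.
  have dP v : s <= v <= u -> is_derive_within `[s, u] (fun v => apply_kernel (p s v) phi c) v
      (apply_kernel (p s v) (A v phi) c).
    move=> /andP[sv vu].
    have sub : `[s, u]%classic `<=` `[s, +oo[%classic by exact: subset_itvl.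
    by apply: is_derive_withinS sub _; apply: (trans_forward hp); rewrite s0.
  have bP v : s <= v <= u -> `|apply_kernel (p s v) (A v phi) c| <= K.
    move=> /andP[sv vu]; have sv0 : 0 <= s <= v by rewrite s0.
    rewrite -[K]mul1r -(trans_mass1 hp c sv0) mulr_suml.
    apply: (le_trans (ler_norm_sum _ _ _)); apply: ler_sum => b _.
    rewrite normrM ger0_norm ?(trans_ge0 hp) // ler_wpM2l ?(trans_ge0 hp) //.
    by apply: hK; rewrite (le_trans s0 sv) (le_trans vu).
  have -> : phi c = apply_kernel (p s s) phi c.
    rewrite /apply_kernel (bigD1 c) //= big1 => [|b bc]; rewrite (trans_id hp) //.
      by rewrite eqxx mul1r addr0.
    by rewrite eq_sym (negPf bc) mul0r.
  rewrite ler_norml; apply/andP; split.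
    have := derive_le_increment su (fun v vs => is_derive_withinN (dP v vs)) (c := K).
    move=> h; rewrite lerNl opprB -[leLHS]opprB opprB.
    have : - apply_kernel (p s u) phi c - - apply_kernel (p s s) phi c <= K * (u - s).
      by apply: h => v vs; rewrite (le_trans (ler_norm _)) // normrN bP.
    by lra.
  apply: (derive_le_increment su dP) => v vs.
  by rewrite (le_trans (ler_norm _)) // bP.
apply: (@norm_Rintegral_le _ (C * B * (u - s))) => [|w].
  apply: measurable_funM; last exact: measurable_state.
  by apply: measurable_funB; exact: (measurable_discount hX W_continuous).
by rewrite normrM mulrAC ler_pM // hC.
Qed.

Lemma tilted_continuous (k b : R) phi : {within `[0, b], continuous (tilt k ^~ phi)}.
Proof.
apply/within_continuousP => x; rewrite /= in_itv /= => /andP[x0 xb].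
have b0 := le_trans x0 xb.
have [C C0 hC] := tilted_lipschitz k phi b0.
apply/cvg_withinP => e e0; exists (e / (C + 1)); first by rewrite divr_gt0 // ltr_wpDl.
move=> u; rewrite /= in_itv /= => /andP[u0 ub]; rewrite ltr_pdivlMr ?ltr_wpDl // => uxe.
apply: (@le_trans _ _ (C * `|u - x|)).
  have [xu|ux] := leP x u; first by rewrite [X in C * X]ger0_norm ?subr_ge0 //; exact: hC.
  by rewrite distrC [X in C * X]ltr0_norm ?subr_lt0 // opprB; apply: hC => //; exact: ltW.
by rewrite mulrC (le_trans _ (ltW uxe)) // ler_wpM2l // lerDl.
Qed.

(* Dominated convergence; right continuity freezes the state just after [t]. *)
Lemma discount_part_derive (k t : R) phi : 0 <= t ->
  is_derive_within `[t, +oo[ (fun u => \int[P]_w ((disc k u w - disc k t w) * phi (X u w))) t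
    (tilt k t (fun c => - (k * W t c) * phi c)).
Proof.
move=> t0.
have t1 : 0 <= t + 1 by rewrite addr_ge0.
have [B B0 hB] := finite_function_bounded phi.
have [C C0 hC] := discount_lipschitz k t1.
pose Z u w := (disc k u w - disc k t w) / (u - t) * phi (X u w).
pose Z0 w := disc k t w * (- (k * W t (X t w)) * phi (X t w)).
have mZ (u : R) : 0 <= u -> measurable_fun setT (Z u).
  move=> u0; apply: measurable_funM; last exact: measurable_state.
  apply: measurable_funM; last exact: measurable_cst.
  by apply: measurable_funB; exact: (measurable_discount hX W_continuous).
have bZ u w : t < u <= t + 1 -> `|Z u w| <= C * B.
  move=> /andP[tu ut1]; rewrite normrM ler_pM //.
  rewrite normrM normfV (ger0_norm (x := u - t)) ?subr_ge0 ?(ltW tu) //.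
  rewrite ler_pdivrMr ?subr_gt0 //; apply: hC => //; exact: ltW.
(* Stopping [u] at [t + 1] makes the dominating constant valid along the whole sequence; close to
   [t] it has no effect. *)
have key : (\int[P]_w Z (Num.min u (t + 1)) w) @[u --> t^'+] --> \int[P]_w Z0 w.
  apply/cvg_at_rightP => u [ut ucv].
  pose v n := Num.min (u n) (t + 1).
  have vt n : t < v n <= t + 1 by rewrite lt_min ut ltrDl ltr01 /= ge_min lexx orbT.
  have vcv : v n @[n --> \oo] --> t.
    apply/cvgrPdist_le => e e0; move/cvgrPdist_le: ucv => /(_ e e0); apply: filterS => n.
    rewrite !ler0_norm ?subr_le0 ?(ltW (ut n)) //; last by case/andP: (vt n) => /ltW.
    rewrite !opprB => /(le_trans _); apply; rewrite lerD2r.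
    by rewrite /v ge_min lexx.
  have cvZ w : Z (v n) w @[n --> \oo] --> Z0 w.
    have -> : Z0 w = (- (k * W t (X t w)) * disc k t w) * phi (X t w) by rewrite /Z0; ring.
    have eX : \forall n \near \oo, X (v n) w = X t w.
      have := X_rcontinuous w t0; rewrite near_withinE => /nbhs_ballP[e /= e0 he].
      move/cvgrPdist_lt: vcv => /(_ e e0); apply: filterS => n hn.
      by apply: he => //; case/andP: (vt n).
    have cq : (disc k (v n) w - disc k t w) / (v n - t) @[n --> \oo] --> - (k * W t (X t w)) * disc k t w.
      have /is_derive_withinP hd := @discount_derive k t w t0.
      apply/cvgrPdist_le => e e0; have [c c0 hc] := hd e e0.
      move/cvgrPdist_lt: vcv => /(_ c c0); apply: filterS => n hn.
      have /andP[tv _] := vt n.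
      have vt0 : 0 < v n - t by rewrite subr_gt0.
      rewrite distrC in hn; have := hc (v n); rewrite /= in_itv /= (ltW tv) => /(_ isT hn).
      have -> : disc k (v n) w - disc k t w - - (k * W t (X t w)) * disc k t w * (v n - t) =
         ((disc k (v n) w - disc k t w) / (v n - t) - - (k * W t (X t w)) * disc k t w) * (v n - t).
        by rewrite mulrBl divfK // gt_eqF.
      by rewrite normrM ler_pM2r ?normr_gt0 ?gt_eqF // distrC.
    apply: cvgM cq _; apply: cvg_near_cst.
    by apply: filterS eX => n ->.
  have mv n : 0 <= v n by case/andP: (vt n) => /ltW /(le_trans t0).
  have mZ0 : measurable_fun setT Z0.
    apply: measurable_funM; first exact: (measurable_discount hX W_continuous).
    exact: (measurable_state (fun c => - (k * W t c) * phi c)).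
  have := @dominated_cvg _ _ _ P setT measurableT (fun n w => (Z (v n) w)%:E)
    (fun w => (Z0 w)%:E) (EFin \o cst (C * B)).
  have H1 n : measurable_fun setT (fun w => (Z (v n) w)%:E) by apply/measurable_EFinP; exact: mZ.
  have H2 w : setT w -> (Z (v n) w)%:E @[n --> \oo] --> (Z0 w)%:E.
    by move=> _; apply: cvg_EFin; [exact: nearW|exact: cvZ].
  have H3 : P.-integrable setT (EFin \o cst (C * B)) by exact: finite_measure_integrable_cst.
  have H4 n w : setT w -> (`|(Z (v n) w)%:E| <= (EFin \o cst (C * B)%R) w)%E.
    by move=> _; rewrite /= lee_fin; exact: bZ.
  move=> /(_ H1 H2 (fun w _ => isT) H3 H4) H.
  have Zi n : P.-integrable setT (EFin \o Z (v n)).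
    by apply: (@bounded_integrable _ _ _ P _ (C * B)); [exact: mZ|move=> w; exact: bZ].
  have [B' B'0 hB'] := finite_function_bounded (fun c => - (k * W t c) * phi c).
  have [D D0 hD] := discount_bounded hX W_continuous k t0.
  have Z0i : P.-integrable setT (EFin \o Z0).
    apply: (@bounded_integrable _ _ _ P _ (D * B')) => // w.
    by rewrite normrM discount_norm ler_pM ?expR_ge0 // ?hD ?t0 /= ?lexx // hB'.
  apply: fine_cvg.
  by rewrite /Rintegral fineK //; exact: integrable_fin_num.
rewrite -[tilt _ _ _]/(\int[P]_w Z0 w); apply: is_derive_within_right.
apply: cvg_trans key; apply: near_eq_cvg; near=> u.
have tu : t < u by near: u; exact: nbhs_right_gt.
have ut1 : u <= t + 1 by near: u; apply: nbhs_right_le; rewrite ltrDl.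
have u0 : 0 <= u := le_trans t0 (ltW tu).
under [X in _ - X]eq_Rintegral do rewrite subrr mul0r.
rewrite Rintegral_cst // mul0r subr0 min_l // mulrC -RintegralZl //.
  by apply: eq_Rintegral => w _; rewrite /Z; ring.
have [D D0 hD] := discount_bounded hX W_continuous k u0.
apply: (@bounded_integrable _ _ _ P _ (C * (u - t) * B)) => [|w].
  apply: measurable_funM; last exact: measurable_state.
  by apply: measurable_funB; exact: (measurable_discount hX W_continuous).
by rewrite normrM ler_pM // hC // ltW.
Unshelve. all: by end_near. Qed.

(** The forward equation with killing rate [k * W]. At each [t] the right derivative has a part from
    [trans_forward], with masses frozen at [t], and a part from the weight. Their sum is continuous
    in [t], so it is the derivative. *)
Lemma tilted_derive (k b t : R) phi : 0 <= t <= b ->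
  is_derive_within `[0, b] (tilt k ^~ phi) t
    (tilt k t (fun c => A t phi c - k * W t c * phi c)).
Proof.
have sub : `[0, b]%classic `<=` `[0, +oo[%classic by exact: subset_itvl.
have [p hp pm] := markov_property hX.
move: t; apply: (derive_within_of_right (g := fun t => tilt k t (fun c => A t phi c - k * W t c * phi c))).
- exact: tilted_continuous.
- apply/within_continuousP => t tb.
  have tE s : s \in `[0, b]%classic -> tilt k s (fun c => A s phi c - k * W s c * phi c) =
     \sum_c tmass k s c * (A s phi c - k * W s c * phi c).
    by rewrite inE /= in_itv /= => /andP[s0 _]; exact: (tiltedE hX W_continuous).
  have : {within `[0, b], continuous (fun s => \sum_c tmass k s c * (A s phi c - k * W s c * phi c))}.
    apply: within_continuous_sum => c; apply: within_continuousM.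
      exact: tilted_continuous.
    apply: within_continuous_add; first exact: within_continuousS sub (@A_continuous phi c).
    apply/within_continuousN/within_continuousM; last exact: within_continuous_cst.
    apply: within_continuousM; first exact: within_continuous_cst.
    exact: within_continuousS sub (@W_continuous c).
  move/within_continuousP => /(_ t tb) /cvg_withinP h; apply/cvg_withinP => e /h[c c0 hc].
  by exists c => // u ub ut; rewrite !tE ?inE //; exact: hc.
- move=> t /andP[t0 tb].
  have subt : `[t, b]%classic `<=` `[t, +oo[%classic by exact: subset_itvl.
  have dS : is_derive_within `[t, +oo[ (fun u => \sum_x tmass k t x * apply_kernel (p t u) phi x) t
      (\sum_x tmass k t x * apply_kernel (p t t) (A t phi) x).
    apply: is_derive_within_sum => x; apply: is_derive_withinZ.
    by apply: (trans_forward hp); rewrite t0 lexx.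
  apply: is_derive_withinS subt _.
  apply: is_derive_within_eq (is_derive_withinD dS (@discount_part_derive k t phi t0)).
  + by rewrite /= in_itv /= lexx.
  + move=> u; rewrite inE /= in_itv /= andbT => tu.
    have tu0 : 0 <= t <= u by rewrite t0.
    by rewrite (tilted_increment k phi tu0) (discount_markov hX W_continuous hp pm).
  + rewrite !(tiltedE hX W_continuous) // -big_split; apply: eq_bigr => x _ /=.
    rewrite /apply_kernel (bigD1 x) //= big1 ?addr0 => [|y yx].
      by rewrite (trans_id hp) // eqxx mul1r; ring.
    by rewrite (trans_id hp) // eq_sym (negPf yx) mul0r.
Qed.

End tilted_derivative.

(** * The particle system *)

Section energy.
Context {R : realType} {S : finType}.
Implicit Types (f : R -> R) (t l : R).

Lemma derive_withinE f t l : 0 <= t -> is_derive_within `[0, +oo[ f t l ->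
  derive_within `[0, +oo[ f t = l.
Proof.
move=> t0 h; rewrite /derive_within; move: h; rewrite /is_derive_within.
(* The limit is unique because [t] is not isolated in the half-line. *)
suff PF : ProperFilter (within (`[0, +oo[%classic `\ t) (nbhs t)).
  by move=> h; apply: cvg_lim; [exact: Rhausdorff|exact: h].
split; last exact: within_filter.
rewrite /within /= => /nbhs_ballP[e /= e0 he].
have te : ball t e (t + e / 2).
  rewrite /ball /= opprD addNKr normrN ger0_norm ?divr_ge0 ?(ltW e0) //.
  by rewrite ltr_pdivrMr // ltr_pMr // ltr1n.
have e2 : 0 < e / 2 by rewrite divr_gt0.
apply: (he _ te); split; first by rewrite /= in_itv /= andbT addr_ge0 // ltW.
by move=> /= /eqP; rewrite -subr_eq0 addrC addKr gt_eqF.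
Qed.

Variables (mu U : R -> S -> R).
Hypothesis hmu : evolving_measures mu U.

(** No regularity of [Z] is assumed. Total mass one identifies its inverse with that of the explicit
    sum [Zs], which is differentiable; hence the energy is the derivative of [U] minus its mean,
    from which continuity and zero mean are immediate. *)
Lemma energy_spec : exists dU : R -> S -> R,
  [/\ forall x, {within `[0, +oo[, continuous (dU ^~ x)},
      forall t x, 0 <= t ->
        is_derive_within `[0, +oo[ (mu ^~ x) t (- energy mu t x * mu t x) &
      forall t x, 0 <= t -> energy mu t x = dU t x - pairing (dU t) (mu t)].
Proof.
have hU x : {dU : R -> R | (forall t, 0 <= t -> is_derive_within `[0, +oo[ (U ^~ x) t (dU t)) &
    {within `[0, +oo[, continuous dU}}.
  by apply: cid2; have [dU [h1 h2]] := evolving_C1 hmu x; exists dU.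
pose dU t x := s2val (hU x) t.
have dUE t x : 0 <= t -> is_derive_within `[0, +oo[ (U ^~ x) t (dU t x).
  by rewrite /dU; case: (hU x) => /= g hg _; exact: hg.
have [Z hZ] := evolving_density hmu.
pose Zs t := \sum_y expR (- U t y) * mu 0 y.
have mu0 x : 0 < mu 0 x by exact: (evolving_pos hmu).
have [x0 _] : exists x0 : S, true.
  case: (pickP (mem S)) => [x _|S0]; first by exists x.
  by have := evolving_mass1 hmu (lexx 0); rewrite big_pred0 // => /eqP; rewrite eq_sym oner_eq0.
have Zs0 t : 0 < Zs t.
  rewrite /Zs (bigD1 x0) //= ltr_pwDl ?mulr_gt0 ?expR_gt0 //.
  by apply: sumr_ge0 => y _; rewrite mulr_ge0 ?expR_ge0 // ltW.
have ZE t : 0 <= t -> (Z t)^-1 = (Zs t)^-1.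
  move=> t0; apply: (mulIf (lt0r_neq0 (Zs0 t))); rewrite [RHS]mulVf ?gt_eqF //.
  rewrite -(evolving_mass1 hmu t0) mulr_sumr; apply: eq_bigr => y _.
  by rewrite (hZ t) // mulrA.
have muE t x : 0 <= t -> mu t x = (Zs t)^-1 * expR (- U t x) * mu 0 x.
  by move=> t0; rewrite (hZ t) // ZE.
pose l t x := pairing (dU t) (mu t) - dU t x.
have dln t x : 0 <= t -> is_derive_within `[0, +oo[ (fun u => ln (mu u x)) t (l t x).
  move=> t0.
  have dZ : is_derive_within `[0, +oo[ Zs t (\sum_y - dU t y * expR (- U t y) * mu 0 y).
    apply: is_derive_within_sum => y.
    have := is_derive_withinM (is_derive_within_comp (is_derive_expR _)
      (is_derive_withinN (dUE t y t0))) (is_derive_within_cst `[0, +oo[ (mu 0 y) t).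
    by rewrite mulr0 addr0 (mulrC (expR _)).
  have dlnZ := is_derive_within_comp (is_derive1_ln (Zs0 t)) dZ.
  have h := is_derive_withinB (is_derive_within_cst `[0, +oo[ (ln (mu 0 x)) t)
    (is_derive_withinD dlnZ (dUE t x t0)).
  apply: is_derive_within_eq h; first by rewrite /= in_itv /= t0.
    move=> u; rewrite inE /= in_itv /= andbT => u0; rewrite (muE u) //.
    rewrite lnM ?posrE ?mulr_gt0 ?invr_gt0 ?expR_gt0 // lnM ?posrE ?invr_gt0 ?expR_gt0 //.
    by rewrite expRK lnV ?posrE //=; ring.
  rewrite /l sub0r opprD -mulrN -sumrN mulr_sumr; congr (_ - _).
  by apply: eq_bigr => y _; rewrite (muE t y) //; ring.
have EE t x : 0 <= t -> energy mu t x = - l t x.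
  by move=> t0; rewrite /energy (derive_withinE t0 (dln t x t0)).
exists dU; split.
- by move=> x; rewrite /dU; case: (hU x).
- move=> t x t0.
  have := is_derive_within_comp (is_derive_expR _) (dln t x t0).
  apply: is_derive_within_eq; first by rewrite /= in_itv /= t0.
    by move=> u; rewrite inE /= in_itv /= andbT => u0; rewrite lnK // posrE (evolving_pos hmu).
  by rewrite lnK ?posrE ?(evolving_pos hmu) // EE // opprK mulrC.
- by move=> t x t0; rewrite EE // /l opprB.
Qed.

Lemma evolving_derive t x : 0 <= t ->
  is_derive_within `[0, +oo[ (mu ^~ x) t (- energy mu t x * mu t x).
Proof. by have [dU [_ h _]] := energy_spec; exact: h. Qed.

Lemma evolving_continuous x : {within `[0, +oo[, continuous (mu ^~ x)}.
Proof.
apply: (is_derive_within_continuous (f' := fun t => - energy mu t x * mu t x)) => t.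
by rewrite /= in_itv /= andbT; exact: evolving_derive.
Qed.

Lemma energy_continuous x : {within `[0, +oo[, continuous (energy mu ^~ x)}.
Proof.
have [dU [cU _ hE]] := energy_spec.
have : {within `[0, +oo[, continuous (fun t => dU t x - pairing (dU t) (mu t))}.
  apply: within_continuous_add; first exact: cU.
  apply: within_continuousN; apply: within_continuous_sum => y.
  by apply: within_continuousM; [exact: cU|exact: evolving_continuous].
move=> /within_continuousP h; apply/within_continuousP => t tD.
move/cvg_withinP: (h t tD) => {}h; apply/cvg_withinP => e /h[c c0 hc].
exists c => // u uD ut; move: tD uD (hc u uD ut).
by rewrite /= !in_itv /= !andbT => t0 u0; rewrite !hE.
Qed.

Lemma pairing_energy t : 0 <= t -> pairing (energy mu t) (mu t) = 0.
Proof.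
move=> t0; have [dU [_ _ hE]] := energy_spec.
rewrite (eq_pairing _ (fun x => hE t x t0)) pairingB pairing_cst.
by rewrite (evolving_mass1 hmu) // mulr1 subrr.
Qed.

End energy.

(** * The particle generator on linear and quadratic functionals *)

Section empirical_means.
Context {R : realType} {S : finType} {N : nat}.
Hypothesis N0 : (0 < N)%N.
Local Notation config := {ffun 'I_N -> S}.
Implicit Types (c : config) (f g h : S -> R).

Definition emp c h : R := N%:R^-1 * \sum_(i < N) h (c i).

Let Nneq0 : N%:R != 0 :> R. Proof. by rewrite pnatr_eq0 -lt0n. Qed.

Lemma empD c f g : emp c (fun x => f x + g x) = emp c f + emp c g.
Proof. by rewrite /emp big_split mulrDr. Qed.

Lemma empZ c a f : emp c (fun x => a * f x) = a * emp c f.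
Proof. by rewrite /emp -mulr_sumr mulrCA. Qed.

Lemma empN c f : emp c (fun x => - f x) = - emp c f.
Proof. by rewrite /emp sumrN mulrN. Qed.

Lemma empB c f g : emp c (fun x => f x - g x) = emp c f - emp c g.
Proof. by rewrite empD empN. Qed.

Lemma eq_emp c f g : f =1 g -> emp c f = emp c g.
Proof. by move=> fg; congr (_ * _); apply: eq_bigr => i _; rewrite fg. Qed.

Lemma emp_cst c a : emp c (fun=> a) = a.
Proof. by rewrite /emp sumr_const card_ord -[a *+ N]mulr_natl mulrA mulVf ?mul1r. Qed.

Lemma emp_ge0 c f : (forall x, 0 <= f x) -> 0 <= emp c f.
Proof. by move=> f0; rewrite mulr_ge0 ?invr_ge0 // sumr_ge0. Qed.

Lemma ler_emp c f g : (forall x, f x <= g x) -> emp c f <= emp c g.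
Proof. by move=> fg; rewrite ler_wpM2l ?invr_ge0 // ler_sum. Qed.

Lemma emp_replace c i y h :
  emp (replace c i y) h = emp c h + N%:R^-1 * (h y - h (c i)).
Proof.
rewrite /emp -mulrDr (bigD1 i) //= [X in _ = _ * (X + _)](bigD1 i) //= ffunE eqxx.
rewrite (eq_bigr (fun j => h (c j))); first by congr (_ * _); ring.
by move=> j /negPf ji; rewrite ffunE ji.
Qed.

Lemma sum_symmetrize (a : 'I_N -> 'I_N -> R) :
  \sum_i \sum_j a i j = 2^-1 * \sum_i \sum_j (a i j + a j i).
Proof.
have -> : \sum_i \sum_j (a i j + a j i) = \sum_i \sum_j a i j + \sum_i \sum_j a j i.
  by rewrite -big_split; apply: eq_bigr => i _; rewrite big_split.
by rewrite [X in _ + X]exchange_big /=; field.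
Qed.

Definition emp2 c (a : S -> S -> R) : R :=
  N%:R^-1 ^+ 2 * \sum_(i < N) \sum_(j < N) a (c i) (c j).

Lemma emp2_prod c f g : emp2 c (fun x y => f x * g y) = emp c f * emp c g.
Proof.
rewrite /emp2 /emp mulrACA -expr2 mulr_suml; congr (_ * _).
by apply: eq_bigr => i _; rewrite mulr_sumr.
Qed.

Lemma emp2D c a b : emp2 c (fun x y => a x y + b x y) = emp2 c a + emp2 c b.
Proof.
rewrite /emp2 -mulrDr -big_split; congr (_ * _); apply: eq_bigr => i _.
by rewrite big_split.
Qed.

Lemma emp2Z c k a : emp2 c (fun x y => k * a x y) = k * emp2 c a.
Proof.
rewrite /emp2 mulrCA; congr (_ * _); rewrite mulr_sumr; apply: eq_bigr => i _.
by rewrite mulr_sumr.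
Qed.

Lemma eq_emp2 c a b : (forall x y, a x y = b x y) -> emp2 c a = emp2 c b.
Proof.
by move=> ab; congr (_ * _); apply: eq_bigr => i _; apply: eq_bigr => j _; rewrite ab.
Qed.

Lemma ler_emp2 c a b : (forall x y, a x y <= b x y) -> emp2 c a <= emp2 c b.
Proof.
move=> ab; rewrite ler_wpM2l ?exprn_ge0 ?invr_ge0 //.
by apply: ler_sum => i _; apply: ler_sum => j _; exact: ab.
Qed.

Lemma emp2_symmetrize c a : emp2 c a = emp2 c (fun x y => 2^-1 * (a x y + a y x)).
Proof. by rewrite emp2Z /emp2 sum_symmetrize mulrCA. Qed.

Variables (mu : R -> S -> R) (lam : R -> R) (L : R -> S -> S -> R).
Hypothesis hL : reversible_generators mu L.
Local Notation H := (energy mu).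

Definition carre_du_champ t h : S -> R := fun x => \sum_y L t x y * (h y - h x) ^+ 2.

(** The carre du champ of the selection jumps after symmetrisation: the positive parts of
    [H x - H y] and [H y - H x] add up to the absolute value, whence the [2^-1]. *)
Definition selection_gradient t h : S -> S -> R :=
  fun x y => 2^-1 * (`|H t x - H t y| * (h y - h x) ^+ 2).

(** Exchanging the two particles turns the positive part into [(H x - H y) (h y - h x) / 2], which
    splits into products of means. On linear functionals the interaction is thus killing at rate
    [H], compensated by the mean energy. *)
Lemma generator_emp t h c : 0 <= t ->
  particle_generator mu lam L t (fun c => emp c h) c =
  lam t * emp c (apply_kernel (L t) h) - emp c (fun x => H t x * h x) +
  emp c (H t) * emp c h.
Proof.
move=> t0; have [_ L0] := rev_generator hL t0.
rewrite /particle_generator -addrA; congr (_ * _ + _).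
  have compE i : component_generator L t i (fun c => emp c h) c =
      N%:R^-1 * apply_kernel (L t) h (c i).
    rewrite /component_generator /apply_kernel mulr_sumr.
    have Z : \sum_y L t (c i) y * (emp c h - N%:R^-1 * h (c i)) = 0.
      by rewrite -mulr_suml L0 mul0r.
    rewrite -[RHS]addr0 -[X in _ = _ + X]Z -big_split /=.
    by apply: eq_bigr => y _; rewrite emp_replace; ring.
  by rewrite (eq_bigr _ (fun i _ => compE i)) -mulr_sumr.
have -> : - emp c (fun x => H t x * h x) + emp c (H t) * emp c h =
    emp2 c (fun x y => -1 * (H t x * h x * 1) + H t x * h y).
  by rewrite emp2D emp2Z (emp2_prod c (fun x => H t x * h x)) emp2_prod emp_cst; ring.
rewrite [RHS]emp2_symmetrize.
transitivity (emp2 c (fun x y => Num.max (H t x - H t y) 0 * (h y - h x))).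
  rewrite /emp2 expr2 -mulrA; congr (_ * _); rewrite mulr_sumr; apply: eq_bigr => i _.
  rewrite mulr_sumr; apply: eq_bigr => j _.
  by rewrite emp_replace; ring.
rewrite emp2_symmetrize; apply: eq_emp2 => x y; congr (_ * _).
have -> : Num.max (H t x - H t y) 0 = H t x - H t y + Num.max (H t y - H t x) 0.
  by case: (leP (H t x - H t y) 0) => h1; case: (leP (H t y - H t x) 0) => h2; lra.
by ring.
Qed.

(** A jump moves the empirical mean by [1 / N] times an increment of [h]. Squaring leaves an extra
    [1 / N ^ 2] times the squared increment, and the sum over particles brings this to order
    [1 / N]. *)
Lemma generator_emp_sqr t h c : 0 <= t ->
  particle_generator mu lam L t (fun c => emp c h ^+ 2) c =
  2 * emp c h * particle_generator mu lam L t (fun c => emp c h) c +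
  N%:R^-1 * (lam t * emp c (carre_du_champ t h) + emp2 c (selection_gradient t h)).
Proof.
move=> t0; have [_ L0] := rev_generator hL t0.
have comp2 i : component_generator L t i (fun c => emp c h ^+ 2) c =
    2 * emp c h * component_generator L t i (fun c => emp c h) c +
    N%:R^-1 ^+ 2 * carre_du_champ t h (c i).
  rewrite /component_generator /carre_du_champ !mulr_sumr -big_split /=.
  have Z : \sum_y L t (c i) y * emp c h ^+ 2 = 0 by rewrite -mulr_suml L0 mul0r.
  rewrite -[LHS]addr0 -[X in _ + X = _]Z -big_split /=.
  by apply: eq_bigr => y _; rewrite emp_replace; ring.
have sel2 i j : emp (replace c i (c j)) h ^+ 2 - emp c h ^+ 2 =
    2 * emp c h * (emp (replace c i (c j)) h - emp c h) +
    N%:R^-1 ^+ 2 * (h (c j) - h (c i)) ^+ 2.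
  by rewrite emp_replace; ring.
rewrite /particle_generator (eq_bigr _ (fun i _ => comp2 i)) big_split /= -!mulr_sumr.
under eq_bigr do under eq_bigr do rewrite sel2 mulrDr.
have -> : emp2 c (selection_gradient t h) =
    emp2 c (fun x y => Num.max (H t x - H t y) 0 * (h y - h x) ^+ 2).
  rewrite [RHS]emp2_symmetrize; apply: eq_emp2 => x y; rewrite /selection_gradient; congr (_ * _).
  rewrite (_ : (h x - h y) ^+ 2 = (h y - h x) ^+ 2); last by ring.
  rewrite -mulrDl -(opprB (H t x)); congr (_ * _).
  by rewrite !maxr_absE !subr0 normrN; lra.
rewrite /emp2 [X in _ = _ + _ * (lam t * X + _)]/emp.
set S1 := \sum_i component_generator _ _ _ _ _; set S2 := \sum_i carre_du_champ _ _ _.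
have -> : \sum_(i < N) \sum_(j < N) (Num.max (H t (c i) - H t (c j)) 0 *
      (2 * emp c h * (emp (replace c i (c j)) h - emp c h)) +
      Num.max (H t (c i) - H t (c j)) 0 * (N%:R^-1 ^+ 2 * (h (c j) - h (c i)) ^+ 2)) =
   2 * emp c h * (\sum_(i < N) \sum_(j < N) Num.max (H t (c i) - H t (c j)) 0 *
      (emp (replace c i (c j)) h - emp c h)) +
   N%:R^-1 ^+ 2 * (\sum_(i < N) \sum_(j < N) Num.max (H t (c i) - H t (c j)) 0 *
      (h (c j) - h (c i)) ^+ 2).
  rewrite !mulr_sumr -big_split; apply: eq_bigr => i _ /=.
  rewrite !mulr_sumr -big_split; apply: eq_bigr => j _ /=.
  by ring.
by ring.
Qed.

End empirical_means.

(** * Moments of empirical means under the initial law *)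

Section product_moments.
Context {R : realType} {S : finType} {N : nat}.
Hypothesis N0 : (0 < N)%N.
Variable m : S -> R.
Hypothesis m1 : \sum_x m x = 1.
Implicit Types (g h : S -> R).

Lemma product_measure_prod (G : 'I_N -> S -> R) :
  \sum_(c : {ffun 'I_N -> S}) product_measure m c * \prod_i G i (c i) =
  \prod_i pairing (G i) m.
Proof.
rewrite /pairing bigA_distr_bigA; apply: eq_bigr => c _.
by rewrite /product_measure -big_split; apply: eq_bigr => i _; rewrite mulrC.
Qed.

Lemma product_measure_coord i h :
  \sum_(c : {ffun 'I_N -> S}) product_measure m c * h (c i) = pairing h m.
Proof.
have := product_measure_prod (fun j => if j == i then h else fun=> 1).
rewrite [RHS](bigD1 i) //= eqxx [X in _ * X]big1 => [|j /negPf ->]; last first.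
  by rewrite pairing_cst m1 mulr1.
rewrite mulr1 => <-; apply: eq_bigr => c _; congr (_ * _).
by rewrite (bigD1 i) //= eqxx big1 ?mulr1 // => j /negPf ->.
Qed.

Lemma product_measure_coord2 i j g h :
  \sum_(c : {ffun 'I_N -> S}) product_measure m c * (g (c i) * h (c j)) =
  pairing g m * pairing h m +
  (i == j)%:R * (pairing (fun x => g x * h x) m - pairing g m * pairing h m).
Proof.
have [->|ij] := eqVneq i j.
  by rewrite mul1r addrC subrK (product_measure_coord j (fun x => g x * h x)).
rewrite mul0r addr0.
have := product_measure_prod (fun k => if k == i then g else if k == j then h else fun=> 1).
have ji : j != i by rewrite eq_sym.
rewrite [RHS](bigD1 i) //= eqxx (bigD1 j) //= (negPf ji) eqxx [X in _ * (_ * X)]big1; last first.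
  by move=> k /andP[/negPf -> /negPf ->]; rewrite pairing_cst m1 mulr1.
rewrite mulr1 => <-; apply: eq_bigr => c _; congr (_ * _).
rewrite (bigD1 i) //= eqxx (bigD1 j) //= (negPf ji) eqxx big1 ?mulr1 //.
by move=> k /andP[/negPf -> /negPf ->].
Qed.

Lemma product_measure_emp h :
  \sum_(c : {ffun 'I_N -> S}) product_measure m c * emp c h = pairing h m.
Proof.
rewrite /emp; under eq_bigr do rewrite mulrCA mulr_sumr.
rewrite -mulr_sumr exchange_big /=; under eq_bigr do rewrite product_measure_coord.
by rewrite sumr_const card_ord -[X in _ * X]mulr_natl mulKf // pnatr_eq0 -lt0n.
Qed.

(** Distinct coordinates are independent, so only the [N] diagonal pairs among [N ^ 2] contribute a
    covariance. *)
Lemma product_measure_emp2 g h :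
  \sum_(c : {ffun 'I_N -> S}) product_measure m c * (emp c g * emp c h) =
  pairing g m * pairing h m +
  N%:R^-1 * (pairing (fun x => g x * h x) m - pairing g m * pairing h m).
Proof.
have Nneq0 : N%:R != 0 :> R by rewrite pnatr_eq0 -lt0n.
under eq_bigr do rewrite -emp2_prod /emp2 mulrCA.
rewrite -mulr_sumr.
have -> : \sum_(c : {ffun 'I_N -> S}) product_measure m c * (\sum_i \sum_j g (c i) * h (c j)) =
    \sum_(i < N) \sum_(j < N) (pairing g m * pairing h m +
      (i == j)%:R * (pairing (fun x => g x * h x) m - pairing g m * pairing h m)).
  under eq_bigr do rewrite mulr_sumr; rewrite exchange_big; apply: eq_bigr => i _ /=.
  under eq_bigr do rewrite mulr_sumr; rewrite exchange_big; apply: eq_bigr => j _ /=.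
  exact: product_measure_coord2.
set a := pairing g m * _; set b := _ - a.
have -> : \sum_(i < N) \sum_(j < N) (a + (i == j)%:R * b) = \sum_(i < N) (a *+ N + b).
  apply: eq_bigr => i _; rewrite big_split /= sumr_const card_ord; congr (_ + _).
  rewrite (bigD1 i) //= eqxx mul1r big1 ?addr0 // => j /negPf ji.
  by rewrite eq_sym ji mul0r.
rewrite sumr_const card_ord -mulr_natl -[a *+ N]mulr_natl; field.
exact: Nneq0.
Qed.

End product_moments.

(** * Weighted means of functions of the configuration *)

Section particle_system.
Context {R : realType} {S : finType}.
Variables (mu U : R -> S -> R) (lam : R -> R) (L : R -> S -> S -> R).
Hypothesis hmu : evolving_measures mu U.
Hypothesis hL : reversible_generators mu L.
Hypothesis hlam : move_rates lam.
Variables (N : nat) (d : measure_display) (T : measurableType d).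
Hypothesis N0 : (0 < N)%N.
Variables (P : probability T R) (X : R -> T -> {ffun 'I_N -> S}).
Hypothesis hX : is_particle_system mu lam L P X.
Local Notation config := {ffun 'I_N -> S}.
Local Notation H := (energy mu).
Implicit Types (c : config) (f g h : S -> R) (phi psi : config -> R).

Definition mean_energy (t : R) c : R := emp c (H t).

Definition weighted_mean (k t : R) phi : R := tilted P X mean_energy k t phi.
Local Notation F := weighted_mean.

Lemma emp_continuous (D : set R) (h : R -> S -> R) c :
  (forall x, {within D, continuous (h ^~ x)}) -> {within D, continuous (fun t => emp c (h t))}.
Proof.
move=> ch; apply: within_continuousM; first exact: within_continuous_cst.
by apply: within_continuous_sum => i; exact: ch.
Qed.

Lemma emp_derive (D : set R) (h : R -> S -> R) (h' : S -> R) t c :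
  (forall x, is_derive_within D (h ^~ x) t (h' x)) ->
  is_derive_within D (fun t => emp c (h t)) t (emp c h').
Proof.
by move=> dh; apply: is_derive_withinZ; apply: is_derive_within_sum => i; exact: dh.
Qed.

Lemma mean_energy_continuous c : {within `[0, +oo[, continuous (mean_energy ^~ c)}.
Proof. by apply: emp_continuous => x; exact: (energy_continuous hmu). Qed.

Lemma generator_continuous phi c :
  {within `[0, +oo[, continuous (fun t => particle_generator mu lam L t phi c)}.
Proof.
have [_ clam] := hlam.
apply: within_continuous_add.
  apply: within_continuousM => //; apply: within_continuous_sum => i.
  apply: within_continuous_sum => y; apply: within_continuousM.
    exact: (rev_continuous hL).
  exact: within_continuous_cst.
apply: within_continuousM; first exact: within_continuous_cst.
apply: within_continuous_sum => i; apply: within_continuous_sum => j.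
apply: within_continuousM; last exact: within_continuous_cst.
apply: within_continuous_max; last exact: within_continuous_cst.
apply: within_continuous_add; first exact: (energy_continuous hmu).
by apply: within_continuousN; exact: (energy_continuous hmu).
Qed.

Let tm := tilted_mass P X mean_energy.

Lemma weighted_meanE (k t : R) phi : 0 <= t -> F k t phi = \sum_c tm k t c * phi c.
Proof. by move=> t0; apply: (tiltedE hX) => // c; exact: mean_energy_continuous. Qed.

Lemma weighted_meanD (k t : R) phi psi : 0 <= t ->
  F k t (fun c => phi c + psi c) = F k t phi + F k t psi.
Proof.
by move=> t0; rewrite !weighted_meanE // -big_split; apply: eq_bigr => c _; rewrite mulrDr.
Qed.

Lemma weighted_meanZ (k t : R) a phi : 0 <= t ->
  F k t (fun c => a * phi c) = a * F k t phi.
Proof.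
by move=> t0; rewrite !weighted_meanE // mulr_sumr; apply: eq_bigr => c _; rewrite mulrCA.
Qed.

Lemma eq_weighted_mean (k t : R) phi psi : phi =1 psi -> F k t phi = F k t psi.
Proof. by move=> e; apply: eq_Rintegral => w _; rewrite e. Qed.

Lemma ler_weighted_mean (k t : R) phi psi : 0 <= t -> (forall c, phi c <= psi c) ->
  F k t phi <= F k t psi.
Proof.
move=> t0 h; rewrite !weighted_meanE //; apply: ler_sum => c _.
by rewrite ler_wpM2l // tilted_mass_ge0.
Qed.

Lemma weighted_mean_ge0 (k t : R) phi : 0 <= t -> (forall c, 0 <= phi c) -> 0 <= F k t phi.
Proof.
move=> t0 h; rewrite weighted_meanE //; apply: sumr_ge0 => c _.
by rewrite mulr_ge0 // tilted_mass_ge0.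
Qed.

Lemma weighted_mean_continuous (k b : R) (phi : R -> config -> R) :
  (forall c, {within `[0, b], continuous (phi ^~ c)}) ->
  {within `[0, b], continuous (fun t => F k t (phi t))}.
Proof.
move=> cphi; have : {within `[0, b], continuous (fun t => \sum_c tm k t c * phi t c)}.
  apply: within_continuous_sum => c; apply: within_continuousM => //.
  apply: (tilted_continuous hX) => *; [exact: mean_energy_continuous|exact: generator_continuous].
move=> /within_continuousP h; apply/within_continuousP => t tD.
move/cvg_withinP: (h t tD) => {}h; apply/cvg_withinP => e /h[r r0 hr].
exists r => // u uD ut; move: tD uD (hr u uD ut).
by rewrite /= !in_itv /= => /andP[t0 _] /andP[u0 _]; rewrite !weighted_meanE.
Qed.

Lemma weighted_mean_derive (k b t : R) (phi : R -> config -> R) (phi' : config -> R) :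
  0 <= t <= b -> (forall c, is_derive_within `[0, b] (phi ^~ c) t (phi' c)) ->
  is_derive_within `[0, b] (fun s => F k s (phi s)) t
    (F k t (fun c => particle_generator mu lam L t (phi t) c -
       k * mean_energy t c * phi t c + phi' c)).
Proof.
move=> tb dphi; have /andP[t0 _] := tb.
have dF psi := tilted_derive (k := k) (phi := psi) hX mean_energy_continuous generator_continuous tb.
(* [phi s] is split into [phi t] and the difference [phi s - phi t], expanded over configurations;
   at [s = t] the derivatives of the masses multiply zero. *)
have h := is_derive_withinD (dF (phi t)) (is_derive_within_sum (fun c =>
  is_derive_withinM (dF (fun x => (x == c)%:R))
   (is_derive_withinB (dphi c) (is_derive_within_cst `[0, b] (phi t c) t)))).
apply: is_derive_within_eq h; first by rewrite /= in_itv.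
  move=> s; rewrite inE /= in_itv /= => /andP[s0 _].
  rewrite -[tilted _ _ _ _ _ _]/(F k s (phi t)) !weighted_meanE // -big_split.
  by apply: eq_bigr => c _ /=; rewrite /tm /tilted_mass /cst; ring.
rewrite -[tilted _ _ _ _ _ _]/(F k t _) weighted_meanD //; congr (_ + _).
rewrite weighted_meanE //; apply: eq_bigr => c _ /=.
by rewrite subrr mulr0 add0r subr0.
Qed.

Lemma weighted_mean0 (k : R) phi :
  F k 0 phi = \sum_c product_measure (mu 0) c * phi c.
Proof. exact: (tilted0 hX mean_energy_continuous). Qed.

Lemma pairing_empirical h t w : pairing h (empirical X t w) = emp (X t w) h.
Proof.
rewrite /pairing /empirical /emp; under eq_bigr do rewrite mulrCA mulr_sumr.
rewrite -mulr_sumr exchange_big; congr (_ * _); apply: eq_bigr => i _ /=.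
rewrite (bigD1 (X t w i)) //= eqxx mulr1 big1 ?addr0 // => x /negPf xX.
by rewrite eq_sym xX mulr0.
Qed.

Lemma pairing_weighted_empirical h t w :
  pairing h (weighted_empirical mu X t w) = discount X mean_energy 1 t w * emp (X t w) h.
Proof.
rewrite -pairing_empirical /pairing mulr_sumr; apply: eq_bigr => x _.
rewrite /weighted_empirical mulrCA /discount mul1r; congr (expR (- _) * _).
by apply: eq_Rintegral => s _; rewrite pairing_empirical.
Qed.

Lemma mean_square_errorE (t : R) f : 0 <= t ->
  mean_square_error mu P X t f =
  (F 2 t (fun c => emp c f ^+ 2) - 2 * pairing f (mu t) * F 1 t (fun c => emp c f) +
   pairing f (mu t) ^+ 2)%:E.
Proof.
move=> t0; rewrite /mean_square_error unlock; set a := pairing f (mu t).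
have hb k phi : P.-integrable setT (EFin \o (fun w => discount X mean_energy k t w * phi (X t w))).
  have [B B0 hB] := finite_function_bounded phi.
  have [D D0 hD] := discount_bounded hX mean_energy_continuous k t0.
  apply: (@bounded_integrable _ _ _ P _ (D * B)) => [|w].
    apply: measurable_funM; first exact: (measurable_discount hX mean_energy_continuous).
    exact: (measurable_state hX).
  by rewrite normrM discount_norm ler_pM ?expR_ge0 // hD // t0 lexx.
pose z2 w := discount X mean_energy 2 t w * emp (X t w) f ^+ 2.
pose z1 w := discount X mean_energy 1 t w * emp (X t w) f.
have i2 : P.-integrable setT (EFin \o z2) := hb 2 (fun c => emp c f ^+ 2).
have i1 : P.-integrable setT (EFin \o z1) := hb 1 (fun c => emp c f).
have ic : P.-integrable setT (EFin \o cst (a ^+ 2)) by exact: finite_measure_integrable_cst.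
have i1' : P.-integrable setT (EFin \o (fun w => (- (2 * a)) * z1 w)).
  have := integrableZl measurableT (- (2 * a)) i1.
  by apply: eq_integrable => // w _; rewrite /= EFinM.
have i21 : P.-integrable setT (EFin \o (fun w => z2 w + (- (2 * a)) * z1 w)).
  have := integrableD measurableT i2 i1'.
  by apply: eq_integrable => // w _; rewrite /= EFinD.
have i21c : P.-integrable setT (EFin \o (fun w => z2 w + (- (2 * a)) * z1 w + cst (a ^+ 2) w)).
  have := integrableD measurableT i21 ic.
  by apply: eq_integrable => // w _; rewrite /= EFinD.
transitivity (\int[P]_w (z2 w + (- (2 * a)) * z1 w + cst (a ^+ 2) w)%:E)%E.
  apply: eq_integral => w _; congr EFin; rewrite pairing_weighted_empirical -/a.
  rewrite real_normK ?num_real // /z2 /z1 /=.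
  have -> : discount X mean_energy 2 t w = discount X mean_energy 1 t w ^+ 2.
    by rewrite /discount -expRM_natl; congr expR; rewrite mul1r mulrN.
  by ring.
rewrite -[LHS]fineK; last exact: integrable_fin_num i21c.
rewrite -[fine _]/(\int[P]_w (z2 w + (- (2 * a)) * z1 w + cst (a ^+ 2) w)).
rewrite !RintegralD // RintegralZl // Rintegral_cst //= (@probability_setT _ _ _ P) /= mulr1.
by congr EFin; rewrite mulNr.
Qed.

End particle_system.

(** * Feynman-Kac operators *)

Section growth.
Context {R : realType}.
Implicit Types (y : R -> R) (k a b s : R).

Lemma is_derive_within_expR_mul (D : set R) y k s (y' : R) :
  is_derive_within D y s y' ->
  is_derive_within D (fun u => y u * expR (k * u)) s ((y' + k * y s) * expR (k * s)).
Proof.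
move=> dy; have dk := is_derive_withinZ (c := k) (is_derive_within_id D s).
have := is_derive_withinM dy (is_derive_within_comp (is_derive_expR _) dk).
by congr (is_derive_within _ _ _ _); ring.
Qed.

(** From [expR x * (1 - x) <= 1], with [17 / 16 = 1 / (1 - 1 / 17)]. *)
Lemma expR_le_17_16 (x : R) : x <= 17^-1 -> expR x <= 17 / 16.
Proof.
move=> x17; have := expR_ge1Dx (- x); rewrite expRN => h.
have e0 := expR_gt0 x.
have h1 : expR x * (1 + - x) <= 1.
  by rewrite -ler_pdivlMl // mulr1.
have : expR x * (16 / 17) <= 1.
  by apply: le_trans h1; rewrite ler_wpM2l ?(ltW e0) //; lra.
by lra.
Qed.

(* Gronwall over a time span during which [expR (k * _)] grows by at most 17/16. *)
Lemma backward_growth y y' k a b : a <= b -> k * (b - a) <= 17^-1 ->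
  (forall s, a <= s <= b -> is_derive_within `[a, b] y s (y' s)) ->
  (forall s, a <= s <= b -> - k * y s <= y' s) -> 0 <= y b ->
  y a <= 17 / 16 * y b.
Proof.
move=> ab kab dy hy yb0.
have : y a * expR (k * a) <= y b * expR (k * b).
  apply: (derive_ge0_nondecreasing ab (fun s sab => is_derive_within_expR_mul (k := k) (dy s sab))).
  move=> s sab; rewrite mulr_ge0 ?expR_ge0 //.
  by have := hy s sab; rewrite mulNr; lra.
have -> : k * b = k * (b - a) + k * a by ring.
rewrite expRD mulrA ler_pM2r ?expR_gt0 // => /le_trans; apply.
by rewrite mulrC ler_wpM2r // expR_le_17_16.
Qed.

Lemma forward_growth y y' k a b : a <= b -> k * (b - a) <= 17^-1 ->
  (forall s, a <= s <= b -> is_derive_within `[a, b] y s (y' s)) ->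
  (forall s, a <= s <= b -> y' s <= k * y s) -> 0 <= y a ->
  y b <= 17 / 16 * y a.
Proof.
move=> ab kab dy hy ya0.
have : - (y a * expR (- k * a)) <= - (y b * expR (- k * b)).
  apply: (derive_ge0_nondecreasing ab
    (fun s sab => is_derive_withinN (is_derive_within_expR_mul (k := - k) (dy s sab)))).
  move=> s sab; rewrite -mulNr mulr_ge0 ?expR_ge0 //.
  by have := hy s sab; rewrite mulNr; lra.
rewrite lerN2; have -> : - k * a = k * (b - a) + - k * b by ring.
rewrite expRD mulrA ler_pM2r ?expR_gt0 // => /le_trans; apply.
by rewrite mulrC ler_wpM2r // expR_le_17_16.
Qed.

Lemma backward_zero y y' k a b : a <= b ->
  (forall s, a <= s <= b -> is_derive_within `[a, b] y s (y' s)) ->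
  (forall s, a <= s <= b -> - k * y s <= y' s) -> y b = 0 -> y a <= 0.
Proof.
move=> ab dy hy yb0.
have : y a * expR (k * a) <= y b * expR (k * b).
  apply: (derive_ge0_nondecreasing ab (fun s sab => is_derive_within_expR_mul (k := k) (dy s sab))).
  move=> s sab; rewrite mulr_ge0 ?expR_ge0 //.
  by have := hy s sab; rewrite mulNr; lra.
by rewrite yb0 mul0r pmulr_lle0 // expR_gt0.
Qed.

(* The negative part squared is differentiable, unlike the negative part. *)
Lemma is_derive_within_negpart_sqr (x : R) :
  is_derive_within setT (fun u : R => Num.max (- u) 0 ^+ 2) x (- 2 * Num.max (- x) 0).
Proof.
apply/is_derive_withinP => e e0; exists e => // u _ ue.
apply: (@le_trans _ _ (`|u - x| * `|u - x|)); last by rewrite ler_wpM2r // ltW.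
rewrite -normrM ler_norml -expr2 (ger0_norm (sqr_ge0 _)).
have sq := sqr_ge0 (u - x); have squ := sqr_ge0 u; have sqx := sqr_ge0 x.
rewrite !maxEle; case: (leP (- u) 0) => hu; case: (leP (- x) 0) => hx;
  by apply/andP; split; nra.
Qed.

End growth.

Section horizon.
Context {R : realType} {S : finType}.
Variables (mu U : R -> S -> R) (lam : R -> R) (L : R -> S -> S -> R).
Variable Q : R -> R -> (S -> R) -> S -> R.
Hypothesis hmu : evolving_measures mu U.
Hypothesis hL : reversible_generators mu L.
Hypothesis hlam : move_rates lam.
Hypothesis hQ : is_feynman_kac mu lam L Q.
Local Notation H := (energy mu).
Implicit Types (f g h : S -> R) (s t b : R).

Let mu_ge0 s x : 0 <= s -> 0 <= mu s x.
Proof. by move=> s0; apply/ltW; exact: (evolving_pos hmu). Qed.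

Lemma feynman_kac_derive t f s x : 0 <= s <= t ->
  is_derive_within `[0, t] (fun u => Q u t f x) s
    (H s x * Q s t f x - lam s * apply_kernel (L s) (Q s t f) x).
Proof.
move=> /andP[s0 st]; have [_ h] := hQ f (le_trans s0 st).
by rewrite -opprB; apply: h; rewrite s0.
Qed.

Lemma feynman_kac_id t f : 0 <= t -> Q t t f = f.
Proof. by move=> t0; apply/funext => x; have [-> _] := hQ f t0. Qed.

Lemma feynman_kac_continuous t f x : {within `[0, t], continuous (fun s => Q s t f x)}.
Proof.
apply: (is_derive_within_continuous
  (f' := fun s => H s x * Q s t f x - lam s * apply_kernel (L s) (Q s t f) x)) => s.
by rewrite /= in_itv /=; exact: feynman_kac_derive.
Qed.

Lemma pairing_generator s g : 0 <= s -> pairing (apply_kernel (L s) g) (mu s) = 0.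
Proof.
move=> s0; have [_ L0] := rev_generator hL s0.
rewrite /pairing /apply_kernel; under eq_bigr do rewrite mulr_suml.
rewrite exchange_big big1 // => y _ /=.
transitivity (\sum_x (mu s y * g y) * L s y x).
  apply: eq_bigr => x _; have := rev_balance hL x y s0; rewrite mulrAC => e.
  by rewrite (mulrC _ (mu s x)) e; ring.
by rewrite -mulr_sumr L0 mulr0.
Qed.

Lemma generator_sqr s g x : 0 <= s ->
  apply_kernel (L s) (fun y => g y ^+ 2) x =
  2 * g x * apply_kernel (L s) g x + carre_du_champ L s g x.
Proof.
move=> s0; have [_ L0] := rev_generator hL s0.
have Z : \sum_y L s x y * g x ^+ 2 = 0 by rewrite -mulr_suml L0 mul0r.
rewrite /apply_kernel /carre_du_champ -[LHS]addr0 -[X in _ + X = _]Z -big_split /= mulr_sumr -big_split.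
by apply: eq_bigr => y _ /=; ring.
Qed.

Lemma carre_du_champ_ge0 s g x : 0 <= s -> 0 <= carre_du_champ L s g x.
Proof.
move=> s0; have [Lp _] := rev_generator hL s0; apply: sumr_ge0 => y _.
have [->|yx] := eqVneq y x; first by rewrite subrr expr0n mulr0.
by rewrite mulr_ge0 ?sqr_ge0 // Lp // eq_sym.
Qed.

Lemma pairing_derive b s (h : R -> S -> R) h' : 0 <= s <= b ->
  (forall x, is_derive_within `[0, b] (h ^~ x) s (h' x)) ->
  is_derive_within `[0, b] (fun u => pairing (h u) (mu u)) s
    (pairing (fun x => h' x - H s x * h s x) (mu s)).
Proof.
move=> /andP[s0 sb] dh; have sub : `[0, b]%classic `<=` `[0, +oo[%classic by exact: subset_itvl.
have := is_derive_within_sum (fun x => is_derive_withinM (dh x)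
  (is_derive_withinS sub (@evolving_derive _ _ mu U hmu s x s0))).
apply: is_derive_within_eq => //; first by rewrite /= in_itv /= s0.
by apply: eq_bigr => x _; ring.
Qed.

(** The energy enters the derivatives of [Q s t f] and of [mu s] with opposite signs, and detailed
    balance makes [mu s] invariant under the generator. *)
Lemma feynman_kac_pairing_derive t f s : 0 <= s <= t ->
  is_derive_within `[0, t] (fun u => pairing (Q u t f) (mu u)) s 0.
Proof.
move=> st; have /andP[s0 _] := st.
have := pairing_derive st (fun x => @feynman_kac_derive t f s x st).
rewrite (_ : pairing _ _ = 0) //.
rewrite (@eq_pairing _ _ _ _ (fun x => - (lam s * apply_kernel (L s) (Q s t f) x))).
  by rewrite pairingN pairingZ pairing_generator // mulr0 oppr0.
by move=> x; ring.
Qed.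

Lemma feynman_kac_pairing t f s : 0 <= s <= t ->
  pairing f (mu t) = pairing (Q s t f) (mu s).
Proof.
move=> /andP[s0 st]; have t0 := le_trans s0 st.
rewrite -{1}(feynman_kac_id f t0); apply: (@derive_eq0_constant _ s t (fun u => pairing (Q u t f) (mu u))) => //.
move=> u /andP[su ut]; have sub : `[s, t]%classic `<=` `[0, t]%classic.
  by apply: subset_itvr; rewrite bnd_simp.
by apply: is_derive_withinS sub _; apply: feynman_kac_pairing_derive; rewrite (le_trans s0 su).
Qed.

Lemma feynman_kac_sqr_derive t f s x : 0 <= s <= t ->
  is_derive_within `[0, t] (fun u => Q u t f x ^+ 2) s
    (2 * (H s x * Q s t f x ^+ 2) - 2 * lam s * (Q s t f x * apply_kernel (L s) (Q s t f) x)).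
Proof.
move=> st; have h := @feynman_kac_derive t f s x st.
have := is_derive_withinM h h; under [X in is_derive_within _ X]eq_fun do rewrite -expr2.
by congr (is_derive_within _ _ _ _); ring.
Qed.

(** The square brings the energy in twice and [mu s] removes it once. Invariance applied to the
    square turns the generator term into the carre du champ. *)
Lemma feynman_kac_sqr_pairing_derive t f s : 0 <= s <= t ->
  is_derive_within `[0, t] (fun u => pairing (fun x => Q u t f x ^+ 2) (mu u)) s
    (pairing (fun x => H s x * Q s t f x ^+ 2) (mu s) +
     lam s * pairing (carre_du_champ L s (Q s t f)) (mu s)).
Proof.
move=> st; have /andP[s0 _] := st.
have := pairing_derive (h := fun u x => Q u t f x ^+ 2) st (fun x => @feynman_kac_sqr_derive t f s x st).
congr (is_derive_within _ _ _ _).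
rewrite -pairingZ -pairingD.
rewrite -[LHS]addr0 -[X in _ + X](mulr0 (lam s)) -[X in _ + _ * X](pairing_generator (fun x => Q s t f x ^+ 2) s0).
rewrite -pairingZ -pairingD; apply: eq_pairing => x.
by rewrite generator_sqr //; ring.
Qed.

(** An energy method: the mean square [psi] of the negative part [n] vanishes at time [t], and its
    derivative is at least [- K * psi] because the generator contributes a nonnegative Dirichlet
    form. Backward Gronwall then gives [psi s <= 0]. *)
Lemma feynman_kac_ge0 t f : 0 <= t -> (forall x, 0 <= f x) ->
  forall s x, 0 <= s <= t -> 0 <= Q s t f x.
Proof.
move=> t0 f0 s x st; have /andP[s0 s_t] := st.
have [K K0 hK] := weight_bounded (energy_continuous hmu) t.
pose n u x := Num.max (- Q u t f x) 0.
pose psi u := pairing (fun x => n u x ^+ 2) (mu u).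
have n0 u z : 0 <= n u z by rewrite le_max lexx orbT.
have dpsi u : 0 <= u <= t -> is_derive_within `[0, t] psi u
    (pairing (fun x => H u x * n u x ^+ 2 +
       2 * lam u * (n u x * apply_kernel (L u) (Q u t f) x)) (mu u)).
  move=> ut; have := pairing_derive (h := fun v z => n v z ^+ 2) ut
    (fun z => is_derive_within_compT (@is_derive_within_negpart_sqr R _) (@feynman_kac_derive t f u z ut)).
  congr (is_derive_within _ _ _ _); apply: eq_pairing => z; rewrite -/(n u z).
  have nq : n u z * Q u t f z = - n u z ^+ 2.
    by rewrite /n maxEle; case: leP => _; ring.
  rewrite (_ : - 2 * n u z * _ = - 2 * (H u z * (n u z * Q u t f z)) +
    2 * lam u * (n u z * apply_kernel (L u) (Q u t f) z)); last by ring.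
  by rewrite nq; ring.
have psi0 : psi s <= 0.
  have sub : `[s, t]%classic `<=` `[0, t]%classic by apply: subset_itvr; rewrite bnd_simp.
  have su0 u : s <= u <= t -> 0 <= u <= t by move=> /andP[su ->]; rewrite (le_trans s0).
  apply: (backward_zero s_t (fun u ut => is_derive_withinS sub (dpsi u (su0 u ut))) (k := K)).
    move=> u /su0 ut; have /andP[u0 _] := ut.
    have [Lp L0] := rev_generator hL u0.
    rewrite pairingD pairingZ /psi -[leLHS]addr0; apply: lerD.
      rewrite -pairingZ; apply: ler_pairing => z; first exact: mu_ge0.
      rewrite ler_wpM2r ?sqr_ge0 //.
      by have := hK u z ut; rewrite ler_norml => /andP[].
    rewrite mulr_ge0 ?mulr_ge0 ?(hlam.1 u u0) //.
    (* [Q] may be replaced by [- n] from below: off the diagonal the rates are nonnegative and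
       [Q >= - n], while on the diagonal [n * Q = - n ^ 2]. *)
    apply: (@le_trans _ _ (pairing (fun z => - (n u z * apply_kernel (L u) (n u) z)) (mu u))).
      have e : pairing (fun z => - (n u z * apply_kernel (L u) (n u) z)) (mu u) =
          2^-1 * pairing (carre_du_champ L u (n u)) (mu u).
        rewrite -pairingZ -[RHS]addr0 -(mulr0 (- 2^-1)) -[X in _ = _ + _ * X](pairing_generator (fun z => n u z ^+ 2) u0).
        rewrite -pairingZ -pairingD; apply: eq_pairing => z; rewrite generator_sqr //.
        by field.
      rewrite e mulr_ge0 ?invr_ge0 //; apply: pairing_ge0 => z; first exact: mu_ge0.
      exact: carre_du_champ_ge0.
    apply: ler_pairing => z; first exact: mu_ge0.
    rewrite /apply_kernel -mulrN -sumrN !mulr_sumr; apply: ler_sum => y _.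
    have [<-|zy] := eqVneq z y.
      rewrite (_ : n u z * (L u z z * Q u t f z) = L u z z * (n u z * Q u t f z)); last by ring.
      have -> : n u z * Q u t f z = - n u z ^+ 2 by rewrite /n maxEle; case: leP => _; ring.
      by rewrite le_eqVlt; apply/orP; left; apply/eqP; ring.
    rewrite ler_wpM2l // -mulrN ler_wpM2l ?Lp //.
    by rewrite lerNl /n le_max lexx.
  rewrite /psi /pairing big1 // => z _; rewrite /n feynman_kac_id // max_r ?oppr_le0 //.
  by rewrite expr0n mul0r.
have : psi s = 0 by apply/le_anti; rewrite psi0 pairing_ge0 // => z; rewrite ?sqr_ge0 // mu_ge0.
move/eqP; rewrite psumr_eq0 => [|z _]; last by rewrite mulr_ge0 ?sqr_ge0 ?mu_ge0.
move/allP => /(_ x); rewrite mem_index_enum => /(_ isT) /=.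
rewrite mulf_eq0 (gt_eqF (evolving_pos hmu x s0)) orbF expf_eq0 /= /n => /eqP h.
have h2 : - Q s t f x <= Num.max (- Q s t f x) 0 by rewrite le_max lexx.
by rewrite h oppr_le0 in h2.
Qed.

End horizon.

(** * The mean square error as an integral of dispersions *)

Section moments.
Context {R : realType} {S : finType}.
Variables (mu U : R -> S -> R) (lam : R -> R) (L : R -> S -> S -> R).
Variable Q : R -> R -> (S -> R) -> S -> R.
Hypothesis hmu : evolving_measures mu U.
Hypothesis hL : reversible_generators mu L.
Hypothesis hlam : move_rates lam.
Hypothesis hQ : is_feynman_kac mu lam L Q.
Variables (N : nat) (d : measure_display) (T : measurableType d).
Hypothesis N0 : (0 < N)%N.
Variables (P : probability T R) (X : R -> T -> {ffun 'I_N -> S}).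
Hypothesis hX : is_particle_system mu lam L P X.
Local Notation config := {ffun 'I_N -> S}.
Local Notation H := (energy mu).
Local Notation F := (weighted_mean mu P X).
Implicit Types (f g h A B : S -> R) (s t : R) (c : config).

Let Nneq0 : N%:R != 0 :> R. Proof. by rewrite pnatr_eq0 -lt0n. Qed.

Lemma weighted_mean_zero k t : 0 <= t -> F k t (fun=> 0) = 0.
Proof.
move=> t0; rewrite -[RHS](mul0r (F k t (fun=> 0))) -(weighted_meanZ hmu hX) //.
by apply: eq_weighted_mean => c; rewrite mul0r.
Qed.

(** At [k = 1] the discount cancels the product of means in [generator_emp], and the backward
    equation for [Q] cancels the other terms. *)
Lemma weighted_mean_martingale t f : 0 <= t ->
  F 1 t (fun c => emp c f) = pairing f (mu t).
Proof.
move=> t0.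
have -> : F 1 t (fun c => emp c f) = F 1 t (fun c => emp c (Q t t f)).
  by rewrite (feynman_kac_id hQ).
rewrite (derive_eq0_constant (F := fun s => F 1 s (fun c => emp c (Q s t f))) t0).
  rewrite (weighted_mean0 hmu hX) (product_measure_emp N0) //; last exact: (evolving_mass1 hmu).
  by rewrite -(feynman_kac_pairing hmu hL hQ) // lexx.
move=> s st; have /andP[s0 _] := st.
have := weighted_mean_derive hmu hL hlam hX (k := 1) (phi := fun s c => emp c (Q s t f)) st
  (fun c => emp_derive (c := c) (fun x => @feynman_kac_derive _ _ mu lam L Q hQ t f s x st)).
congr (is_derive_within _ _ _ _); rewrite -[RHS](weighted_mean_zero 1 s0).
apply: eq_weighted_mean => c.
by rewrite (generator_emp N0 lam hL) // empB empZ /mean_energy; ring.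
Qed.

(** By [weighted_mean_martingale] the weighted empirical measure is unbiased, so this is the
    covariance of its pairings with [A] and [B]. *)
Definition covariance_error t A B : R :=
  F 2 t (fun c => emp c A * emp c B) - pairing A (mu t) * pairing B (mu t).

Lemma mean_square_error_covariance t f : 0 <= t ->
  mean_square_error mu P X t f = (covariance_error t f f)%:E.
Proof.
move=> t0; rewrite (mean_square_errorE hmu hX) // weighted_mean_martingale //.
congr EFin; rewrite /covariance_error.
under [X in _ = X - _]eq_weighted_mean do rewrite -expr2.
by ring.
Qed.

Definition dispersion s g c : R :=
  emp2 c (selection_gradient mu s g) + emp c (H s) * emp c (fun x => g x ^+ 2)
  - emp c (fun x => H s x * g x ^+ 2).

(** The mean of [Q s t f ^ 2] is linear in the empirical measure but carries the squared discount,
    so one factor [emp c (H s)] is left over. *)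
Lemma weighted_mean_sqr_derive t f s : 0 <= s <= t ->
  is_derive_within `[0, t] (fun u => F 2 u (fun c => emp c (fun x => Q u t f x ^+ 2))) s
    (F 2 s (fun c => lam s * emp c (carre_du_champ L s (Q s t f)) +
       (emp c (fun x => H s x * Q s t f x ^+ 2) - emp c (H s) * emp c (fun x => Q s t f x ^+ 2)))).
Proof.
move=> st; have /andP[s0 _] := st.
have := weighted_mean_derive hmu hL hlam hX (k := 2)
  (phi := fun s c => emp c (fun x => Q s t f x ^+ 2)) st
  (fun c => emp_derive (c := c) (fun x => @feynman_kac_sqr_derive _ _ mu lam L Q hQ t f s x st)).
congr (is_derive_within _ _ _ _); apply: eq_weighted_mean => c.
rewrite (generator_emp N0 lam hL) // empB !empZ /mean_energy.
have -> : emp c (apply_kernel (L s) (fun x => Q s t f x ^+ 2)) =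
    2 * emp c (fun x => Q s t f x * apply_kernel (L s) (Q s t f) x) +
    emp c (carre_du_champ L s (Q s t f)).
  rewrite -empZ -empD; apply: eq_emp => x; rewrite (generator_sqr hL) //; ring.
by ring.
Qed.

(** Here the squared discount matches the degree of the functional, and only the terms of order
    [1 / N] survive. *)
Lemma weighted_mean_quadratic_derive t f s : 0 <= s <= t ->
  is_derive_within `[0, t] (fun u => F 2 u (fun c => emp c (Q u t f) ^+ 2)) s
    (F 2 s (fun c => N%:R^-1 * (lam s * emp c (carre_du_champ L s (Q s t f)) +
        emp2 c (selection_gradient mu s (Q s t f))))).
Proof.
move=> st; have /andP[s0 _] := st.
have dg c := emp_derive (c := c) (fun x => @feynman_kac_derive _ _ mu lam L Q hQ t f s x st).
have := weighted_mean_derive hmu hL hlam hX (k := 2) (phi := fun s c => emp c (Q s t f) ^+ 2) st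
  (fun c => is_derive_withinM (dg c) (dg c)).
congr (is_derive_within _ _ _ _); apply: eq_weighted_mean => c.
by rewrite (generator_emp_sqr lam hL) // (generator_emp N0 lam hL) // empB !empZ /mean_energy; ring.
Qed.

(** The subtracted functional has the same carre du champ in its derivative, so neither [lam] nor
    [L] appears explicitly in the derivative of the difference. *)
Definition excess t f s : R :=
  N%:R * F 2 s (fun c => emp c (Q s t f) ^+ 2) -
  F 2 s (fun c => emp c (fun x => Q s t f x ^+ 2)).

(* The carre du champ terms cancel. *)
Lemma excess_derive t f s : 0 <= s <= t ->
  is_derive_within `[0, t] (excess t f) s (F 2 s (dispersion s (Q s t f))).
Proof.
move=> st; have /andP[s0 _] := st.
have := is_derive_withinB (is_derive_withinZ (c := N%:R) (weighted_mean_quadratic_derive (f := f) st))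
  (weighted_mean_sqr_derive (f := f) st).
congr (is_derive_within _ _ _ _).
rewrite -(weighted_meanZ hmu hX) // -[X in _ - X]mul1r -mulNr -(weighted_meanZ hmu hX) //.
rewrite -(weighted_meanD hmu hX) //; apply: eq_weighted_mean => c.
by rewrite /dispersion mulrA mulfV //; ring.
Qed.

(** For independent particles, [N] times the second moment is [N - 1] times the squared mean plus
    the mean square, and the latter is subtracted. *)
Lemma excess0 t f : 0 <= t -> excess t f 0 = (N%:R - 1) * pairing f (mu t) ^+ 2.
Proof.
move=> t0; rewrite /excess !(weighted_mean0 hmu hX).
have m1 := evolving_mass1 hmu (lexx 0).
under eq_bigr do rewrite expr2.
rewrite (product_measure_emp2 N0 m1) (product_measure_emp N0 m1).
rewrite (feynman_kac_pairing hmu hL hQ (s := 0) f (t := t)) ?lexx //.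
rewrite -[X in _ - X](@eq_pairing _ _ _ (fun x => Q 0 t f x * Q 0 t f x)); last by move=> x; ring.
by field.
Qed.

Lemma covariance_error_excess t f : 0 <= t ->
  N%:R * covariance_error t f f =
  F 2 t (fun c => emp c (fun x => f x ^+ 2)) - pairing f (mu t) ^+ 2 +
  (excess t f t - excess t f 0).
Proof.
move=> t0; rewrite excess0 // /excess (feynman_kac_id hQ) // /covariance_error.
under [X in _ * (X - _)]eq_weighted_mean do rewrite -expr2.
by ring.
Qed.

Lemma covariance_errorE s A B : 0 <= s ->
  F 2 s (fun c => emp c A * emp c B) = pairing A (mu s) * pairing B (mu s) + covariance_error s A B.
Proof. by rewrite /covariance_error addrC subrK. Qed.

Lemma covariance_error_ge0 s A : 0 <= s -> 0 <= covariance_error s A A.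
Proof.
move=> s0; rewrite -lee_fin -mean_square_error_covariance //.
by apply: expectation_ge0 => w; rewrite exprn_ge0.
Qed.

Lemma covariance_error_sqr s A B x y : 0 <= s ->
  covariance_error s (fun z => x * A z + y * B z) (fun z => x * A z + y * B z) =
  x ^+ 2 * covariance_error s A A + y ^+ 2 * covariance_error s B B +
  2 * x * y * covariance_error s A B.
Proof.
move=> s0; rewrite /covariance_error !pairingD !pairingZ.
have -> : F 2 s (fun c => emp c (fun z => x * A z + y * B z) * emp c (fun z => x * A z + y * B z)) =
   F 2 s (fun c => (x ^+ 2 * (emp c A * emp c A) + y ^+ 2 * (emp c B * emp c B)) +
      2 * x * y * (emp c A * emp c B)).
  by apply: eq_weighted_mean => c; rewrite empD !empZ; ring.
rewrite !(weighted_meanD hmu hX) // !(weighted_meanZ hmu hX) //.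
by ring.
Qed.

(* Cauchy-Schwarz for the positive semidefinite form [covariance_error]. *)
Lemma covariance_error_le s A B (e a b : R) : 0 <= s -> 0 < a -> 0 < b ->
  covariance_error s A A <= e * a ^+ 2 -> covariance_error s B B <= e * b ^+ 2 ->
  `|covariance_error s A B| <= e * (a * b).
Proof.
move=> s0 a0 b0 hA hB; have ab0 := mulr_gt0 a0 b0.
have h1 := covariance_error_ge0 (fun z => b * A z + a * B z) s0.
have h2 := covariance_error_ge0 (fun z => b * A z + - a * B z) s0.
rewrite !covariance_error_sqr // in h1 h2.
have hA' : b ^+ 2 * covariance_error s A A <= b ^+ 2 * (e * a ^+ 2) by rewrite ler_wpM2l ?sqr_ge0.
have hB' : a ^+ 2 * covariance_error s B B <= a ^+ 2 * (e * b ^+ 2) by rewrite ler_wpM2l ?sqr_ge0.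
rewrite sqrrN in h2.
rewrite ler_norml; apply/andP; split; rewrite -(ler_pM2l ab0); nra.
Qed.

End moments.

(** * Estimates *)

Lemma lpnorm_norm {R : realType} {S : finType} (m : S -> R) (p : \bar R) (f : S -> R) :
  lpnorm m p (fun x => `|f x|) = lpnorm m p f.
Proof.
case: p => [r| |]; rewrite /lpnorm.
- by congr (_ `^ _); apply: eq_pairing => x; rewrite normr_id.
- by apply: eq_bigr => x _; rewrite normr_id.
- by [].
Qed.

#[local] Opaque lpnorm.

(** The third product counts twice, hence 6 for five terms. *)
Lemma five_term_bound {R : realType} (b D x1 x2 x3 x4 x5 : R) :
  `|x1| <= b -> `|x2| <= b -> `|x3| <= b -> `|x4| <= b -> `|x5| <= b ->
  D <= x1 + x2 - 2 * x3 + x4 - x5 -> D <= 6 * b.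
Proof.
rewrite !ler_norml => /andP[l1 u1] /andP[l2 u2] /andP[l3 u3] /andP[l4 u4] /andP[l5 u5].
by lra.
Qed.

Lemma growth_combine {R : realType} (yt y1 y0 n e K : R) :
  yt <= 17 / 16 * y1 -> y0 <= n -> y1 - y0 <= e * n * K ->
  yt <= 17 / 16 * ((1 + e * K) * n).
Proof. by lra. Qed.

(** As [om * s <= 1 / 17], the tail [l] is at most [3 / 16] of [b], and
    [323 / 256 = (19 / 16) * (17 / 16)]. *)
Lemma apriori_combine {R : realType} (C b m h l n e K om s : R) :
  C = b - m ^+ 2 + (h + l) -> b <= 17 / 16 * ((1 + e * K) * n) ->
  h <= 6 * (1 + e) * n * K -> l <= 3 * om * (17 / 16 * b) * s -> om * s <= 17^-1 -> 0 <= b ->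
  C <= (323 / 256 * (1 + e * K) + 6 * (1 + e) * K) * n.
Proof.
move=> -> hb hh hl hs b0.
have h1 : om * s * b <= 17^-1 * b by rewrite ler_wpM2r.
have := sqr_ge0 m; nra.
Qed.

(** The tail costs [3 / 16] of [b] and [1 / 16] of [m2]. Since [b = m2 + c], what exceeds [m2] is at
    most [m2 / 4 + 19 c / 16], hence at most [(1 / 4 + 19 / 40) n], which is below the one [n]
    allowed. *)
Lemma error_combine {R : realType} (C c m2 m h l n e et K om s V b : R) :
  C = b - m ^+ 2 + (h + l + V) -> b = m2 + c -> c <= et * n -> et <= 2 / 5 ->
  m2 <= n -> 0 <= n -> 0 <= b -> 0 <= m2 -> om * s <= 17^-1 ->
  h <= 6 * e * n * K -> l <= (3 * om * (17 / 16 * b) + om * (17 / 16 * m2)) * s ->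
  C <= m2 - m ^+ 2 + V + (1 + 6 * (e * K)) * n.
Proof.
move=> -> hb hc het m2n n0 b0 m20 hs hh hl.
have h1 : om * s * b <= 17^-1 * b by rewrite ler_wpM2r.
have h2 : om * s * m2 <= 17^-1 * m2 by rewrite ler_wpM2r.
have h3 : et * n <= 2 / 5 * n by rewrite ler_wpM2r.
rewrite hb in hl h1 b0 *; nra.
Qed.

Lemma five_term_excess {R : realType} (D x1 x2 x3 x4 x5 p1 p2 p3 p4 p5 : R) :
  D <= p1 + x1 + (p2 + x2) - 2 * (p3 + x3) + (p4 + x4) - (p5 + x5) ->
  D - (p1 + p2 - 2 * p3 + p4 - p5) <= x1 + x2 - 2 * x3 + x4 - x5.
Proof. by lra. Qed.

Section estimates.
Context {R : realType} {S : finType}.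
Variables (mu U : R -> S -> R) (lam : R -> R) (L : R -> S -> S -> R).
Variable Q : R -> R -> (S -> R) -> S -> R.
Hypothesis hmu : evolving_measures mu U.
Hypothesis hL : reversible_generators mu L.
Hypothesis hlam : move_rates lam.
Hypothesis hQ : is_feynman_kac mu lam L Q.
Variables (N : nat) (d : measure_display) (T : measurableType d).
Hypothesis N0 : (0 < N)%N.
Variables (P : probability T R) (X : R -> T -> {ffun 'I_N -> S}).
Hypothesis hX : is_particle_system mu lam L P X.
Local Notation config := {ffun 'I_N -> S}.
Local Notation H := (energy mu).
Local Notation F := (weighted_mean mu P X).
Local Notation cov := (covariance_error mu P X).
Implicit Types (f g h A B : S -> R) (s : R) (c : config).

Let mpos s : 0 <= s -> forall x, 0 < mu s x.
Proof. by move=> s0 x; exact: (evolving_pos hmu). Qed.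
Let mass s : 0 <= s -> \sum_x mu s x = 1.
Proof. exact: (evolving_mass1 hmu). Qed.
Let mge0 s : 0 <= s -> forall x, 0 <= mu s x.
Proof. by move=> s0 x; apply/ltW/mpos. Qed.

(** [t] is the horizon, [tau] separates head from tail, [e] is an error level for the exponent [a]
    valid up to [t], and [K] bounds the integral of the rate over the head. The exponent [a] will be
    [p] and [pt] in turn. *)
Variables (t a r e om tau K : R) (q : \bar R).
Hypothesis t0 : 0 <= t.
Hypothesis aqr : hoelder_conjugates a q r.
Hypothesis a2 : 2 <= a.
Hypothesis e0 : 0 <= e.
Hypothesis he : forall s h, 0 <= s <= t -> cov s h h <= e * lpnorm (mu s) a%:E h ^+ 2.
Hypothesis om0 : 0 <= om.
Hypothesis hom : forall s x y, 0 <= s <= t -> H s x - H s y <= om.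
Hypothesis tau0t : 0 <= tau <= t.
Hypothesis om_tau : om * (t - tau) <= 17^-1.

Definition rate (s : R) : \bar R :=
  ((lpnorm (mu s) q (H s))%:E * C_fk mu Q s t a%:E q ^+ 2)%E.

Hypothesis K0 : 0 <= K.
Hypothesis hK : (\int[lebesgue_measure]_(s in `[0%R, tau]) rate s <= K%:E)%E.
Hypothesis rE : ((a%:E^-1 - q^-1)^-1)%E = r%:E.

Let a0 : 0 < a. Proof. by apply: lt_le_trans a2. Qed.

Lemma covariance_error_bound s A B : 0 <= s <= t ->
  `|cov s A B| <= e * (lpnorm (mu s) a%:E A * lpnorm (mu s) a%:E B).
Proof.
move=> st; have /andP[s0 _] := st.
have A0 := lpnorm_ge0 (mu s) a%:E A; have B0 := lpnorm_ge0 (mu s) a%:E B.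
have [/eqP A00|Apos] := boolP (lpnorm (mu s) a%:E A == 0).
  have -> : cov s A B = 0.
    rewrite (lpnorm_eq0 (mpos s0) a0 A00) /covariance_error pairing_cst !mul0r subr0.
    rewrite -[RHS](weighted_mean_zero hmu hX 2 s0); apply: eq_weighted_mean => c.
    by rewrite (emp_cst N0) mul0r.
  by rewrite normr0 A00 mul0r mulr0.
have [/eqP B00|Bpos] := boolP (lpnorm (mu s) a%:E B == 0).
  have -> : cov s A B = 0.
    rewrite (lpnorm_eq0 (mpos s0) a0 B00) /covariance_error pairing_cst !(mul0r, mulr0) subr0.
    rewrite -[RHS](weighted_mean_zero hmu hX 2 s0); apply: eq_weighted_mean => c.
    by rewrite (emp_cst N0) mulr0.
  by rewrite normr0 B00 !mulr0.
have Ap : 0 < lpnorm (mu s) a%:E A by rewrite lt_neqAle eq_sym Apos A0.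
have Bp : 0 < lpnorm (mu s) a%:E B by rewrite lt_neqAle eq_sym Bpos B0.
exact: (covariance_error_le hmu hL hlam hQ N0 hX s0 Ap Bp (he A st) (he B st)).
Qed.

Lemma weighted_mean_linear_derive s h : 0 <= s <= t ->
  is_derive_within `[0, t] (fun u => F 2 u (fun c => emp c (Q u t h))) s
    (F 2 s (fun c => - (emp c (H s) * emp c (Q s t h)))).
Proof.
move=> st; have /andP[s0 _] := st.
have := weighted_mean_derive hmu hL hlam hX (k := 2) (phi := fun s c => emp c (Q s t h)) st
  (fun c => emp_derive (c := c) (fun x => @feynman_kac_derive _ _ mu lam L Q hQ t h s x st)).
congr (is_derive_within _ _ _ _); apply: eq_weighted_mean => c.
by rewrite (generator_emp N0 lam hL) // empB empZ /mean_energy; ring.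
Qed.

Lemma rate_ge0 s : (0 <= rate s)%E.
Proof.
apply: mule_ge0; first by rewrite lee_fin lpnorm_ge0.
apply: expe_ge0; apply: (@le_trans _ _ 1%E) => //.
by rewrite /C_fk !le_max lexx !orbT.
Qed.

Section fixed_function.
Variable f : S -> R.
Local Notation g s := (Q s t f).
Local Notation nf := (lpnorm (mu t) a%:E f).
Local Notation hg2 s := (lpnorm (mu s) q (H s) * lpnorm (mu s) (2 * r)%:E (Q s t f) ^+ 2).

(** Uniqueness is not part of [is_feynman_kac]. Here it follows from positivity together with the
    zero mean under the positive measure [mu s]. It covers the zero function, which the suprema in
    [op_norm] leave out. *)
Lemma feynman_kac_zero s : 0 <= s <= t -> Q s t (fun=> 0) = fun=> 0.
Proof.
move=> st; have /andP[s0 _] := st; apply/funext => x.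
have q0 := feynman_kac_ge0 hmu hL hlam hQ t0 (fun x : S => lexx 0).
have := feynman_kac_pairing hmu hL hQ (fun=> 0) st.
rewrite pairing_cst mul0r => /esym/eqP; rewrite psumr_eq0 => [|z _]; last first.
  by rewrite mulr_ge0 ?mge0 // q0.
move/allP => /(_ x); rewrite mem_index_enum => /(_ isT) /=.
by rewrite mulf_eq0 (gt_eqF (mpos s0 x)) orbF => /eqP.
Qed.

Lemma op_norm_bound s (b b' C : R) h : 0 <= s <= t -> 0 < b -> 0 < b' ->
  (op_norm mu Q s t b%:E b'%:E <= C%:E)%E ->
  lpnorm (mu s) b'%:E (Q s t h) <= C * lpnorm (mu t) b%:E h.
Proof.
move=> st b0 b'0 hC; have /andP[s0 _] := st.
have [->|h0] := pselect (h = fun=> 0).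
  by rewrite feynman_kac_zero // !lpnorm0 ?mulr0 //; [exact: mpos|exact: mpos].
have nh : 0 < lpnorm (mu t) b%:E h.
  rewrite lt_neqAle lpnorm_ge0 andbT eq_sym; apply/eqP => /(lpnorm_eq0 (mpos t0) b0).
  exact: h0.
rewrite -ler_pdivrMr // -lee_fin; apply: le_trans hC.
by apply: ereal_sup_ubound; exists h.
Qed.

(* [C_fk >= 1]; when it is infinite the bound is trivial unless the energy
   vanishes, in which case both sides do. *)
Lemma rate_bound s (x y : R) : 0 <= s <= t -> 0 <= y -> (y = 0 -> x = 0) ->
  (forall C : R, 1 <= C -> C_fk mu Q s t a%:E q = C%:E -> x <= y * C ^+ 2) ->
  ((lpnorm (mu s) q (H s) * x)%:E <= y%:E * rate s)%E.
Proof.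
move=> st y0 hxy hx; have H0 := lpnorm_ge0 (mu s) q (H s).
have C1 : (1 <= C_fk mu Q s t a%:E q)%E by rewrite /C_fk !le_max lexx !orbT.
rewrite /rate; case CE : (C_fk mu Q s t a%:E q) C1 => [C| |] // C1.
  rewrite -EFin_expe -!EFinM lee_fin mulrCA ler_wpM2l //.
  by apply: hx => //; rewrite -lee_fin.
have [yE|yneq] := eqVneq y 0; first by rewrite (hxy yE) yE mulr0 mul0e.
have [->|Hneq] := eqVneq (lpnorm (mu s) q (H s)) 0; first by rewrite mul0r mul0e mule0.
have Hpos : 0 < lpnorm (mu s) q (H s) by rewrite lt_neqAle eq_sym Hneq.
have ypos : 0 < y by rewrite lt_neqAle eq_sym yneq.
by rewrite expe2 mulyy gt0_muley ?lte_fin // gt0_muley ?lte_fin // leey.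
Qed.

Lemma feynman_kac_norm_zero s h (b b' : R) : 0 <= s <= t -> 0 < b -> 0 < b' ->
  lpnorm (mu t) b%:E h = 0 -> lpnorm (mu s) b'%:E (Q s t h) = 0.
Proof.
move=> st b0 b'0; have /andP[s0 _] := st.
move/(lpnorm_eq0 (mpos t0) b0) => ->.
by rewrite feynman_kac_zero // lpnorm0 //; exact: mpos.
Qed.

(** The first operator norm in [C_fk], from exponent [a] to [2 * r], squared. *)
Lemma feynman_kac_sqr_rate s : 0 <= s <= t -> ((hg2 s)%:E <= (nf ^+ 2)%:E * rate s)%E.
Proof.
move=> st; have r0 : 0 < r by case: aqr => _ ar _; exact: lt_le_trans ar.
apply: rate_bound => // [||C C1 CE]; first exact: sqr_ge0.
  by move/eqP; rewrite sqrf_eq0 => /eqP /(feynman_kac_norm_zero st a0) -> //; rewrite ?expr0n // mulr_gt0.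
rewrite [leRHS]mulrC -exprMn; apply: lerXn2r; rewrite ?nnegrE ?mulr_ge0 ?lpnorm_ge0 //.
  exact: le_trans C1.
have r20 : 0 < 2 * r by rewrite mulr_gt0.
apply: (op_norm_bound f st a0 r20).
rewrite -CE /C_fk rE le_max; apply/orP; left.
by rewrite -EFinM.
Qed.

(** The second operator norm in [C_fk], from [a / 2] to [a], occurs once; as [C >= 1], its square in
    [rate] dominates it. *)
Lemma feynman_kac_rate s h : 0 <= s <= t ->
  ((lpnorm (mu s) q (H s) * lpnorm (mu s) a%:E (Q s t h))%:E
   <= (lpnorm (mu t) (a / 2)%:E h)%:E * rate s)%E.
Proof.
move=> st; have a20 : 0 < a / 2 by rewrite divr_gt0.
apply: rate_bound => // [||C C1 CE]; first exact: lpnorm_ge0.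
  exact: feynman_kac_norm_zero.
apply: (@le_trans _ _ (C * lpnorm (mu t) (a / 2)%:E h)).
  apply: (op_norm_bound h st a20 a0).
  have e2 : ((2%:E : \bar R)^-1 = (2^-1)%:E)%E by rewrite inver pnatr_eq0.
  rewrite -CE /C_fk e2 -EFinM le_max; apply/orP; right.
  by rewrite le_max; apply/orP; left.
rewrite [leRHS]mulrC ler_wpM2r ?lpnorm_ge0 // expr2 ler_peMl //.
exact: le_trans C1.
Qed.

(** [|H x - H y| <= |H x| + |H y|] reduces the dispersion to products of two empirical means. The
    means of 1 are written out so that all five terms are bilinear. *)
Lemma dispersion_le s c : 0 <= s <= t ->
  dispersion mu s (g s) c <=
    emp c (fun=> 1) * emp c (fun x => `|H s x| * g s x ^+ 2)
  + emp c (fun x => `|H s x|) * emp c (fun x => g s x ^+ 2)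
  - 2 * (emp c (fun x => `|H s x| * g s x) * emp c (g s))
  + emp c (H s) * emp c (fun x => g s x ^+ 2)
  - emp c (fun=> 1) * emp c (fun x => H s x * g s x ^+ 2).
Proof.
move=> st; rewrite /dispersion (emp_cst N0) !mul1r !lerD2r.
have -> : emp c (fun x => `|H s x| * g s x ^+ 2) + emp c (fun x => `|H s x|) * emp c (fun x => g s x ^+ 2)
    - 2 * (emp c (fun x => `|H s x| * g s x) * emp c (g s)) =
    emp2 c (fun x y => `|H s x| * (g s y - g s x) ^+ 2).
  rewrite -[X in X + _ + _]mulr1 -[X in _ * X](emp_cst N0 c) -!emp2_prod -mulNr -emp2Z -!emp2D.
  by apply: eq_emp2 => x y; ring.
rewrite [leRHS]emp2_symmetrize; apply: ler_emp2 => x y; rewrite /selection_gradient.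
rewrite ler_wpM2l ?invr_ge0 // (_ : (g s x - g s y) ^+ 2 = (g s y - g s x) ^+ 2); last by ring.
by rewrite -mulrDl ler_wpM2r ?sqr_ge0 // ler_normB.
Qed.

(** The polynomial of [dispersion_le] with [mu s] for the empirical measure. Its fourth term is
    zero, the energy having mean zero, and is kept to match. *)
Lemma V_fkE s : 0 <= s <= t ->
  V_fk mu Q s t f =
    pairing (fun=> 1) (mu s) * pairing (fun x => `|H s x| * g s x ^+ 2) (mu s)
  + pairing (fun x => `|H s x|) (mu s) * pairing (fun x => g s x ^+ 2) (mu s)
  - 2 * (pairing (fun x => `|H s x| * g s x) (mu s) * pairing (g s) (mu s))
  + pairing (H s) (mu s) * pairing (fun x => g s x ^+ 2) (mu s)
  - pairing (fun=> 1) (mu s) * pairing (fun x => H s x * g s x ^+ 2) (mu s).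
Proof.
move=> /andP[s0 _]; rewrite (pairing_energy hmu) // pairing_cst mass // mul0r addr0 !mul1r /V_fk addrC.
congr (_ - _).
have -> : pairing (fun x => `|H s x| * g s x ^+ 2) (mu s) =
    \sum_x \sum_y `|H s x| * g s x ^+ 2 * mu s x * mu s y.
  by apply: eq_bigr => x _; rewrite -mulr_sumr mass // mulr1.
have pairing_mul A B : pairing A (mu s) * pairing B (mu s) =
    \sum_x \sum_y A x * B y * mu s x * mu s y.
  rewrite /pairing mulr_suml; apply: eq_bigr => x _; rewrite mulr_sumr.
  by apply: eq_bigr => y _; ring.
rewrite !pairing_mul mulr_sumr -sumrN -!big_split /=; apply: eq_bigr => x _.
by rewrite mulr_sumr -sumrN -!big_split; apply: eq_bigr => y _ /=; ring.
Qed.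

(** [Phi] is left abstract to serve twice: as a product of means plus a covariance in the sharp
    estimate, and as the plain second moment in the crude one. *)
Lemma weighted_mean_dispersion s (Phi : (S -> R) -> (S -> R) -> R) : 0 <= s <= t ->
  (forall A B, F 2 s (fun c => emp c A * emp c B) = Phi A B) ->
  F 2 s (dispersion mu s (g s)) <=
    Phi (fun=> 1) (fun x => `|H s x| * g s x ^+ 2)
  + Phi (fun x => `|H s x|) (fun x => g s x ^+ 2)
  - 2 * Phi (fun x => `|H s x| * g s x) (g s)
  + Phi (H s) (fun x => g s x ^+ 2)
  - Phi (fun=> 1) (fun x => H s x * g s x ^+ 2).
Proof.
move=> st hPhi; have /andP[s0 _] := st.
apply: (le_trans (ler_weighted_mean hmu hX 2 s0 (fun c => dispersion_le c st))).
rewrite -!hPhi -mulNr -!(weighted_meanZ hmu hX) // -[X in _ <= _ - X]mul1r -mulNr -!(weighted_meanZ hmu hX) //.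
rewrite -!(weighted_meanD hmu hX) // le_eqVlt; apply/orP; left; apply/eqP.
by apply: eq_weighted_mean => c; ring.
Qed.

(** Each product contains one energy and two factors [Q s t f]. Hoelder's inequality with
    [1 / a = 1 / q + 1 / r] assigns [q] to the energy and [2 * r] to each of the others. *)
Lemma dispersion_norms s : 0 <= s <= t ->
  [/\ lpnorm (mu s) a%:E (fun=> 1) * lpnorm (mu s) a%:E (fun x => `|H s x| * g s x ^+ 2) <= hg2 s,
      lpnorm (mu s) a%:E (fun x => `|H s x|) * lpnorm (mu s) a%:E (fun x => g s x ^+ 2) <= hg2 s,
      lpnorm (mu s) a%:E (fun x => `|H s x| * g s x) * lpnorm (mu s) a%:E (g s) <= hg2 s,
      lpnorm (mu s) a%:E (H s) * lpnorm (mu s) a%:E (fun x => g s x ^+ 2) <= hg2 s &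
      lpnorm (mu s) a%:E (fun=> 1) * lpnorm (mu s) a%:E (fun x => H s x * g s x ^+ 2) <= hg2 s].
Proof.
move=> st; have /andP[s0 _] := st; have m0 := mpos s0; have m1 := mass s0.
have n1 : lpnorm (mu s) a%:E (fun=> 1) <= 1 by rewrite lpnorm_cst1.
have hsq := lpnorm_sqr_le m0 m1 aqr (g s).
have hH := lpnorm_le_conjugate m0 m1 aqr (H s).
have hHg2 := lpnorm_mulr_sqr_le m0 aqr (H s) (g s).
have habsg2 := lpnorm_mulr_sqr_le m0 aqr (fun x => `|H s x|) (g s).
have habsg := lpnorm_mulr_le m0 m1 aqr (fun x => `|H s x|) (g s).
have hg := lpnorm_le_double m0 m1 aqr (g s).
rewrite !lpnorm_norm in habsg2 habsg *.
split.
- rewrite -[leRHS]mul1r; exact: ler_pM (lpnorm_ge0 _ _ _) (lpnorm_ge0 _ _ _) n1 habsg2.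
- exact: ler_pM (lpnorm_ge0 _ _ _) (lpnorm_ge0 _ _ _) hH hsq.
- rewrite expr2 mulrA; exact: ler_pM (lpnorm_ge0 _ _ _) (lpnorm_ge0 _ _ _) habsg hg.
- exact: ler_pM (lpnorm_ge0 _ _ _) (lpnorm_ge0 _ _ _) hH hsq.
- rewrite -[leRHS]mul1r; exact: ler_pM (lpnorm_ge0 _ _ _) (lpnorm_ge0 _ _ _) n1 hHg2.
Qed.

Lemma dispersion_excess_le s : 0 <= s <= t ->
  F 2 s (dispersion mu s (g s)) - V_fk mu Q s t f <= 6 * e * hg2 s.
Proof.
move=> st; have /andP[s0 _] := st.
have [n1 n2 n3 n4 n5] := dispersion_norms st.
have hd := weighted_mean_dispersion st (fun A B => covariance_errorE mu P X A B s0).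
rewrite V_fkE //.
have b A B : lpnorm (mu s) a%:E A * lpnorm (mu s) a%:E B <= hg2 s -> `|cov s A B| <= e * hg2 s.
  by move=> h; apply: (le_trans (covariance_error_bound A B st)); rewrite ler_wpM2l.
rewrite -mulrA.
exact: five_term_bound (b _ _ n1) (b _ _ n2) (b _ _ n3) (b _ _ n4) (b _ _ n5) (five_term_excess hd).
Qed.

(** A second moment is a product of means, bounded by the norms, plus a covariance, bounded by [e]
    times the norms; hence [1 + e]. *)
Lemma dispersion_apriori_le s : 0 <= s <= t ->
  F 2 s (dispersion mu s (g s)) <= 6 * (1 + e) * hg2 s.
Proof.
move=> st; have /andP[s0 _] := st; have m0 := mpos s0; have m1 := mass s0.
have [n1 n2 n3 n4 n5] := dispersion_norms st.
have hd := weighted_mean_dispersion st (fun A B => erefl (F 2 s (fun c => emp c A * emp c B))).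
have a1 : 1 <= a by apply: le_trans a2; rewrite ler1n.
have b A B : lpnorm (mu s) a%:E A * lpnorm (mu s) a%:E B <= hg2 s ->
    `|F 2 s (fun c => emp c A * emp c B)| <= (1 + e) * hg2 s.
  move=> h; rewrite (covariance_errorE _ _ _ _ _ s0) [leRHS]mulrDl mul1r; apply: (le_trans (ler_normD _ _)).
  apply: lerD; last by apply: (le_trans (covariance_error_bound A B st)); rewrite ler_wpM2l.
  rewrite normrM; apply: le_trans h; apply: ler_pM => //; exact: ler_norm_pairing_lpnorm.
rewrite -mulrA.
exact: five_term_bound (b _ _ n1) (b _ _ n2) (b _ _ n3) (b _ _ n4) (b _ _ n5) hd.
Qed.

(** For each pair of particles the selection gradient is at most [om (g x ^ 2 + g y ^ 2)] and the
    energy difference adds at most [om g x ^ 2], which makes [3 * om] on average. No norm of [Q] is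
    used. *)
Lemma dispersion_tail_le s : 0 <= s <= t ->
  F 2 s (dispersion mu s (g s)) <= 3 * om * F 2 s (fun c => emp c (fun x => g s x ^+ 2)).
Proof.
move=> st; have /andP[s0 _] := st.
rewrite -(weighted_meanZ hmu hX) //; apply: (ler_weighted_mean hmu hX 2 s0) => c.
have -> : dispersion mu s (g s) c = emp2 c (fun x y => selection_gradient mu s (g s) x y +
    (g s x ^+ 2 * H s y + - 1 * (H s x * g s x ^+ 2 * 1))).
  rewrite !emp2D (emp2Z c (-1)) (emp2_prod c (fun x => g s x ^+ 2)) (emp2_prod c (fun x => H s x * g s x ^+ 2) (fun=> 1)).
  by rewrite (emp_cst N0) /dispersion; ring.
have -> : 3 * om * emp c (fun x => g s x ^+ 2) =
    emp2 c (fun x y => 2 * om * (g s x ^+ 2 * 1) + om * (1 * g s y ^+ 2)).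
  rewrite emp2D (emp2Z c (2 * om)) (emp2Z c om) (emp2_prod c (fun x => g s x ^+ 2) (fun=> 1)) (emp2_prod c (fun=> 1) (fun y => g s y ^+ 2)).
  by rewrite (emp_cst N0); ring.
apply: ler_emp2 => x y; rewrite /selection_gradient.
have h1 : `|H s x - H s y| <= om.
  by rewrite ler_norml hom // andbT lerNl opprB hom.
have h2 : `|H s x - H s y| * (g s y - g s x) ^+ 2 <= om * (g s y - g s x) ^+ 2.
  by rewrite ler_wpM2r ?sqr_ge0.
have h3 : (H s y - H s x) * g s x ^+ 2 <= om * g s x ^+ 2 by rewrite ler_wpM2r ?sqr_ge0 ?hom.
have h4 : om * (g s y - g s x) ^+ 2 <= om * (2 * (g s x ^+ 2 + g s y ^+ 2)).
  by rewrite ler_wpM2l //; have := sqr_ge0 (g s y + g s x); nra.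
by lra.
Qed.

(** The energy has mean zero, so each value is an average of differences. *)
Lemma energy_bound s x : 0 <= s <= t -> - om <= H s x <= om.
Proof.
move=> st; have /andP[s0 _] := st.
have hH : H s x = pairing (fun y => H s x - H s y) (mu s).
  by rewrite pairingB pairing_cst mass // (pairing_energy hmu) // mulr1 subr0.
have E : om = pairing (fun=> om) (mu s) by rewrite pairing_cst mass // mulr1.
apply/andP; split.
  rewrite {1}E hH -pairingN; apply: ler_pairing => [y|y]; first exact: mge0.
  by rewrite lerNl opprB hom.
rewrite [leRHS]E hH; apply: ler_pairing => [y|y]; [exact: mge0|exact: hom].
Qed.

Lemma V_fk_tail_ge s : 0 <= s <= t ->
  - V_fk mu Q s t f <= om * pairing (fun x => g s x ^+ 2) (mu s).
Proof.
move=> st; have /andP[s0 _] := st; rewrite /V_fk opprD opprK.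
apply: (@le_trans _ _ (pairing (fun x => H s x * g s x ^+ 2) (mu s))).
  rewrite gerDl oppr_le0; apply: sumr_ge0 => x _; apply: sumr_ge0 => y _.
  by rewrite (mulr_ge0 (mulr_ge0 (mulr_ge0 (normr_ge0 _) (sqr_ge0 _)) (mge0 s0 x)) (mge0 s0 y)).
rewrite -pairingZ; apply: ler_pairing => x; first exact: mge0.
by rewrite ler_wpM2r ?sqr_ge0 //; have /andP[] := energy_bound x st.
Qed.

Let sub_interval s : 0 <= s -> `[s, t]%classic `<=` `[0, t]%classic.
Proof. by move=> s0; apply: subset_itvr; rewrite bnd_simp. Qed.

Let tail_in s u : tau <= s -> s <= u <= t -> 0 <= u <= t.
Proof.
by have /andP[h _] := tau0t; move=> h1 /andP[h2 ->]; rewrite (le_trans h) // (le_trans h1).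
Qed.

Let om_tail s : tau <= s -> om * (t - s) <= 17^-1.
Proof. by move=> ts; apply: le_trans om_tau; rewrite ler_wpM2l // lerD2l lerN2. Qed.

Let emp_energy_ge c s h : 0 <= s <= t -> (forall x, 0 <= h x) ->
  `|emp c (H s) * emp c h| <= om * emp c h.
Proof.
move=> st h0; have eh := emp_ge0 c h0; rewrite normrM (ger0_norm eh) ler_wpM2r //.
rewrite -(emp_cst N0 c om) ler_norml -empN; apply/andP; split; apply: ler_emp => x.
  by have /andP[] := energy_bound x st.
by have /andP[] := energy_bound x st.
Qed.

(** Backwards in time the carre du champ only helps, and [H x - H y >= - om] for each pair gives the
    Gronwall rate [om]. *)
Lemma weighted_mean_sqr_growth s : tau <= s <= t ->
  F 2 s (fun c => emp c (fun x => g s x ^+ 2)) <=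
  17 / 16 * F 2 t (fun c => emp c (fun x => f x ^+ 2)).
Proof.
move=> /andP[ts st]; have /andP[tau0 _] := tau0t; have s0 := le_trans tau0 ts.
have idE : (fun c => emp c (fun x => f x ^+ 2)) = (fun c => emp c (fun x => Q t t f x ^+ 2)).
  by rewrite (feynman_kac_id hQ).
rewrite idE.
apply: (backward_growth (k := om) (y := fun s => F 2 s (fun c => emp c (fun x => Q s t f x ^+ 2))) st (om_tail ts)
  (fun u su => is_derive_withinS (sub_interval s0)
     (weighted_mean_sqr_derive hmu hL hlam hQ N0 hX (f := f) (tail_in ts su)))).
  move=> u su; have ut := tail_in ts su; have /andP[u0 _] := ut.
  rewrite -(weighted_meanZ hmu hX) //; apply: (ler_weighted_mean hmu hX 2 u0) => c.
  rewrite -[leLHS]add0r; apply: lerD.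
    rewrite mulr_ge0 ?(hlam.1 u u0) //; apply: emp_ge0 => x.
    exact: (carre_du_champ_ge0 hL).
  have sq x : 0 <= Q u t f x ^+ 2 by exact: sqr_ge0.
  have -> : emp c (fun x => H u x * Q u t f x ^+ 2) - emp c (H u) * emp c (fun x => Q u t f x ^+ 2) =
    emp2 c (fun x y => H u x * Q u t f x ^+ 2 * 1 + - 1 * (Q u t f x ^+ 2 * H u y)).
    rewrite emp2D (emp2Z c (-1)) (emp2_prod c (fun x => Q u t f x ^+ 2)) (emp2_prod c (fun x => H u x * Q u t f x ^+ 2) (fun=> 1)).
    by rewrite (emp_cst N0); ring.
  have -> : - om * emp c (fun x => Q u t f x ^+ 2) = emp2 c (fun x y => - om * (Q u t f x ^+ 2 * 1)).
    by rewrite emp2Z (emp2_prod c (fun x => Q u t f x ^+ 2) (fun=> 1)) (emp_cst N0) mulr1.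
  apply: ler_emp2 => x y; have h := hom y x ut; have := sq x; nra.
by apply: (weighted_mean_ge0 hmu hX 2 t0) => c; apply: emp_ge0 => x; exact: sqr_ge0.
Qed.

Lemma pairing_sqr_growth s : tau <= s <= t ->
  pairing (fun x => g s x ^+ 2) (mu s) <= 17 / 16 * pairing (fun x => f x ^+ 2) (mu t).
Proof.
move=> /andP[ts st]; have /andP[tau0 _] := tau0t; have s0 := le_trans tau0 ts.
have idE : (fun x => f x ^+ 2) = (fun x => Q t t f x ^+ 2) by rewrite (feynman_kac_id hQ).
rewrite idE.
apply: (backward_growth (k := om) (y := fun s => pairing (fun x => Q s t f x ^+ 2) (mu s)) st (om_tail ts)
  (fun u su => is_derive_withinS (sub_interval s0)
     (feynman_kac_sqr_pairing_derive hmu hL hQ (f := f) (tail_in ts su)))).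
  move=> u su; have ut := tail_in ts su; have /andP[u0 _] := ut.
  rewrite -[leLHS]addr0; apply: lerD; last first.
    rewrite mulr_ge0 ?(hlam.1 u u0) //; apply: pairing_ge0 => x; first exact: mge0.
    exact: (carre_du_champ_ge0 hL).
  rewrite -pairingZ; apply: ler_pairing => x; first exact: mge0.
  by rewrite ler_wpM2r ?sqr_ge0 //; have /andP[] := energy_bound x ut.
by apply: pairing_ge0 => x; [exact: mge0|exact: sqr_ge0].
Qed.

Let nf_sqr_ge0 : 0 <= nf ^+ 2. Proof. exact: sqr_ge0. Qed.

Let head_sub : `[0, tau]%classic `<=` `[0, t]%classic.
Proof. by have /andP[_ h] := tau0t; apply: subset_itvl; rewrite bnd_simp. Qed.

Let head_in s : 0 <= s <= tau -> 0 <= s <= t.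
Proof. by have /andP[_ h] := tau0t; move=> /andP[-> /le_trans]; apply. Qed.

(** The function [k = f ^ 2] is itself propagated by [Q], instead of squaring [Q s t f]: its
    weighted mean then changes only through a product with the mean energy. On the head this is a
    covariance, estimated by [rate]; on the tail, positivity of [Q s t k] allows Gronwall. *)
Lemma weighted_mean_sqr_apriori :
  F 2 t (fun c => emp c (fun x => f x ^+ 2)) <= 17 / 16 * ((1 + e * K) * nf ^+ 2).
Proof.
have /andP[tau0 taut] := tau0t.
pose k := fun x => f x ^+ 2.
have k0 x : 0 <= k x by exact: sqr_ge0.
have qk0 s x : 0 <= s <= t -> 0 <= Q s t k x.
  exact: (feynman_kac_ge0 hmu hL hlam hQ t0 k0).
have nk : lpnorm (mu t) (a / 2)%:E k = nf ^+ 2.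
  have a20 : 0 < a / 2 by rewrite divr_gt0.
  have := lpnorm_sqr (mu t) f a20.
  by rewrite (_ : 2 * (a / 2) = a); last by field.
pose y s := F 2 s (fun c => emp c (Q s t k)).
have dy s : 0 <= s <= t -> is_derive_within `[0, t] y s
    (F 2 s (fun c => - (emp c (H s) * emp c (Q s t k)))).
  exact: weighted_mean_linear_derive.
have -> : F 2 t (fun c => emp c (fun x => f x ^+ 2)) = y t by rewrite /y (feynman_kac_id hQ).
have ytau0 : 0 <= y tau.
  by apply: (weighted_mean_ge0 hmu hX 2 tau0) => c; apply: emp_ge0 => x; exact: qk0.
have growth : y t <= 17 / 16 * y tau.
  apply: (forward_growth (k := om) taut om_tau
    (fun u su => is_derive_withinS (sub_interval tau0) (dy u (tail_in (lexx tau) su)))) => //.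
  move=> u su; have ut := tail_in (lexx tau) su; have /andP[u0 _] := ut.
  rewrite /y -(weighted_meanZ hmu hX) //; apply: (ler_weighted_mean hmu hX 2 u0) => c.
  have := emp_energy_ge c ut (fun x => qk0 u x ut).
  by rewrite ler_norml => /andP[+ _]; rewrite lerNl.
have y0 : y 0 <= nf ^+ 2.
  rewrite /y (weighted_mean0 hmu hX) (product_measure_emp N0) ?mass //.
  rewrite -(feynman_kac_pairing hmu hL hQ) ?lexx //.
  exact: (ler_pairing_sqr_lpnorm (mpos t0) (mass t0)).
have head : y tau - y 0 <= e * nf ^+ 2 * K.
  rewrite -lee_fin EFinM.
  have c0 : 0 <= e * nf ^+ 2 by rewrite mulr_ge0.
  have := @derive_le_integral R 0 tau y (fun s => F 2 s (fun c => - (emp c (H s) * emp c (Q s t k))))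
    rate (e * nf ^+ 2) tau0.
  move=> /(_ _ _ c0 (fun s _ => rate_ge0 s)) h.
  apply: le_trans (h _ _ _) _; last by rewrite lee_wpmul2l ?lee_fin.
  - apply: within_continuousS head_sub _.
    apply: (weighted_mean_continuous hmu hL hlam hX) => c.
    apply: within_continuousN; apply: within_continuousM; apply: emp_continuous => x.
      have sub : `[0, t]%classic `<=` `[0, +oo[%classic by exact: subset_itvl.
      exact: within_continuousS sub (@energy_continuous _ _ mu U hmu x).
    exact: (feynman_kac_continuous hQ).
  - by move=> s st; apply: is_derive_withinS head_sub (dy s (head_in st)).
  move=> s sh; have st := head_in sh; have /andP[s0 _] := st.
  apply: (@le_trans _ _ (e * (lpnorm (mu s) q (H s) * lpnorm (mu s) a%:E (Q s t k)))%:E).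
    rewrite lee_fin.
    (* Zero mean of the energy turns this second moment into a covariance. *)
    have -> : F 2 s (fun c => - (emp c (H s) * emp c (Q s t k))) = - cov s (H s) (Q s t k).
      rewrite /covariance_error (pairing_energy hmu) // mul0r subr0 -mulN1r -(weighted_meanZ hmu hX) //.
      by apply: eq_weighted_mean => c; rewrite mulN1r.
    apply: (le_trans (ler_norm _)); rewrite normrN; apply: (le_trans (covariance_error_bound _ _ st)).
    rewrite ler_wpM2l // ler_wpM2r ?lpnorm_ge0 //.
    exact: (lpnorm_le_conjugate (mpos s0) (mass s0) aqr).
  rewrite EFinM (EFinM e) -muleA; apply: lee_wpmul2l; first by rewrite lee_fin.
  by rewrite -nk; exact: feynman_kac_rate.
exact: growth_combine growth y0 head.
Qed.

Lemma dispersion_continuous :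
  {within `[0, t], continuous (fun s => F 2 s (dispersion mu s (g s)))}.
Proof.
have sub : `[0, t]%classic `<=` `[0, +oo[%classic by exact: subset_itvl.
have cH x : {within `[0, t], continuous (fun s => H s x)}.
  exact: within_continuousS sub (@energy_continuous _ _ mu U hmu x).
have cg x : {within `[0, t], continuous (fun s => g s x)} by exact: (feynman_kac_continuous hQ).
have cg2 x : {within `[0, t], continuous (fun s => g s x ^+ 2)}.
  under [X in continuous X]eq_fun do rewrite expr2; exact: within_continuousM.
apply: (weighted_mean_continuous hmu hL hlam hX) => c.
apply: within_continuous_add; last first.
  by apply: within_continuousN; apply: emp_continuous => x; exact: within_continuousM.
apply: within_continuous_add; last first.
  by apply: within_continuousM; apply: emp_continuous => x.
apply: within_continuousM; first exact: within_continuous_cst.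
apply: within_continuous_sum => i; apply: within_continuous_sum => j.
apply: within_continuousM; first exact: within_continuous_cst.
apply: within_continuousM.
  apply: within_continuous_norm; apply: within_continuous_add => //.
  exact: within_continuousN.
under [X in continuous X]eq_fun do rewrite expr2.
by apply: within_continuousM; apply: within_continuous_add => //; exact: within_continuousN.
Qed.

Lemma V_fk_continuous : {within `[0, t], continuous (fun s => V_fk mu Q s t f)}.
Proof.
have sub : `[0, t]%classic `<=` `[0, +oo[%classic by exact: subset_itvl.
have cH x : {within `[0, t], continuous (fun s => H s x)}.
  exact: within_continuousS sub (@energy_continuous _ _ mu U hmu x).
have cm x : {within `[0, t], continuous (fun s => mu s x)}.
  exact: within_continuousS sub (@evolving_continuous _ _ mu U hmu x).
have cg x : {within `[0, t], continuous (fun s => g s x)} by exact: (feynman_kac_continuous hQ).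
apply: within_continuous_add.
  apply: within_continuousN; apply: within_continuous_sum => x.
  apply: within_continuousM => //; apply: within_continuousM => //.
  by under [X in continuous X]eq_fun do rewrite expr2; exact: within_continuousM.
apply: within_continuous_sum => x; apply: within_continuous_sum => y.
apply: within_continuousM => //; apply: within_continuousM => //.
apply: within_continuousM; first exact: within_continuous_norm.
under [X in continuous X]eq_fun do rewrite expr2.
by apply: within_continuousM; apply: within_continuous_add => //; exact: within_continuousN.
Qed.

Lemma excess_derive_on (D : set R) s : D `<=` `[0, t]%classic -> 0 <= s <= t ->
  is_derive_within D (excess mu Q P X t f) s (F 2 s (dispersion mu s (g s))).
Proof.
move=> sub st; apply: is_derive_withinS sub _.
exact: (excess_derive hmu hL hlam hQ N0 hX (f := f) st).
Qed.

Let bt_ge0 : 0 <= F 2 t (fun c => emp c (fun x => f x ^+ 2)).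
Proof.
by apply: (weighted_mean_ge0 hmu hX 2 t0) => c; apply: emp_ge0 => x; exact: sqr_ge0.
Qed.

(** [Y] is [excess] in the crude estimate, and [excess] minus the running integral of [V_fk] in the
    sharp one. *)
Lemma head_bound (Y y : R -> R) C : {within `[0, t], continuous y} ->
  (forall s, 0 <= s <= tau -> is_derive_within `[0, tau] Y s (y s)) -> 0 <= C ->
  (forall s, 0 <= s <= t -> y s <= C * hg2 s) -> Y tau - Y 0 <= C * nf ^+ 2 * K.
Proof.
have /andP[tau0 _] := tau0t; move=> cy dY C0 hy.
have c0 : 0 <= C * nf ^+ 2 by rewrite mulr_ge0.
rewrite -lee_fin EFinM.
have h := @derive_le_integral R 0 tau Y y rate (C * nf ^+ 2) tau0 (within_continuousS head_sub cy)
  dY c0 (fun s _ => rate_ge0 s).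
apply: le_trans (h _) _; last by apply: lee_wpmul2l; [rewrite lee_fin|].
move=> s sh; have st := head_in sh.
apply: (@le_trans _ _ (C * hg2 s)%:E); first by rewrite lee_fin hy.
rewrite EFinM (EFinM C) -muleA; apply: lee_wpmul2l; first by rewrite lee_fin.
exact: feynman_kac_sqr_rate.
Qed.

Lemma covariance_error_apriori :
  N%:R * cov t f f <= (323 / 256 * (1 + e * K) + 6 * (1 + e) * K) * nf ^+ 2.
Proof.
have /andP[tau0 taut] := tau0t.
have head := head_bound (Y := excess mu Q P X t f) dispersion_continuous
  (fun s sh => excess_derive_on head_sub (head_in sh)) (C := 6 * (1 + e)).
have tail := derive_le_increment taut (fun s st => excess_derive_on (sub_interval tau0) (tail_in (lexx tau) st))
  (c := 3 * om * (17 / 16 * F 2 t (fun c => emp c (fun x => f x ^+ 2)))).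
have C0 : 0 <= 6 * (1 + e) by rewrite mulr_ge0 // addr_ge0.
have main : N%:R * cov t f f = F 2 t (fun c => emp c (fun x => f x ^+ 2)) - pairing f (mu t) ^+ 2 +
    (excess mu Q P X t f tau - excess mu Q P X t f 0 +
     (excess mu Q P X t f t - excess mu Q P X t f tau)).
  rewrite (covariance_error_excess hmu hL hQ N0 hX f t0); congr (_ + _).
  set z := excess _ _ _ _ _ _ t; set y := excess _ _ _ _ _ _ tau; set x := excess _ _ _ _ _ _ 0.
  by clearbody x y z; ring.
have {}head := head C0 dispersion_apriori_le.
apply: (apriori_combine main weighted_mean_sqr_apriori head _ om_tau bt_ge0); apply: tail.
move=> s st; have st0 := tail_in (lexx tau) st.
apply: (le_trans (dispersion_tail_le st0)).
by rewrite ler_wpM2l ?mulr_ge0 //; exact: weighted_mean_sqr_growth.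
Qed.

(** The empirical mean of 1 is 1, so the weighted mean of [f ^ 2] equals its mean under [mu t] plus
    the covariance of 1 and [f ^ 2]. This is where the bound on [et] replaces the cruder
    [weighted_mean_sqr_apriori]. *)
Lemma covariance_error_main et : et <= 2 / 5 ->
  cov t (fun=> 1) (fun x => f x ^+ 2) <= et * nf ^+ 2 ->
  N%:R * cov t f f <= variance_wrt (mu t) f + int_V mu Q t f + (1 + 6 * (e * K)) * nf ^+ 2.
Proof.
have /andP[tau0 taut] := tau0t; move=> het hc.
pose J s := \int[lebesgue_measure]_(u in `[0, s]) V_fk mu Q u t f.
pose Y s := excess mu Q P X t f s - J s.
have dY (D : set R) s : D `<=` `[0, t]%classic -> 0 <= s <= t ->
    is_derive_within D Y s (F 2 s (dispersion mu s (g s)) - V_fk mu Q s t f).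
  move=> sub st; apply: is_derive_withinB; first exact: excess_derive_on.
  apply: is_derive_withinS sub _; exact: is_derive_within_integral V_fk_continuous st.
have cy : {within `[0, t], continuous (fun s => F 2 s (dispersion mu s (g s)) - V_fk mu Q s t f)}.
  by apply: within_continuous_add; [exact: dispersion_continuous|apply: within_continuousN; exact: V_fk_continuous].
have C0 : 0 <= 6 * e by rewrite mulr_ge0.
have head := head_bound (Y := Y) cy (fun s sh => dY _ s head_sub (head_in sh)) C0 dispersion_excess_le.
have tail := derive_le_increment taut (fun s st => dY _ s (sub_interval tau0) (tail_in (lexx tau) st))
  (c := 3 * om * (17 / 16 * F 2 t (fun c => emp c (fun x => f x ^+ 2))) +
        om * (17 / 16 * pairing (fun x => f x ^+ 2) (mu t))).
have J0 : J 0 = 0 by rewrite /J set_itv1 Rintegral_set1.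
have bE : F 2 t (fun c => emp c (fun x => f x ^+ 2)) =
    pairing (fun x => f x ^+ 2) (mu t) + cov t (fun=> 1) (fun x => f x ^+ 2).
  have := covariance_errorE mu P X (fun=> 1) (fun x => f x ^+ 2) t0.
  rewrite pairing_cst mass // !mul1r => <-; apply: eq_weighted_mean => c.
  by rewrite (emp_cst N0) mul1r.
have main : N%:R * cov t f f = F 2 t (fun c => emp c (fun x => f x ^+ 2)) - pairing f (mu t) ^+ 2 +
    (Y tau - Y 0 + (Y t - Y tau) + int_V mu Q t f).
  rewrite (covariance_error_excess hmu hL hQ N0 hX f t0); congr (_ + _).
  rewrite /Y J0 -[int_V mu Q t f]/(J t).
  set z := excess _ _ _ _ _ _ t; set y := excess _ _ _ _ _ _ tau; set x := excess _ _ _ _ _ _ 0.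
  by clearbody x y z; ring.
have m2n : pairing (fun x => f x ^+ 2) (mu t) <= nf ^+ 2.
  exact: (ler_pairing_sqr_lpnorm (mpos t0) (mass t0)).
have m20 : 0 <= pairing (fun x => f x ^+ 2) (mu t).
  by apply: pairing_ge0 => x; [exact: mge0|exact: sqr_ge0].
apply: (error_combine main bE hc het m2n nf_sqr_ge0 bt_ge0 m20 om_tau head (tail _)).
move=> s st; have st0 := tail_in (lexx tau) st.
apply: lerD.
  apply: (le_trans (dispersion_tail_le st0)).
  by rewrite ler_wpM2l ?mulr_ge0 //; exact: weighted_mean_sqr_growth.
apply: (le_trans (V_fk_tail_ge st0)).
by rewrite ler_wpM2l //; exact: pairing_sqr_growth.
Qed.

End fixed_function.
End estimates.

(** * Finiteness of the oscillation and of the worst error *)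

Section finiteness.
Context {R : realType} {S : finType}.
Variables (mu U : R -> S -> R) (lam : R -> R) (L : R -> S -> S -> R).
Variable Q : R -> R -> (S -> R) -> S -> R.
Hypothesis hmu : evolving_measures mu U.
Hypothesis hL : reversible_generators mu L.
Hypothesis hlam : move_rates lam.
Hypothesis hQ : is_feynman_kac mu lam L Q.
Local Notation H := (energy mu).
Implicit Types (f g h A B : S -> R) (s t : R).

Let mpos s : 0 <= s -> forall x, 0 < mu s x.
Proof. by move=> s0 x; exact: (evolving_pos hmu). Qed.
Let mass s : 0 <= s -> \sum_x mu s x = 1.
Proof. exact: (evolving_mass1 hmu). Qed.

Lemma energy_bounded t : exists2 M : R, 0 <= M &
  forall s x, 0 <= s <= t -> `|H s x| <= M.
Proof.
have sub : `[0, t]%classic `<=` `[0, +oo[%classic by exact: subset_itvl.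
have /choice[M hM] : forall x, exists M : R, 0 <= M /\ forall s, 0 <= s <= t -> `|H s x| <= M.
  move=> x.
  have [M M0 hM] := within_continuous_bounded
    (within_continuousS sub (@energy_continuous _ _ mu U hmu x)).
  by exists M.
exists (\sum_x M x) => [|s x st]; first by apply: sumr_ge0 => x _; case: (hM x).
rewrite (bigD1 x) //=; apply: (le_trans ((hM x).2 s st)); rewrite lerDl.
by apply: sumr_ge0 => y _; case: (hM y).
Qed.

Lemma omega_fin t0 : 0 <= t0 -> exists om : R,
  [/\ 0 <= om, omega mu t0 = om%:E &
      forall s x y, 0 <= s <= t0 -> H s x - H s y <= om].
Proof.
move=> t00; have [M M0 hM] := energy_bounded t0.
have [x0 _] : exists x : S, true.
  apply/existsP; rewrite -[X in is_true X]negbK negb_exists; apply/negP => /forallP h.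
  have := mass t00; rewrite big1 => [/eqP|x _]; first by rewrite eq_sym oner_eq0.
  by have := h x.
have upper s : 0 <= s <= t0 -> has_ubound (range (H s)).
  by move=> st; exists M => _ [x _ <-]; exact: le_trans (ler_norm _) (hM s x st).
have lower s : 0 <= s <= t0 -> has_lbound (range (H s)).
  move=> st; exists (- M) => _ [x _ <-]; have := hM s x st.
  by rewrite ler_norml => /andP[].
have osc_ge s x y : 0 <= s <= t0 -> H s x - H s y <= osc (H s).
  move=> st; apply: lerB.
    by apply: ub_le_sup; [exact: upper|exists x].
  by apply: ge_inf; [exact: lower|exists y].
have osc_le s : 0 <= s <= t0 -> osc (H s) <= M + M.
  move=> st; rewrite /osc lerBlDr.
  have : - M <= inf (range (H s)).
    apply: lb_le_inf; first by exists (H s x0), x0.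
    by move=> _ [x _ <-]; have := hM s x st; rewrite ler_norml => /andP[].
  have : sup (range (H s)) <= M.
    apply: ge_sup; first by exists (H s x0), x0.
    by move=> _ [x _ <-]; exact: le_trans (ler_norm _) (hM s x st).
  by lra.
have omle : (omega mu t0 <= (M + M)%:E)%E.
  apply: ge_ereal_sup => _ [s st <-]; rewrite lee_fin; apply: osc_le.
  by move: st; rewrite /= in_itv.
have omge s : 0 <= s <= t0 -> ((osc (H s))%:E <= omega mu t0)%E.
  by move=> st; apply: ereal_sup_ubound; exists s => //; rewrite /= in_itv.
have om_ge0 : (0%:E <= omega mu t0)%E.
  have s0 : 0 <= (0 : R) <= t0 by rewrite lexx.
  have h := osc_ge 0 x0 x0 s0; rewrite subrr in h.
  by apply: le_trans (omge 0 s0); rewrite lee_fin.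
case E : (omega mu t0) omle om_ge0 omge => [om| |] // _ om0 omge.
exists om; split => // s x y st; apply: le_trans (osc_ge s x y st) _.
by rewrite -lee_fin; exact: omge.
Qed.

(** If [om = 0], the gap is infinite and the cut falls at 0: the whole interval is tail, at no
    cost. *)
Lemma gap_cutoff t0 t (om : R) : 0 <= om -> omega mu t0 = om%:E -> 0 <= t ->
  let tau := fine (maxe (t%:E - gap mu t0) 0)%E in
  0 <= tau <= t /\ om * (t - tau) <= 17^-1.
Proof.
move=> om0 omE t00; rewrite /gap omE -EFinM inver mulf_eq0 pnatr_eq0 /=.
case: eqVneq => [->|omneq] /=.
  by rewrite addeNy maxNye /= lexx t00 mul0r.
have ompos : 0 < om by rewrite lt_neqAle eq_sym omneq.
rewrite -EFinD -EFin_max /=; split.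
  by rewrite le_max lexx orbT ge_max t00 andbT lerBlDr lerDl invr_ge0 mulr_ge0.
apply: (@le_trans _ _ (om * (17 * om)^-1)); last by rewrite invfM mulrCA divff ?mulr1.
by rewrite ler_wpM2l // lerBlDr -lerBlDl le_max lexx.
Qed.

Lemma le_Cbar t t' p q delta : t <= t' ->
  (Cbar mu Q t p q delta <= Cbar mu Q t' p q delta)%E.
Proof.
move=> tt'; apply: le_ereal_sup => _ [tau taut <-]; exists tau => //.
move: taut; rewrite /= !in_itv /= => /andP[-> h]; exact: le_trans tt'.
Qed.

Lemma integral_rate_le t tau (a : R) q delta : 0 <= tau <= t ->
  (\int[lebesgue_measure]_(s in `[0%R, fine (maxe (tau%:E - delta) 0)])
     rate mu Q tau a q s <= Cbar mu Q t a%:E q delta)%E.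
Proof.
by move=> taut; apply: ereal_sup_ubound; exists tau => //; rewrite /= in_itv.
Qed.

Lemma Cbar_ge0 t (a : R) q delta : 0 <= t -> (0 <= Cbar mu Q t a%:E q delta)%E.
Proof.
move=> t00; have t0t : 0 <= (0 : R) <= t by rewrite lexx.
apply: le_trans (integral_rate_le a q delta t0t); apply: integral_ge0 => s _.
exact: rate_ge0.
Qed.

(** The horizon 0 contributes the value 0; a nonzero function exists because total mass one excludes
    an empty [S]. *)
Lemma v_fk_ge0 t (a : R) : 0 <= t -> 0 < a -> (0 <= v_fk mu Q t a%:E)%E.
Proof.
move=> t00 a0.
have n1 : (fun=> 1 : R) <> (fun=> 0 : R) :> (S -> R).
  move=> h; have := mass t00; rewrite big1 => [/eqP|x _]; first by rewrite eq_sym oner_eq0.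
  by have /eqP := congr1 (fun k => k x) h; rewrite oner_eq0.
apply: ereal_sup_ubound; exists 0, (fun=> 1); split=> //; first by rewrite lexx.
by rewrite /int_V set_itv1 Rintegral_set1 mul0r.
Qed.

Variables (N : nat) (d : measure_display) (T : measurableType d).
Hypothesis N0 : (0 < N)%N.
Variables (P : probability T R) (X : R -> T -> {ffun 'I_N -> S}).
Hypothesis hX : is_particle_system mu lam L P X.
Local Notation config := {ffun 'I_N -> S}.
Local Notation F := (weighted_mean mu P X).
Local Notation cov := (covariance_error mu P X).
Implicit Types (c : config).

(** The worst error can be absorbed into a left-hand side only if it is finite. Positivity of [mu s]
    gives [h x ^ 2 <= W s * n ^ 2], which bounds every squared empirical mean, and the weighted mean
    of the constant [W s] is continuous in [s]. *)
Lemma covariance_error_bounded t (a : R) : 0 <= t -> 2 <= a ->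
  exists2 M : R, 0 <= M &
  forall s h, 0 <= s <= t -> cov s h h <= M * lpnorm (mu s) a%:E h ^+ 2.
Proof.
move=> t00 a2.
have sub : `[0, t]%classic `<=` `[0, +oo[%classic by exact: subset_itvl.
pose W s := \sum_x (mu s x)^-1.
have W0 s : 0 <= s -> 0 <= W s.
  by move=> s0; apply: sumr_ge0 => x _; rewrite invr_ge0 ltW ?mpos.
have cW : {within `[0, t], continuous W}.
  apply: within_continuous_sum => x; apply: within_continuousV.
    by move=> s; rewrite /= in_itv /= => /andP[s0 _]; rewrite gt_eqF ?mpos.
  exact: within_continuousS sub (@evolving_continuous _ _ mu U hmu x).
have [M M0 hM] := within_continuous_bounded
  (weighted_mean_continuous hmu hL hlam hX (k := 2) (phi := fun s _ => W s) (fun=> cW)).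
exists M => // s h st; have /andP[s0 _] := st.
set n := lpnorm (mu s) a%:E h.
have hx x : h x ^+ 2 <= W s * n ^+ 2.
  have h1 : h x ^+ 2 * mu s x <= n ^+ 2.
    apply: le_trans (ler_pairing_sqr_lpnorm (mpos s0) (mass s0) h a2).
    rewrite /pairing (bigD1 x) //= lerDl; apply: sumr_ge0 => y _.
    by rewrite mulr_ge0 ?sqr_ge0 // ltW ?mpos.
  have h2 : (mu s x)^-1 <= W s.
    rewrite /W (bigD1 x) //= lerDl; apply: sumr_ge0 => y _.
    by rewrite invr_ge0 ltW ?mpos.
  apply: (@le_trans _ _ ((mu s x)^-1 * n ^+ 2)); last by rewrite ler_wpM2r ?sqr_ge0.
  by rewrite ler_pdivlMl ?mpos // mulrC.
have hemp c : emp c h * emp c h <= W s * n ^+ 2.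
  set m := Num.sqrt (W s * n ^+ 2).
  have W2 : 0 <= W s * n ^+ 2 by rewrite mulr_ge0 ?sqr_ge0 ?W0.
  have mE : m ^+ 2 = W s * n ^+ 2 by rewrite sqr_sqrtr.
  have hm x : `|h x| <= m.
    by rewrite -sqrtr_sqr ler_sqrt.
  have : `|emp c h| <= m.
    rewrite ler_norml -(emp_cst N0 c m) -empN; apply/andP; split; apply: ler_emp => x.
      by have := hm x; rewrite ler_norml => /andP[].
    by have := hm x; rewrite ler_norml => /andP[].
  rewrite -expr2 -mE -[emp c h ^+ 2]real_normK ?num_real // => hh.
  by apply: lerXn2r => //; rewrite nnegrE // sqrtr_ge0.
apply: (@le_trans _ _ (F 2 s (fun c => emp c h * emp c h))).
  by rewrite /covariance_error lerBlDr lerDl -expr2 sqr_ge0.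
apply: (le_trans (ler_weighted_mean hmu hX 2 s0 hemp)).
have -> : F 2 s (fun=> W s * n ^+ 2) = n ^+ 2 * F 2 s (fun=> W s).
  rewrite -(weighted_meanZ hmu hX) //; apply: eq_weighted_mean => c; exact: mulrC.
rewrite mulrC ler_wpM2r ?sqr_ge0 //; exact: le_trans (ler_norm _) (hM s st).
Qed.

Lemma worst_error_fin t (a : R) : 0 <= t -> 2 <= a -> exists e : R,
  [/\ 0 <= e, worst_error mu P X t a%:E = e%:E &
      forall s h, 0 <= s <= t -> cov s h h <= e * lpnorm (mu s) a%:E h ^+ 2].
Proof.
move=> t00 a2; have [M M0 hM] := covariance_error_bounded t00 a2.
have a0 : 0 < a by apply: lt_le_trans a2.
have ub s h : 0 <= s <= t -> lpnorm (mu s) a%:E h <= 1 ->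
    ((cov s h h)%:E <= worst_error mu P X t a%:E)%E.
  move=> st h1; have /andP[s0 _] := st; apply: ereal_sup_ubound; exists s, h; split=> //.
  by rewrite (mean_square_error_covariance hmu hL hlam hQ N0 hX).
have we_le : (worst_error mu P X t a%:E <= M%:E)%E.
  apply: ge_ereal_sup => _ [s [h [st h1 ->]]]; have /andP[s0 _] := st.
  rewrite (mean_square_error_covariance hmu hL hlam hQ N0 hX) // lee_fin.
  apply: (le_trans (hM s h st)); rewrite -[leRHS]mulr1 ler_wpM2l //.
  by apply: exprn_ile1 => //; exact: lpnorm_ge0.
have we_ge0 : (0%:E <= worst_error mu P X t a%:E)%E.
  have t0t : 0 <= (0 : R) <= t by rewrite lexx.
  have := ub 0 (fun=> 0) t0t; rewrite (lpnorm0 (mpos (lexx 0)) a0) => /(_ ler01).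
  apply: le_trans; rewrite lee_fin.
  exact: (covariance_error_ge0 hmu hL hlam hQ N0 hX).
case E : (worst_error mu P X t a%:E) we_le we_ge0 ub => [e| |] // _ e0 ub.
exists e; split => // s h st; have /andP[s0 _] := st.
set n := lpnorm (mu s) a%:E h.
have [n0|nneq] := eqVneq n 0.
  by have := hM s h st; rewrite -/n n0 expr0n /= !mulr0.
have npos : 0 < n by rewrite lt_neqAle eq_sym nneq lpnorm_ge0.
(* Normalisation to the unit sphere; [covariance_error_sqr] with second coefficient 0 gives the
   quadratic scaling. *)
have := ub s (fun x => n^-1 * h x) st.
rewrite (lpnormZ (mpos s0)) // -/n ger0_norm ?invr_ge0 ?(ltW npos) // mulVf // lexx => /(_ isT).
rewrite lee_fin.
have := covariance_error_sqr hmu hX h h n^-1 0 s0.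
have -> : (fun z => n^-1 * h z + 0 * h z) = fun z => n^-1 * h z.
  by apply/funext => z; rewrite mul0r addr0.
move=> ->; rewrite expr0n /= mul0r addr0 mulr0 mul0r addr0 exprVn.
by rewrite ler_pdivrMl ?exprn_gt0 // mulrC.
Qed.

End finiteness.

(** * Exponents, arithmetic and the closing argument *)

Lemma conjugate_exponents {R : realType} (q : \bar R) (p pt : R) :
  (6%:E < q)%E -> p_lower q < p -> (p%:E < q)%E ->
  ((pt%:E)^-1 = q^-1 + ((p / 2)%:E)^-1)%E ->
  [/\ 4 < p, 2 < pt, pt <= p / 2,
    hoelder_conjugates pt q (p / 2) /\ ((pt%:E^-1 - q^-1)^-1)%E = (p / 2)%:E &
    exists2 r, hoelder_conjugates p q r & ((p%:E^-1 - q^-1)^-1)%E = r%:E].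
Proof.
case: q => [q| |] //; rewrite ?lte_fin.
- move=> q6; rewrite /p_lower => pl pq.
  have q0 : 0 < q by lra.
  have hl : 4 * q < p * (q - 2) by rewrite -ltr_pdivrMr //; lra.
  have p4 : 4 < p by nra.
  have p0 : 0 < p by lra.
  rewrite !inver (gt_eqF q0).
  have -> : (p / 2 == 0) = false by apply/gt_eqF; lra.
  case: eqVneq => // pt0; rewrite -EFinD => -[ptE].
  have ptE' : pt = p * q / (p + 2 * q).
    by rewrite -[pt]invrK ptE; field; rewrite ?gt_eqF //; lra.
  have d0 : 0 < p + 2 * q by lra.
  have pt2 : 2 < pt by rewrite ptE' ltr_pdivlMr //; nra.
  have ptp : pt < p / 2 by rewrite ptE' ltr_pdivrMr //; nra.
  have p2 : p / 2 = (pt^-1 - q^-1)^-1 by rewrite ptE addrAC subrr add0r invrK.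
  split=> //; first exact: ltW.
    split; first by split; [lra|lra|right; exists q; split=> //; lra].
    rewrite -EFinN -EFinD inver ptE addrAC subrr add0r invrK.
    by have -> : ((p / 2)^-1 == 0) = false by apply/gt_eqF; rewrite invr_gt0; lra.
  have r0 : 0 < p^-1 - q^-1 by rewrite subr_gt0 ltf_pV2.
  exists (p^-1 - q^-1)^-1.
    split=> //; last by right; exists q.
    by rewrite -[leLHS]invrK lef_pV2 ?posrE ?invr_gt0 // gerBl invr_ge0 ltW.
  by rewrite (gt_eqF p0) -EFinN -EFinD inver (gt_eqF r0).
- move=> _; rewrite /p_lower => p4 _; have p0 : 0 < p by lra.
  have p20 : 0 < p / 2 by lra.
  rewrite invey add0e !inver (gt_eqF p20) (gt_eqF p0); case: eqVneq => // pt0 -[ptE].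
  have {ptE}-> : pt = p / 2 by rewrite -[pt]invrK ptE invrK.
  split=> //; first by lra.
    split; first by split=> //; left.
    by rewrite sube0 inver invr_eq0 (gt_eqF p20) invrK.
  exists p; first by split=> //; left.
  by rewrite sube0 inver invr_eq0 (gt_eqF p0) invrK.
Qed.

Lemma apriori_arith_ge0 {R : realType} (e K : R) : 0 <= e -> 0 <= K ->
  0 <= 323 / 256 * (1 + e * K) + 6 * (1 + e) * K.
Proof. by move=> e0 K0; have eK := mulr_ge0 e0 K0; nra. Qed.

(** After division by [n], the coefficient of [e] on the right is at most
    [(323 / 256 + 6) / 25 < 0.3], and the rest is at most [323 / 12800 + 6 / 25 < 0.27]. Hence
    [e < 0.27 / 0.7 < 2 / 5]. *)
Lemma apriori_arith {R : realType} (n e K : R) : 50 <= n -> 0 <= e -> 25 * K <= n ->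
  n * e <= 323 / 256 * (1 + e * K) + 6 * (1 + e) * K -> e <= 2 / 5.
Proof.
move=> n50 e0 hK h.
have h1 : 25 * K * e <= n * e by rewrite ler_wpM2r.
rewrite leNgt; apply/negP => e25.
have h2 : n * (2 / 5) < n * e by rewrite ltr_pM2l //; lra.
nra.
Qed.

Section bounds.
Context {R : realType} {S : finType}.
Variables (mu U : R -> S -> R) (lam : R -> R) (L : R -> S -> S -> R).
Variable Q : R -> R -> (S -> R) -> S -> R.
Hypothesis hmu : evolving_measures mu U.
Hypothesis hL : reversible_generators mu L.
Hypothesis hlam : move_rates lam.
Hypothesis hQ : is_feynman_kac mu lam L Q.
Variables (N : nat) (d : measure_display) (T : measurableType d).
Hypothesis N50 : 50 <= N%:R :> R.
Variables (P : probability T R) (X : R -> T -> {ffun 'I_N -> S}).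
Hypothesis hX : is_particle_system mu lam L P X.
Local Notation cov := (covariance_error mu P X).
Variables (t0 t a r K e : R) (q : \bar R).
Hypothesis tt0 : 0 <= t <= t0.
Hypothesis aqr : hoelder_conjugates a q r.
Hypothesis rE : ((a%:E^-1 - q^-1)^-1)%E = r%:E.
Hypothesis a2 : 2 <= a.
Hypothesis KE : Cbar mu Q t a%:E q (gap mu t0) = K%:E.
Hypothesis K0 : 0 <= K.
Hypothesis KN : 25 * K <= N%:R.
Hypothesis e0 : 0 <= e.
Hypothesis eE : worst_error mu P X t a%:E = e%:E.
Hypothesis he : forall s h, 0 <= s <= t -> cov s h h <= e * lpnorm (mu s) a%:E h ^+ 2.
Implicit Types (f : S -> R) (s : R).

Let N0 : (0 < N)%N.
Proof. by rewrite -(ltr_nat R); apply: lt_le_trans N50. Qed.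

(** Each [s] up to [t] is a horizon in its own right, with the same [e] and [K]: [Cbar] is a
    supremum over horizons, and [he] holds at all times up to [t]. *)
Lemma apriori_bound s f : 0 <= s <= t ->
  N%:R * cov s f f <= (323 / 256 * (1 + e * K) + 6 * (1 + e) * K) * lpnorm (mu s) a%:E f ^+ 2.
Proof.
move=> /[dup] st0 /andP[s0 st]; have /andP[t00 tt] := tt0.
have [om [om0 omE hom]] := omega_fin hmu (le_trans t00 tt).
have [taus omtau] := gap_cutoff om0 omE s0.
have hK := integral_rate_le mu Q a q (gap mu t0) st0; rewrite KE in hK.
apply: (covariance_error_apriori hmu hL hlam hQ N0 hX s0 aqr a2 e0 _ om0 _ taus omtau hK rE).
  by move=> u h /andP[u0 us]; apply: he; rewrite u0 (le_trans us).
by move=> u x y /andP[u0 us]; apply: hom; rewrite u0 (le_trans us (le_trans st tt)).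
Qed.

Lemma main_bound s f et : 0 <= s <= t -> et <= 2 / 5 ->
  cov s (fun=> 1) (fun x => f x ^+ 2) <= et * lpnorm (mu s) a%:E f ^+ 2 ->
  N%:R * cov s f f <= variance_wrt (mu s) f + int_V mu Q s f +
     (1 + 6 * (e * K)) * lpnorm (mu s) a%:E f ^+ 2.
Proof.
move=> /[dup] st0 /andP[s0 st]; have /andP[t00 tt] := tt0.
have [om [om0 omE hom]] := omega_fin hmu (le_trans t00 tt).
have [taus omtau] := gap_cutoff om0 omE s0.
have hK := integral_rate_le mu Q a q (gap mu t0) st0; rewrite KE in hK.
apply: (covariance_error_main hmu hL hlam hQ N0 hX s0 aqr a2 e0 _ om0 _ taus omtau hK rE).
  by move=> u h /andP[u0 us]; apply: he; rewrite u0 (le_trans us).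
by move=> u x y /andP[u0 us]; apply: hom; rewrite u0 (le_trans us (le_trans st tt)).
Qed.

Lemma worst_error_le b : 0 <= b ->
  (forall s f, 0 <= s <= t -> lpnorm (mu s) a%:E f <= 1 -> N%:R * cov s f f <= b) ->
  N%:R * e <= b.
Proof.
move=> b0 hb; rewrite mulrC -ler_pdivlMr ?ltr0n // -lee_fin -eE.
apply: ge_ereal_sup => _ [s [f [st f1 ->]]]; have /andP[s0 _] := st.
rewrite (mean_square_error_covariance hmu hL hlam hQ N0 hX) // lee_fin.
by rewrite ler_pdivlMr ?ltr0n // mulrC; exact: hb.
Qed.

(** The supremum over the unit ball turns the a priori bound into an inequality for the finite
    number [e] itself. *)
Lemma worst_error_le_two_fifths : e <= 2 / 5.
Proof.
have B0 := apriori_arith_ge0 e0 K0.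
apply: (apriori_arith N50 e0 KN); apply: worst_error_le => // s f st f1.
apply: (le_trans (apriori_bound f st)).
rewrite -[leRHS]mulr1 ler_wpM2l // exprn_ile1 //; exact: lpnorm_ge0.
Qed.

End bounds.

(* [(1 - 6 x) (1 + 10 x) >= 1] for [0 <= x <= 1 / 15], with [x = K / n]. *)
Lemma worst_error_arith {R : realType} (n e K v : R) : 50 <= n -> 0 <= K -> 25 * K <= n ->
  0 <= e -> 0 <= v -> n * e <= 2 + v + 6 * (e * K) ->
  e <= (2 + v) * n^-1 * (1 + 10 * K * n^-1).
Proof.
move=> n50 K0 hK e0 v0 h; have n0 : 0 < n by lra.
set x := K / n.
have x0 : 0 <= x by rewrite divr_ge0 // ltW.
have x25 : x <= 1 / 25 by rewrite ler_pdivrMr //; lra.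
have KE : K = x * n by rewrite divfK ?gt_eqF.
have -> : 10 * K * n^-1 = 10 * x by rewrite -mulrA.
clearbody x.
have h1 : e * (1 - 6 * x) <= (2 + v) * n^-1.
  by rewrite ler_pdivlMr //; rewrite KE in h; lra.
have h2 : 0 <= (2 + v) * n^-1 by rewrite divr_ge0 ?ltW //; lra.
have h3 : e * (1 - 6 * x) * (1 + 10 * x) <= (2 + v) * n^-1 * (1 + 10 * x).
  by rewrite ler_wpM2r //; lra.
apply: le_trans h3; rewrite -subr_ge0.
have -> : e * (1 - 6 * x) * (1 + 10 * x) - e = e * (4 * x * (1 - 15 * x)) by ring.
by rewrite !mulr_ge0 //; lra.
Qed.

Lemma Cbar_fin {R : realType} {S : finType} (mu : R -> S -> R) Q (t t0 a n : R) q delta :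
  0 <= t <= t0 -> (25%:E * Cbar mu Q t0 a%:E q delta <= n%:E)%E ->
  exists K, [/\ Cbar mu Q t a%:E q delta = K%:E, 0 <= K & 25 * K <= n].
Proof.
move=> /andP[t00 tt] h.
have c0 := Cbar_ge0 mu Q a q delta t00.
have : (25%:E * Cbar mu Q t a%:E q delta <= n%:E)%E.
  by apply: le_trans h; apply: lee_wpmul2l; [rewrite lee_fin|exact: le_Cbar].
case: (Cbar mu Q t a%:E q delta) c0 => [K| |] //.
  by move=> K0 hK; exists K; split.
by move=> _; rewrite gt0_muley ?lte_fin.
Qed.

Lemma normalized_arith {R : realType} (a b v c m : R) : a <= m -> b <= v * m ->
  a + b + (1 + 6 * c) * m <= (2 + v + 6 * c) * m.
Proof. by move=> am bvm; lra. Qed.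

Section conclusion.
Context {R : realType} {S : finType}.
Variables (mu U : R -> S -> R) (lam : R -> R) (L : R -> S -> S -> R).
Variable Q : R -> R -> (S -> R) -> S -> R.
Hypothesis hmu : evolving_measures mu U.
Hypothesis hL : reversible_generators mu L.
Hypothesis hlam : move_rates lam.
Hypothesis hQ : is_feynman_kac mu lam L Q.
Variables (N : nat) (d : measure_display) (T : measurableType d).
Hypothesis N50 : 50 <= N%:R :> R.
Variables (P : probability T R) (X : R -> T -> {ffun 'I_N -> S}).
Hypothesis hX : is_particle_system mu lam L P X.
Local Notation cov := (covariance_error mu P X).
Variables (t0 p pt r t : R) (q : \bar R).
Hypothesis tt0 : 0 <= t <= t0.
Hypothesis pqr : hoelder_conjugates p q r.
Hypothesis rE : ((p%:E^-1 - q^-1)^-1)%E = r%:E.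
Hypothesis ptq : hoelder_conjugates pt q (p / 2).
Hypothesis ptE : ((pt%:E^-1 - q^-1)^-1)%E = (p / 2)%:E.
Hypothesis p4 : 4 < p.
Hypothesis pt2 : 2 < pt.
Hypothesis ptp : pt <= p / 2.
Hypothesis Np : (25%:E * Cbar mu Q t0 p%:E q (gap mu t0) <= N%:R%:E)%E.
Hypothesis Npt : (25%:E * Cbar mu Q t0 pt%:E q (gap mu t0) <= N%:R%:E)%E.
Implicit Types (f : S -> R) (s : R).

Let N0 : (0 < N)%N.
Proof. by rewrite -(ltr_nat R); apply: lt_le_trans N50. Qed.

(* The covariance of [1] and [f ^ 2] is controlled with the exponent [pt],
   for which [f ^ 2] has norm at most [lpnorm (mu s) p f ^ 2]. *)
Lemma covariance_one_sqr_le : exists2 et : R, et <= 2 / 5 &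
  forall s f, 0 <= s <= t ->
    cov s (fun=> 1) (fun x => f x ^+ 2) <= et * lpnorm (mu s) p%:E f ^+ 2.
Proof.
have /andP[t00 _] := tt0.
have [K [KE K0 KN]] := Cbar_fin tt0 Npt.
have [et [et0 etE het]] := worst_error_fin hmu hL hlam hQ N0 hX t00 (ltW pt2).
have et25 := worst_error_le_two_fifths hmu hL hlam hQ N50 hX tt0 ptq ptE (ltW pt2) KE K0 KN et0 etE het.
exists et; first exact: et25.
move=> s f st; have /andP[s0 _] := st.
have mpos x : 0 < mu s x by exact: (evolving_pos hmu).
have mass : \sum_x mu s x = 1 by exact: (evolving_mass1 hmu).
apply: (le_trans (ler_norm _)).
apply: (le_trans (covariance_error_bound hmu hL hlam hQ N0 hX (ltW pt2) het _ _ st)).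
have pt0 : 0 < pt by apply: lt_trans pt2.
have p20 : 0 < p / 2 by apply: lt_le_trans ptp.
rewrite (lpnorm_cst1 mass pt0) mul1r; apply: (ler_wpM2l et0).
apply: (le_trans (lpnorm_mono mpos mass _ pt0 ptp)).
by rewrite (lpnorm_sqr _ _ p20) [2 * _]mulrC divfK ?pnatr_eq0 ?lexx.
Qed.

Lemma mean_square_error_le f :
  (N%:R%:E * mean_square_error mu P X t f
     <= (variance_wrt (mu t) f + int_V mu Q t f)%:E
        + (1 + 7%:E * Cbar mu Q t p%:E q (gap mu t0) * worst_error mu P X t p%:E)
          * (lpnorm (mu t) p%:E f ^+ 2)%:E)%E.
Proof.
have /andP[t00 _] := tt0.
have p2 : 2 <= p by apply: le_trans (ltW p4); rewrite ler_nat.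
have [K [KE K0 KN]] := Cbar_fin tt0 Np.
have [e [e0 eE he]] := worst_error_fin hmu hL hlam hQ N0 hX t00 p2.
have [et het hc] := covariance_one_sqr_le.
have tt : 0 <= t <= t by rewrite t00 lexx.
have h := main_bound hmu hL hlam hQ N50 hX tt0 pqr rE p2 KE e0 he tt het (hc t f tt).
rewrite KE eE (mean_square_error_covariance hmu hL hlam hQ N0 hX) //.
rewrite -!EFinM -!EFinD lee_fin; apply: (le_trans h).
(* The constant obtained is 6, weakened here to the stated 7. *)
rewrite lerD2l ler_wpM2r ?sqr_ge0 // lerD2l (mulrC e) mulrA ler_wpM2r // ler_wpM2r //.
by rewrite ler_nat.
Qed.

(** The 2 collects the variance, which is at most the squared norm, and the unit remainder of
    [main_bound]. The resulting [N * e <= 2 + v + 6 * (e * K)] is solved for [e] by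
    [worst_error_arith]. *)
Lemma worst_error_bound :
  (worst_error mu P X t p%:E
     <= (2%:E + v_fk mu Q t p%:E) * (N%:R^-1)%:E
        * (1 + 10%:E * Cbar mu Q t p%:E q (gap mu t0) * (N%:R^-1)%:E))%E.
Proof.
have /andP[t00 _] := tt0.
have p2 : 2 <= p by apply: le_trans (ltW p4); rewrite ler_nat.
have p0 : 0 < p by apply: lt_trans p4; rewrite ltr0n.
have [K [KE K0 KN]] := Cbar_fin tt0 Np.
have [e [e0 eE he]] := worst_error_fin hmu hL hlam hQ N0 hX t00 p2.
have [et het hc] := covariance_one_sqr_le.
have v0 := v_fk_ge0 Q hmu t00 p0.
have hv s f : 0 <= s <= t -> f <> (fun=> 0) ->
    ((int_V mu Q s f / lpnorm (mu s) p%:E f ^+ 2)%:E <= v_fk mu Q t p%:E)%E.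
  by move=> st f0; apply: ereal_sup_ubound; exists s, f.
have n0 : 0 < N%:R^-1 :> R by rewrite invr_gt0 ltr0n.
have c1 : 0 < 1 + 10 * K / N%:R.
  by apply: ltr_wpDr => //; rewrite !mulr_ge0 // ltW.
rewrite KE eE.
(* An infinite [v_fk] makes the right-hand side infinite, since the factors multiplying it are
   positive. *)
case: (v_fk mu Q t p%:E) v0 hv => [v| |] //; last first.
  move=> _ _; rewrite addey // gt0_mulye ?lte_fin // -!EFinM -EFinD.
  by rewrite gt0_mulye ?lte_fin // leey.
rewrite lee_fin => v0 hv; rewrite -!EFinM lee_fin.
apply: worst_error_arith => //.
have eK := mulr_ge0 e0 K0.
apply: (worst_error_le hmu hL hlam hQ N50 hX eE).
  by rewrite !addr_ge0 // mulr_ge0.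
move=> s f st f1; have /andP[s0 _] := st.
have mpos x : 0 < mu s x by exact: (evolving_pos hmu).
have mass : \sum_x mu s x = 1 by exact: (evolving_mass1 hmu).
have [f0|f0] := pselect (f = fun=> 0).
  have := he s f st; rewrite f0 (lpnorm0 mpos p0) expr0n /= mulr0 => h.
  apply: (@le_trans _ _ 0); first by rewrite mulr_ge0_le0.
  by rewrite !addr_ge0 // mulr_ge0.
have nf0 : 0 < lpnorm (mu s) p%:E f.
  rewrite lt_neqAle lpnorm_ge0 andbT eq_sym; apply/eqP => /(lpnorm_eq0 mpos p0).
  exact: f0.
have n2 : lpnorm (mu s) p%:E f ^+ 2 <= 1 by apply: exprn_ile1 => //; exact: lpnorm_ge0.
have := hv s f st f0; rewrite lee_fin ler_pdivrMr ?exprn_gt0 // => hvf.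
have hvar : variance_wrt (mu s) f <= lpnorm (mu s) p%:E f ^+ 2.
  rewrite /variance_wrt lerBlDr; apply: (le_trans (ler_pairing_sqr_lpnorm mpos mass f p2)).
  by rewrite lerDl sqr_ge0.
apply: (le_trans (main_bound hmu hL hlam hQ N50 hX tt0 pqr rE p2 KE e0 he st het (hc s f st))).
apply: (@le_trans _ _ ((2 + v + 6 * (e * K)) * lpnorm (mu s) p%:E f ^+ 2)).
  exact: normalized_arith hvar hvf.
rewrite -[leRHS]mulr1 ler_wpM2l // !addr_ge0 //; exact: mulr_ge0.
Qed.

End conclusion.

Theorem theorem2p5 (R : realType) (S : finType)
  (mu U : R -> S -> R) (lam : R -> R) (L : R -> S -> S -> R)
  (Q : R -> R -> (S -> R) -> S -> R)
  (hmu : evolving_measures mu U)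
  (hL : reversible_generators mu L)
  (hlam : move_rates lam)
  (hQ : is_feynman_kac mu lam L Q)
  (N : nat) (d : measure_display) (T : measurableType d)
  (P : probability T R) (X : R -> T -> {ffun 'I_N -> S})
  (hX : is_particle_system mu lam L P X)
  (t0 : R) (ht0 : 0 < t0)
  (q : \bar R) (hq : (6%:E < q)%E)
  (p : R) (hp_lower : p_lower q < p) (hp_upper : (p%:E < q)%E)
  (pt : R) (hpt : ((pt%:E)^-1 = q^-1 + ((p / 2)%:E)^-1)%E)
  (hN : (25%:E * maxe 2%:E (maxe (Cbar mu Q t0 p%:E q (gap mu t0))
                                 (Cbar mu Q t0 pt%:E q (gap mu t0)))
         <= N%:R%:E)%E) :
  (forall (t : R) (f : S -> R), 0 <= t <= t0 ->
    (N%:R%:E * mean_square_error mu P X t f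
     <= (variance_wrt (mu t) f + int_V mu Q t f)%:E
        + (1 + 7%:E * Cbar mu Q t p%:E q (gap mu t0)
               * worst_error mu P X t p%:E)
          * (lpnorm (mu t) p%:E f ^+ 2)%:E)%E) /\
  (forall t : R, 0 <= t <= t0 ->
    (worst_error mu P X t p%:E
     <= (2%:E + v_fk mu Q t p%:E) * (N%:R^-1)%:E
        * (1 + 10%:E * Cbar mu Q t p%:E q (gap mu t0) * (N%:R^-1)%:E))%E).
Proof.
have [p4 pt2 ptp [ptq ptE] [r pqr rE]] := conjugate_exponents hq hp_lower hp_upper hpt.
have le25 (x y : \bar R) : (x <= y)%E -> (25%:E * y <= N%:R%:E)%E -> (25%:E * x <= N%:R%:E)%E.
  by move=> xy; apply: le_trans; rewrite lee_wpmul2l ?lee_fin.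
have N50 : 50 <= N%:R :> R.
  have : (25%:E * 2%:E <= N%:R%:E :> \bar R)%E by apply: le25 hN; rewrite le_max lexx.
  by rewrite -EFinM lee_fin -natrM.
have Np : (25%:E * Cbar mu Q t0 p%:E q (gap mu t0) <= N%:R%:E)%E.
  by apply: le25 hN; rewrite le_max; apply/orP; right; rewrite le_max; apply/orP; left; exact: lexx.
have Npt : (25%:E * Cbar mu Q t0 pt%:E q (gap mu t0) <= N%:R%:E)%E.
  by apply: le25 hN; rewrite le_max; apply/orP; right; rewrite le_max; apply/orP; right; exact: lexx.
split=> [t f tt0|t tt0].
  exact: (mean_square_error_le hmu hL hlam hQ N50 hX tt0 pqr rE ptq ptE p4 pt2 ptp Np Npt).
exact: (worst_error_bound hmu hL hlam hQ N50 hX tt0 pqr rE ptq ptE p4 pt2 ptp Np Npt).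
Qed.
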